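(* Let $s=\sigma+it$ with $0<\sigma\le 1$ and $t\ge 0$, let $0<\alpha\le 1$, and let $\psi(u)=u-[u]-\tfrac12$ for real $u$. I) Let $s\ne 1$. For arbitrary $x>0$: (a) $\displaystyle \zeta(s,\alpha)-\frac{x^{1-s}}{s-1}=\sum_{0\le n\le x-\alpha}(n+\alpha)^{-s}+\psi(x-\alpha)\,x^{-s}-s\int_x^\infty\frac{\psi(u-\alpha)}{u^{s+1}}\,du$; (b) for every integer $r\ge 0$, $$\zeta^{(r)}(s,\alpha)-\frac{d^r}{ds^r}\Big(\frac{x^{1-s}}{s-1}\Big)=\sum_{0\le n\le x-\alpha}\frac{d^r}{ds^r}(n+\alpha)^{-s}+\psi(x-\alpha)\frac{d^r}{ds^r}(x^{-s})-\int_x^\infty\frac{\psi(u-\alpha)}{u}\frac{d^r}{ds^r}(su^{-s})\,du .$$ II) Let $s\neq 1$, let $a,q\ge 1$ be integers with $1\le a\le q$, and let $Z(s,a,q)=q^{-s}\zeta(s,\tfrac aq)$. For arbitrary $X>0$: (a) $\displaystyle Z(s,a,q)-\frac{X^{1-s}}{q(s-1)}=\sum_{\substack{n\le X\\ n\equiv a\,(\mathrm{mod}\, q)}}n^{-s}+\psi\Big(\frac{X-a}{q}\Big)X^{-s}-s\,q^{-s}\int_{X/q}^\infty\frac{\psi(u-\frac aq)}{u^{s+1}}\,du$; (b) for every integer $r\ge 0$, $$Z^{(r)}(s,a,q)-\frac1q\frac{d^r}{ds^r}\Big(\frac{X^{1-s}}{s-1}\Big)=\sum_{\substack{n\le X\\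 n\equiv a\,(\mathrm{mod}\, q)}}\frac{d^r}{ds^r}n^{-s}+\psi\Big(\frac{X-a}{q}\Big)\frac{d^r}{ds^r}X^{-s}-\int_{X/q}^\infty\frac{\psi(u-\frac aq)}{u}\frac{d^r}{ds^r}\big(s(qu)^{-s}\big)\,du .$$ III) Let $\chi$ be a non-principal Dirichlet character modulo $q$. For arbitrary $X>0$: (a) $\displaystyle L(s,\chi)=\sum_{a=1}^q\chi(a)\Big\{\sum_{\substack{n\le X\\ n\equiv a\,(\mathrm{mod}\, q)}}n^{-s}+X^{-s}\psi\Big(\frac{X-a}{q}\Big)-\int_{X/q}^\infty\frac{\psi(u-\frac aq)}{u}\,s(qu)^{-s}\,du\Big\}$; (b) for every integer $r\ge 0$, $$L^{(r)}(s,\chi)=\sum_{a=1}^q\chi(a)\Big\{\sum_{\substack{n\le X\\ n\equiv a\,(\mathrm{mod}\, q)}}n^{-s}(-\log n)^r+\psi\Big(\frac{X-a}{q}\Big)\frac{d^r}{ds^r}X^{-s}-\int_{X/q}^\infty\frac{\psi(u-\frac aq)}{u}\frac{d^r}{ds^r}\big(s(qu)^{-s}\big)\,du\Big\}.$$ IV) For arbitrary $x>0$ and $0<\lambda<1$: (a) $$\phi(\lambda,\alpha,s)=\sum_{0\le n\le x-\alpha}e^{2\pi i\lambda n}(n+\alpha)^{-s}+\int_x^\infty\frac{e^{2\pi i\lambda(u-\alpha)}}{u^s}\,du+2\pi i\lambda\int_x^\infty\psi(u-\alpha)\frac{e^{2\pi i\lambda(u-\alpha)}}{u^s}\,du$$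 $$\qquad-s\int_x^\infty\psi(u-\alpha)\frac{e^{2\pi i\lambda(u-\alpha)}}{u^{s+1}}\,du+\frac{e^{2\pi i\lambda(x-\alpha)}}{x^s}\psi(x-\alpha);$$ (b) for every integer $r\ge 0$, $$\phi^{(r)}(\lambda,\alpha,s)=\sum_{0\le n\le x-\alpha}e^{2\pi i\lambda n}\frac{d^r}{ds^r}(n+\alpha)^{-s}+\int_x^\infty e^{2\pi i\lambda(u-\alpha)}\frac{d^r}{ds^r}u^{-s}\,du+2\pi i\lambda\int_x^\infty\psi(u-\alpha)e^{2\pi i\lambda(u-\alpha)}\frac{d^r}{ds^r}u^{-s}\,du$$ $$\qquad-\int_x^\infty\frac{\psi(u-\alpha)}{u}e^{2\pi i\lambda(u-\alpha)}\frac{d^r}{ds^r}(su^{-s})\,du+e^{2\pi i\lambda(x-\alpha)}\psi(x-\alpha)\frac{d^r}{ds^r}x^{-s}.$$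
   Context: $[u]$ denotes the integral part (floor) of a real number $u$. For $0<\alpha\le1$, $\zeta(s,\alpha)$ is the Hurwitz zeta function, $\zeta(s,\alpha)=\sum_{n\ge0}(n+\alpha)^{-s}$ for $\mathrm{Re}\,s>1$, together with its analytic continuation. $L(s,\chi)$ is the Dirichlet $L$-function, $L(s,\chi)=\sum_{n\ge1}\chi(n)n^{-s}$ for $\mathrm{Re}\,s>1$, and its analytic continuation. For $0<\alpha\le1$ and $0<\lambda<1$, $\phi(\lambda,\alpha,s)$ is Lerch's zeta function, $\phi(\lambda,\alpha,s)=\sum_{n\ge0}e^{2\pi i\lambda n}(n+\alpha)^{-s}$ for $\mathrm{Re}\,s>1$, and its analytic continuation (entire in $s$). The superscript $(r)$ denotes the $r$-th derivative with respect to $s$. Sums over $0\le n\le x-\alpha$ run over integers $n$; sums over $n\le X$, $n\equiv a\,(\mathrm{mod}\,q)$ run over positive integers $n$; empty sums are zero. The integrals over $[x,\infty)$ are improper integrals, $\int_x^\infty=\lim_{N\to\infty}\int_x^N$. *)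

(* Defs.v *)
From Stdlib Require Import Reals ZArith.
From Coquelicot Require Import Coquelicot.

Open Scope R_scope.
Open Scope C_scope.

Definition Cexp (z : C) : C :=
  (exp (Re z) * cos (Im z), exp (Re z) * sin (Im z))%R.

(* x^s = exp (s log x) with the real logarithm; only meaningful for 0 < x. *)
Definition Rcpow (x : R) (s : C) : C := Cexp (s * RtoC (ln x)).

Definition expi (v : R) : C := Cexp (0, 2 * PI * v)%R.

(* Int_part is the floor function, also for negative arguments. *)
Definition psi (u : R) : R := (u - IZR (Int_part u) - 1 / 2)%R.

(* Coquelicot's C_derive is a total operator; by C_derive_correct it is the
   complex derivative wherever the function is complex differentiable. *)
Definition C_derive_n (r : nat) (f : C -> C) : C -> C := Nat.iter r C_derive f.

(* Sum of f n over the integers n with 0 <= n <= y; it is 0 when y < 0. *)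
Definition sum_upto (y : R) (f : nat -> C) : C :=
  sum_n (fun n => if Rle_dec (INR n) y then f n else RtoC 0)
        (Z.to_nat (Int_part y)).

(* Sum of f n over the positive integers n <= y with n = a (mod q). *)
Definition sum_upto_mod (y : R) (a q : nat) (f : nat -> C) : C :=
  sum_upto y (fun n =>
    if andb (Nat.leb 1 n) (Nat.eqb (Nat.modulo n q) (Nat.modulo a q))
    then f n else RtoC 0).

Definition is_RInt_infty (f : R -> C) (x : R) (l : C) : Prop :=
  is_RInt_gen (V := C_R_NormedModule) f (at_point x) (Rbar_locally p_infty) l.

Definition analytic_at (F : C -> C) (z : C) : Prop :=
  exists (a : nat -> C) (rho : R), 0 < rho /\
    forall h : C, Cmod h < rho ->
      is_pseries (K := C_AbsRing) (V := C_NormedModule) a h (F (z + h)).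

(* Value at s of the analytic continuation to D of the sum of the series
   sum_n a_n(z), 1 < Re z.  Here D is C or C \ {1}, so that D meets every half
   plane c < Re z in a connected set, and the value at a point s of D is that
   of the analytic continuation to D inside any half plane containing s; by
   the identity theorem it does not depend on the half plane.  iota is
   definite description. *)
Definition continuation (D : C -> Prop) (a : nat -> C -> C) (s : C) : C :=
  iota (T := C_CompleteNormedModule) (fun w : C =>
    exists (c : R) (F : C -> C),
      c < Re s /\
      (forall z : C, D z -> c < Re z -> analytic_at F z) /\
      (forall z : C, 1 < Re z ->
         is_series (K := C_AbsRing) (V := C_NormedModule)
           (fun n => a n z) (F z)) /\
      F s = w).

Definition hurwitz_zeta (alpha : R) : C -> C :=
  continuation (fun z => z <> 1)
    (fun n z => Rcpow (INR n + alpha) (- z)).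

Definition lerch_phi (lambda alpha : R) : C -> C :=
  continuation (fun _ => True)
    (fun n z => expi (lambda * INR n) * Rcpow (INR n + alpha) (- z)).

Definition Z_fun (a q : nat) (s : C) : C :=
  Rcpow (INR q) (- s) * hurwitz_zeta (INR a / INR q) s.

Record dirichlet_character (q : nat) (chi : Z -> C) : Prop := {
  chi_mul : forall m n : Z, chi (m * n)%Z = chi m * chi n;
  chi_periodic : forall n : Z, chi (n + Z.of_nat q)%Z = chi n;
  chi_support : forall n : Z, chi n <> 0 <-> Z.gcd n (Z.of_nat q) = 1%Z
}.

Definition principal (q : nat) (chi : Z -> C) : Prop :=
  forall n : Z, Z.gcd n (Z.of_nat q) = 1%Z -> chi n = 1.

(* The domain is C when chi is non-principal and C \ {1} otherwise.
   The series starts at the integer 1, whence the shift of the index. *)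
Definition dirichlet_L (q : nat) (chi : Z -> C) : C -> C :=
  continuation (fun z => ~ principal q chi \/ z <> 1)
    (fun n z => chi (Z.of_nat (S n)) * Rcpow (INR (S n)) (- z)).

(* Main.v *)
(* For a bounded B the integral of B(u) u^(-z-1) over [x, oo) converges absolutely when Re z > 0, and
   expanding u^(-h) = exp (-h log u) under the integral sign gives its Taylor series at z explicitly: it is
   analytic and may be differentiated under the integral sign, without any use of Cauchy's theorem.
   Partial summation applied to the partial sums of the series shows that the right-hand side of each formula
   with r = 0 is the limit of these partial sums for Re z > 1.  It is analytic for Re z > 0 (away from 1), so it
   is the value of the continuation by the identity theorem, and the formulas with r > 0 follow by
   differentiation.  For Lerch's function the integrals J1 and J2 converge only conditionally; since
   exp (2 pi i lambda u) has a bounded primitive and bounded partial sums over the lattice, integration by parts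
   reduces them to absolutely convergent ones.  For L the pole terms cancel because the sum of chi over the
   residues is zero. *)
Require Import Defs.
From Stdlib Require Import Reals ZArith Lra Lia List Permutation.
From Coquelicot Require Import Coquelicot.

Open Scope R_scope.
Open Scope C_scope.

(** * Complex-valued functions of a real variable *)

(** What makes order r no harder than order 0 is that the objects are families [F k], each member
    having the Taylor coefficients [F (k + j) z / j!] at z; such families are stable under sums,
    scalar factors and multiplication by z, so analyticity and all derivatives are obtained
    together. The kernel is (c u)^(-z) with a free scale c: c = 1 serves zeta and Lerch's function,
    c = q serves Z and L. The logarithms brought in by differentiation and by the expansion in h are
    paid for with half of the decay exponent Re z, which fixes the radius Re z / 8 of the
    expansions. The pole term is the one piece kept outside the Taylor families: its derivatives
    follow a recursion, and its analyticity is checked at x = 1, where x^(1-z) is 1. For Lerch's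
    function neither the lattice sum of exponentials nor psi times the exponential is continuous,
    but their jumps cancel, and their sum has the derivative whose integral is wanted. *)

Notation derC := (@is_derive R_AbsRing C_R_NormedModule).
Notation contC := (@continuous R_UniformSpace C_UniformSpace).
Notation intC := (@is_RInt C_R_NormedModule).

(* Equations in C are often typed in the carrier of a Coquelicot structure, which [ring] does not recognise. *)
Ltac Ceq := match goal with |- ?a = ?b => change (@eq C a b) end.

Ltac cring := first [ring | Ceq; ring].
Ltac cfield := first [field | Ceq; field].

Lemma C_eq (z w : C) : Re z = Re w -> Im z = Im w -> z = w.
Proof. destruct z, w; unfold Re, Im; simpl; congruence. Qed.

Lemma Cmod_norm_R (z : C) : norm (V := C_R_NormedModule) z = Cmod z.
Proof.
  unfold norm; simpl; unfold prod_norm, norm; simpl; unfold abs; simpl.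
  unfold Cmod; f_equal; rewrite <- (pow2_abs (fst z)), <- (pow2_abs (snd z)); simpl; reflexivity.
Qed.

Lemma scal_C_R (a : R) (z : C) : scal (V := C_R_NormedModule) a z = RtoC a * z.
Proof. destruct z as [u v]; apply C_eq; unfold scal, Re, Im; simpl; unfold prod_scal, scal; simpl; unfold mult; simpl; ring. Qed.

Lemma is_derive_eq {K : AbsRing} {V : NormedModule K} (f : K -> V) (x : K) (a b : V) :
  is_derive f x a -> a = b -> is_derive f x b.
Proof. intros H <-; exact H. Qed.

(** The pair is f (1,0) + g (0,1), and a scalar function times a fixed vector is differentiated in
    its scalar factor. *)
Lemma derC_pair (f g : R -> R) (x a b : R) :
  is_derive f x a -> is_derive g x b ->
  derC (fun u => (f u, g u) : C) x (a, b).
Proof.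
  intros Hf Hg.
  assert (H := is_derive_plus (K := R_AbsRing) (V := C_R_NormedModule) _ _ _ _ _
    (is_derive_scal_l (V := C_R_NormedModule) f x a (1, 0)%R Hf)
    (is_derive_scal_l (V := C_R_NormedModule) g x b (0, 1)%R Hg)).
  replace ((a, b) : C) with (plus (G := C_R_NormedModule) (scal (V := C_R_NormedModule) a (1, 0)%R) (scal (V := C_R_NormedModule) b (0, 1)%R)).
  - eapply is_derive_ext; [| exact H].
    intros t. apply C_eq; unfold Re, Im, scal, plus; simpl; unfold prod_scal, prod_plus, scal, plus; simpl; unfold mult; simpl; ring.
  - apply C_eq; unfold Re, Im, scal, plus; simpl; unfold prod_scal, prod_plus, scal, plus; simpl; unfold mult; simpl; ring.
Qed.

Lemma derC_components (f : R -> C) (x : R) (l : C) : derC f x l ->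
  is_derive (fun u => Re (f u)) x (Re l) /\ is_derive (fun u => Im (f u)) x (Im l).
Proof.
  intros H; split.
  - apply (filterdiff_comp' f (fun z : C_R_NormedModule => Re z) x _ (fun z : C_R_NormedModule => Re z) H).
    apply filterdiff_linear, (is_linear_fst (U := R_NormedModule) (V := R_NormedModule)).
  - apply (filterdiff_comp' f (fun z : C_R_NormedModule => Im z) x _ (fun z : C_R_NormedModule => Im z) H).
    apply filterdiff_linear, (is_linear_snd (U := R_NormedModule) (V := R_NormedModule)).
Qed.

Lemma derC_of_components (f : R -> C) (x : R) (l : C) :
  is_derive (fun u => Re (f u)) x (Re l) ->
  is_derive (fun u => Im (f u)) x (Im l) -> derC f x l.
Proof.
  intros H1 H2. destruct l as [a b].
  eapply is_derive_ext; [| exact (derC_pair _ _ _ _ _ H1 H2)].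
  intros t; symmetry; apply surjective_pairing.
Qed.

Lemma derC_const (c : C) (x : R) : derC (fun _ => c) x (RtoC 0).
Proof. apply (is_derive_const (V := C_R_NormedModule)). Qed.

Lemma derC_ext (f g : R -> C) (x : R) (a : C) :
  (forall u, f u = g u) -> derC f x a -> derC g x a.
Proof. apply (is_derive_ext (V := C_R_NormedModule)). Qed.

Lemma derC_plus (f g : R -> C) (x : R) (a b : C) :
  derC f x a -> derC g x b -> derC (fun u => f u + g u) x (a + b).
Proof. apply (is_derive_plus (V := C_R_NormedModule)). Qed.

Lemma derC_RtoC (f : R -> R) (x a : R) :
  is_derive f x a -> derC (fun u => RtoC (f u)) x (RtoC a).
Proof. intros H; apply derC_pair; [exact H | apply (is_derive_const (V := R_NormedModule))]. Qed.

Lemma derC_mult (f g : R -> C) (x : R) (a b : C) :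
  derC f x a -> derC g x b ->
  derC (fun u => f u * g u) x (a * g x + f x * b).
Proof.
  intros Hf Hg.
  destruct (derC_components _ _ _ Hf) as [F1 F2], (derC_components _ _ _ Hg) as [G1 G2].
  apply derC_of_components.
  - eapply is_derive_eq.
    + exact (is_derive_minus (V := R_NormedModule) _ _ _ _ _
        (is_derive_mult (K := R_AbsRing) _ _ _ _ _ F1 G1 Rmult_comm) (is_derive_mult (K := R_AbsRing) _ _ _ _ _ F2 G2 Rmult_comm)).
    + unfold minus, plus, opp, mult, Re, Im; simpl; ring.
  - eapply is_derive_eq.
    + exact (is_derive_plus (V := R_NormedModule) _ _ _ _ _
        (is_derive_mult (K := R_AbsRing) _ _ _ _ _ F1 G2 Rmult_comm) (is_derive_mult (K := R_AbsRing) _ _ _ _ _ F2 G1 Rmult_comm)).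
    + unfold plus, mult, Re, Im; simpl; ring.
Qed.

Lemma derC_Cexp (f : R -> C) (x : R) (a : C) :
  derC f x a -> derC (fun u => Cexp (f u)) x (a * Cexp (f x)).
Proof.
  intros Hf. destruct (derC_components _ _ _ Hf) as [F1 F2].
  assert (E : forall (k h : R -> R) (k' h' : R), is_derive k x k' -> is_derive h x h' ->
    is_derive (fun u => exp (k u) * cos (h u))%R x (k' * (exp (k x) * cos (h x)) - h' * (exp (k x) * sin (h x)))%R /\
    is_derive (fun u => exp (k u) * sin (h u))%R x (k' * (exp (k x) * sin (h x)) + h' * (exp (k x) * cos (h x)))%R).
  { intros k h k' h' Hk Hh. split; (auto_derive; [repeat split; eexists; eassumption|]);
    pose proof (is_derive_unique _ _ _ Hk : Derive (fun u : R => k u) x = k') as Ek; pose proof (is_derive_unique _ _ _ Hh : Derive (fun u : R => h u) x = h') as Eh; rewrite Ek, Eh; ring. }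
  destruct (E _ _ _ _ F1 F2) as [E1 E2].
  apply derC_of_components; eapply is_derive_eq; [exact E1|unfold Cexp, Re, Im; simpl; ring|exact E2|unfold Cexp, Re, Im; simpl; ring].
Qed.

Lemma derC_cont (f : R -> C) (x : R) (a : C) : derC f x a -> contC f x.
Proof. intros H. apply (ex_derive_continuous (V := C_R_NormedModule)); exists a; exact H. Qed.

Lemma derC_eq (f : R -> C) (x : R) (a b : C) : derC f x a -> a = b -> derC f x b.
Proof. intros H <-; exact H. Qed.

Lemma derC_pow (f : R -> C) (x : R) (a : C) (k : nat) :
  derC f x a -> derC (fun u => Cpow (f u) k) x (INR k * a * Cpow (f x) (pred k)).
Proof.
  intros H; induction k as [|k IH].
  - simpl Cpow. eapply derC_eq; [apply derC_const|]. simpl. ring.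
  - eapply derC_eq; [exact (derC_mult _ _ _ _ _ H IH)|].
    rewrite S_INR, RtoC_plus. destruct k as [|k]; simpl Cpow; simpl pred.
    + simpl INR. ring.
    + ring.
Qed.

Lemma intC_derive (f df : R -> C) (a b : R) :
  (forall u, Rmin a b <= u <= Rmax a b -> derC f u (df u)) ->
  (forall u, Rmin a b <= u <= Rmax a b -> contC df u) ->
  intC df a b (f b - f a).
Proof. intros H1 H2. exact (is_RInt_derive (V := C_R_CompleteNormedModule) f df a b H1 H2). Qed.

Lemma contC_plus (f g : R -> C) (x : R) : contC f x -> contC g x -> contC (fun u => f u + g u) x.
Proof. apply (continuous_plus (V := C_R_NormedModule)). Qed.

Lemma contC_components (f : R -> C) (x : R) : contC f x ->
  continuous (fun u => Re (f u)) x /\ continuous (fun u => Im (f u)) x.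
Proof.
  intros H; split.
  - apply (continuous_comp f (fun z : C => Re z)); [exact H | apply continuous_fst].
  - apply (continuous_comp f (fun z : C => Im z)); [exact H | apply continuous_snd].
Qed.

Lemma contC_of_components (f : R -> C) (x : R) :
  continuous (fun u => Re (f u)) x -> continuous (fun u => Im (f u)) x -> contC f x.
Proof.
  intros H1 H2. apply filterlim_locally. intros eps.
  pose proof (proj1 (filterlim_locally _ _) H1 eps) as A1.
  pose proof (proj1 (filterlim_locally _ _) H2 eps) as A2.
  generalize (filter_and _ _ A1 A2). apply filter_imp. intros t [B1 B2]; split; assumption.
Qed.

Lemma contC_mult (f g : R -> C) (x : R) : contC f x -> contC g x -> contC (fun u => f u * g u) x.
Proof.
  intros Hf Hg. destruct (contC_components _ _ Hf) as [F1 F2], (contC_components _ _ Hg) as [G1 G2].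
  apply contC_of_components; unfold Re, Im in *; simpl.
  - apply (continuous_minus (V := R_NormedModule)); apply (continuous_mult (K := R_AbsRing)); assumption.
  - apply (continuous_plus (V := R_NormedModule)); apply (continuous_mult (K := R_AbsRing)); assumption.
Qed.

Lemma contC_const (c : C) (x : R) : contC (fun _ => c) x.
Proof. apply continuous_const. Qed.

(** The integral is taken in the real module C, where linearity concerns real factors; a complex
    factor is handled through real and imaginary parts. *)
Lemma intC_mult_l (f : R -> C) (a b : R) (c l : C) :
  intC f a b l -> intC (fun u => c * f u) a b (c * l).
Proof.
  intros H.
  pose proof (is_RInt_fct_extend_fst (U := R_NormedModule) (V := R_NormedModule) _ _ _ _ H) as H1.
  pose proof (is_RInt_fct_extend_snd (U := R_NormedModule) (V := R_NormedModule) _ _ _ _ H) as H2.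
  destruct c as [p q].
  apply (is_RInt_fct_extend_pair (U := R_NormedModule) (V := R_NormedModule)); simpl.
  - apply (is_RInt_minus (V := R_NormedModule)); apply (is_RInt_scal (V := R_NormedModule)); assumption.
  - apply (is_RInt_plus (V := R_NormedModule)); apply (is_RInt_scal (V := R_NormedModule)); assumption.
Qed.

Lemma intC_plus (f g : R -> C) (a b : R) (l m : C) :
  intC f a b l -> intC g a b m -> intC (fun u => f u + g u) a b (l + m).
Proof. apply (is_RInt_plus (V := C_R_NormedModule)). Qed.

Lemma intC_ext (f g : R -> C) (a b : R) (l : C) : a <= b ->
  (forall u, a < u < b -> f u = g u) -> intC f a b l -> intC g a b l.
Proof.
  intros Hab H. apply (is_RInt_ext (V := C_R_NormedModule)).
  intros u; rewrite Rmin_left, Rmax_right by assumption; apply H.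
Qed.

Lemma intC_norm (f : R -> C) (g : R -> R) (a b : R) (l : C) (m : R) :
  a <= b -> (forall u, a <= u <= b -> Cmod (f u) <= g u) ->
  intC f a b l -> is_RInt g a b m -> Cmod l <= m.
Proof.
  intros Hab H Hf Hg. rewrite <- Cmod_norm_R.
  apply (norm_RInt_le (V := C_R_NormedModule) f g a b l m); auto.
  intros u Hu; rewrite Cmod_norm_R; auto.
Qed.

(** * The complex exponential and its Taylor remainder *)

Lemma exp_le_compat (x y : R) : x <= y -> exp x <= exp y.
Proof. intros [H| ->]; [left; apply exp_increasing, H | right; reflexivity]. Qed.

Lemma Cexp_plus (z w : C) : Cexp (z + w) = Cexp z * Cexp w.
Proof.
  unfold Cexp, Re, Im; destruct z as [a b], w as [c d]; simpl.
  apply C_eq; unfold Re, Im; simpl; rewrite exp_plus, ?cos_plus, ?sin_plus; ring.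
Qed.

Lemma Cexp_0 : Cexp 0 = 1.
Proof. unfold Cexp; simpl; rewrite exp_0, cos_0, sin_0; apply C_eq; simpl; ring. Qed.

Lemma Cexp_opp (z : C) : Cexp (- z) * Cexp z = 1.
Proof. rewrite <- Cexp_plus, <- Cexp_0; f_equal; ring. Qed.

Lemma Cexp_neq_0 (z : C) : Cexp z <> 0.
Proof. intros H. pose proof (Cexp_opp z) as E. rewrite H, Cmult_0_r in E. apply RtoC_inj in E; lra. Qed.

Lemma Cmod_Cexp (z : C) : Cmod (Cexp z) = exp (Re z).
Proof.
  unfold Cmod, Cexp; simpl.
  replace (_ + _)%R with (exp (Re z) ^ 2)%R.
  - apply sqrt_pow2, Rlt_le, exp_pos.
  - pose proof (sin2_cos2 (Im z)) as E. unfold Rsqr in E.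
    replace (exp (Re z) ^ 2)%R with (exp (Re z) ^ 2 * (sin (Im z) * sin (Im z) + cos (Im z) * cos (Im z)))%R
      by (rewrite E; ring). ring.
Qed.

Lemma sumC_0 (f : nat -> C) : sum_n f 0%nat = f 0%nat.
Proof. exact (sum_O (G := C_AbelianMonoid) f). Qed.

Lemma sumC_S (f : nat -> C) (n : nat) : sum_n f (S n) = sum_n f n + f (S n).
Proof. exact (sum_Sn (G := C_AbelianMonoid) f n). Qed.

(* The remainder satisfies r_(N+1)' = w r_N on the segment from 0 to w, whence the bound by induction on N. *)
Lemma Cexp_taylor (w : C) (N : nat) :
  Cmod (Cexp w - sum_n (fun j => w ^ j / RtoC (INR (fact j))) N)
  <= Cmod w ^ S N / INR (fact (S N)) * exp (Cmod w).
Proof.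
  set (S_ := fun N (t : R) => (sum_n (fun j => (RtoC t * w) ^ j / RtoC (INR (fact j))) N : C)).
  assert (Hf : forall j, RtoC (INR (fact j)) <> 0).
  { intros j H; apply RtoC_inj in H; revert H; apply INR_fact_neq_0. }
  assert (Hd0 : forall t, derC (fun t => RtoC t * w) t w).
  { intros t. eapply derC_eq; [apply derC_mult; [apply derC_RtoC, is_derive_id|apply derC_const]|].
    unfold one; simpl; ring. }
  assert (HS : forall N t, derC (S_ (S N)) t (w * S_ N t)).
  { intros M; induction M as [|M IH]; intros t.
    - apply (derC_ext (fun u => 1 + (RtoC u * w) ^ 1 / RtoC (INR (fact 1)))).
      { intros u; unfold S_; rewrite sumC_S, sumC_0; simpl; field. }
      eapply derC_eq.
      + apply derC_plus; [|unfold Cdiv; apply derC_mult; [apply derC_pow, Hd0|apply derC_const]].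
        apply derC_const.
      + unfold S_; rewrite sumC_0. simpl. field.
    - apply (derC_ext (fun u => S_ (S M) u + (RtoC u * w) ^ S (S M) / RtoC (INR (fact (S (S M)))))).
      { intros u; unfold S_; rewrite (sumC_S _ (S M)); reflexivity. }
      eapply derC_eq.
      + apply derC_plus; [apply IH|unfold Cdiv; apply derC_mult; [apply derC_pow, Hd0|apply derC_const]].
      + unfold S_; rewrite sumC_S. fold (S_ M t). simpl pred.
        change (w * S_ M t + (INR (S (S M)) * w * (RtoC t * w) ^ S M * / INR (fact (S (S M)))
          + (RtoC t * w) ^ S (S M) * 0) = w * (S_ M t + (RtoC t * w) ^ S M / INR (fact (S M)))).
        rewrite (fact_simpl (S M)), mult_INR, RtoC_mult.
        field. split; [apply Hf|]. intros E; apply RtoC_inj in E. revert E; apply not_0_INR; lia. }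
  assert (HSc : forall N t, contC (S_ N) t).
  { intros [|M] t; [|eapply derC_cont, HS].
    eapply continuous_ext; [intros u; symmetry; unfold S_; rewrite sumC_0; simpl; reflexivity|]. apply contC_const. }
  assert (HE : forall t, derC (fun t => Cexp (RtoC t * w)) t (w * Cexp (RtoC t * w))).
  { intros t. apply derC_Cexp, Hd0. }
  assert (Hb : forall t, 0 <= t <= 1 -> exp (Re (RtoC t * w)) <= exp (Cmod w)).
  { intros t Ht. apply exp_le_compat. eapply Rle_trans; [apply Rle_abs|].
    eapply Rle_trans; [apply re_le_Cmod|]. rewrite Cmod_mult, Cmod_R, Rabs_pos_eq by lra.
    pose proof (Cmod_ge_0 w). nra. }
  pose proof (Cmod_ge_0 w) as Hw.
  (* Mean value inequality in integrated form: if [g] dominates the derivative of [D] and [G] is a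
     primitive of [g], the increment of [D] is at most that of [G]. *)
  assert (Hint : forall (D dD : R -> C) t, 0 <= t -> (forall u, derC D u (dD u)) -> (forall u, contC dD u) ->
     forall g G : R -> R, (forall u, is_derive G u (g u)) -> (forall u, continuous g u) ->
     (forall u, 0 <= u <= t -> Cmod (dD u) <= g u) -> Cmod (D t - D 0%R) <= G t - G 0).
  { intros D dD t Ht H1 H2 g G H3 H4 H5.
    eapply (intC_norm dD g 0 t); [exact Ht|exact H5|apply intC_derive; auto|].
    apply (is_RInt_derive (V := R_CompleteNormedModule) G g); auto. }
  assert (Hcont : forall k (c : R) u, continuous (fun u : R => c * u ^ k)%R u).
  { intros k c u. apply (ex_derive_continuous (V := R_NormedModule)). auto_derive. trivial. }
  assert (Hpow : forall c n (u : R), is_derive (fun u : R => c * u ^ S n)%R u (c * INR (S n) * u ^ n)%R).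
  { intros c n u. auto_derive; trivial. change (pred (S n)) with n. rewrite S_INR; destruct n; simpl; ring. }
  assert (HN : forall N t, 0 <= t <= 1 ->
     Cmod (Cexp (RtoC t * w) - S_ N t) <= Cmod w ^ S N * t ^ S N / INR (fact (S N)) * exp (Cmod w)).
  { intros M; induction M as [|M IH]; intros t Ht.
    - replace (Cexp (RtoC t * w) - S_ 0%nat t) with (Cexp (RtoC t * w) - Cexp (RtoC 0 * w)).
      2:{ unfold S_; rewrite sumC_0; simpl. rewrite Cmult_0_l, Cexp_0. field. }
      replace (Cmod w ^ 1 * t ^ 1 / INR (fact 1) * exp (Cmod w))%R
        with (Cmod w * exp (Cmod w) * t - Cmod w * exp (Cmod w) * 0)%R by (simpl; field).
      apply (Hint (fun t => Cexp (RtoC t * w)) (fun t => w * Cexp (RtoC t * w)) t) with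
        (g := fun u => (Cmod w * exp (Cmod w) * u ^ 0)%R) (G := fun u => (Cmod w * exp (Cmod w) * u)%R);
        [lra|exact HE| | |apply Hcont|].
      + intros u; apply contC_mult; [apply contC_const|eapply derC_cont, HE].
      + intros u; auto_derive; auto; ring.
      + intros u Hu. rewrite Cmod_mult, Cmod_Cexp. simpl. rewrite Rmult_1_r.
        apply Rmult_le_compat_l; [exact Hw|apply Hb; lra].
    (* The remainder vanishes at t = 0, so it equals its own increment and [Hint] applies; the
       induction hypothesis bounds its derivative. *)
    - replace (Cexp (RtoC t * w) - S_ (S M) t) with
        ((fun t => Cexp (RtoC t * w) + -1 * S_ (S M) t) t - (fun t => Cexp (RtoC t * w) + -1 * S_ (S M) t) 0%R).
      2:{ cbv beta. replace (S_ (S M) 0%R) with (RtoC 1).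
          - rewrite Cmult_0_l, Cexp_0; ring.
          - unfold S_. clear. induction M as [|M IH].
            + rewrite sumC_S, sumC_0. simpl. field.
            + rewrite sumC_S. rewrite <- IH.
              rewrite Cpow_S, Cmult_0_l. unfold Cdiv; ring. }
      assert (E : (Cmod w ^ S (S M) * t ^ S (S M) / INR (fact (S (S M))) * exp (Cmod w)
          = Cmod w ^ S (S M) / INR (fact (S (S M))) * exp (Cmod w) * t ^ S (S M)
            - Cmod w ^ S (S M) / INR (fact (S (S M))) * exp (Cmod w) * 0 ^ S (S M))%R).
      { rewrite (pow_ne_zero (S (S M))) by lia. rewrite Rmult_0_r, Rminus_0_r. field. apply INR_fact_neq_0. }
      rewrite E.
      apply (Hint (fun t => Cexp (RtoC t * w) + -1 * S_ (S M) t) (fun t => w * Cexp (RtoC t * w) + -1 * (w * S_ M t)) t) with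
        (g := fun u => (Cmod w ^ S (S M) / INR (fact (S M)) * exp (Cmod w) * u ^ S M)%R)
        (G := fun u => (Cmod w ^ S (S M) / INR (fact (S (S M))) * exp (Cmod w) * u ^ S (S M))%R);
        [lra| | | |apply Hcont|].
      + intros u. apply derC_plus; [apply HE|].
        eapply derC_eq; [apply derC_mult; [apply derC_const|apply HS]|cbv beta; ring_simplify; reflexivity].
      + intros u. apply contC_plus; apply contC_mult; try apply contC_const; [eapply derC_cont, HE|].
        apply contC_mult; [apply contC_const|apply HSc].
      + intros u. eapply is_derive_eq; [apply Hpow|]. cbv beta.
        rewrite (fact_simpl (S M)), mult_INR. match goal with |- ?a = ?b => change (@eq R a b) end. field. split; [apply INR_fact_neq_0|apply not_0_INR; lia].
      + intros u Hu. replace (w * Cexp (RtoC u * w) + -1 * (w * S_ M u)) with (w * (Cexp (RtoC u * w) - S_ M u)) by ring.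
        rewrite Cmod_mult. eapply Rle_trans; [apply Rmult_le_compat_l; [exact Hw|apply IH; lra]|].
        apply Req_le. simpl. unfold Rdiv. ring. }
  specialize (HN N 1%R ltac:(lra)). unfold S_ in HN. rewrite !Cmult_1_l, pow1, Rmult_1_r in HN. exact HN.
Qed.

(** * Power series and the identity theorem *)

Notation serC := (@is_series C_AbsRing C_NormedModule).
Notation holC := (@is_derive C_AbsRing C_NormedModule).

Lemma serC_spec (a : nat -> C) (l : C) :
  serC a l <-> forall eps : R, 0 < eps -> exists N, forall n, (N <= n)%nat -> Cmod (sum_n a n - l) < eps.
Proof.
  split.
  - intros H eps Heps.
    apply (filterlim_locally_ball_norm (K := C_AbsRing) (U := C_NormedModule)) with (eps := mkposreal _ Heps) in H.
    destruct H as [N HN]. exists N; intros n Hn. exact (HN n Hn).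
  - intros H. apply (filterlim_locally_ball_norm (K := C_AbsRing) (U := C_NormedModule)).
    intros [eps Heps]. destruct (H eps Heps) as [N HN]. exists N; intros n Hn. exact (HN n Hn).
Qed.

(** The series of 1/w, of the kernel and of the integrals are all shown to converge through a
    remainder of order 2^(-n). *)
Lemma serC_of_geometric (a : nat -> C) (l : C) (M : R) :
  (forall n, Cmod (sum_n a n - l) <= M * (1 / 2) ^ n) -> serC a l.
Proof.
  intros H. apply serC_spec. intros eps Heps.
  assert (HM : 0 <= M).
  { specialize (H 0%nat). simpl in H. pose proof (Cmod_ge_0 (sum_n a 0%nat - l)) as H0.
    simpl in H0. lra. }
  destruct (pow_lt_1_zero (1 / 2) ltac:(rewrite Rabs_pos_eq; lra) (eps / (M + 1))) as [N HN].
  { apply Rdiv_lt_0_compat; lra. }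
  exists N; intros n Hn. specialize (HN n Hn). rewrite Rabs_pos_eq in HN by (apply pow_le; lra).
  eapply Rle_lt_trans; [apply H|].
  apply Rle_lt_trans with ((M + 1) * (1 / 2) ^ n)%R.
  - apply Rmult_le_compat_r; [apply pow_le|]; lra.
  - apply Rmult_lt_reg_l with (/ (M + 1))%R; [apply Rinv_0_lt_compat; lra|].
    replace (/ (M + 1) * ((M + 1) * (1 / 2) ^ n))%R with ((1 / 2) ^ n)%R by (cfield; lra).
    unfold Rdiv in HN. rewrite Rmult_comm. exact HN.
Qed.

Lemma serC_ext (a b : nat -> C) (l : C) : (forall n, a n = b n) -> serC a l -> serC b l.
Proof. intros H. apply is_series_ext, H. Qed.

Lemma serC_plus (a b : nat -> C) (l m : C) : serC a l -> serC b m -> serC (fun n => a n + b n) (l + m).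
Proof. apply (is_series_plus (V := C_NormedModule)). Qed.

Lemma serC_scal (c : C) (a : nat -> C) (l : C) : serC a l -> serC (fun n => c * a n) (c * l).
Proof. apply (is_series_scal (V := C_NormedModule)). Qed.

Lemma serC_shift (a : nat -> C) (l : C) :
  serC a l -> serC (fun n => match n with O => RtoC 0 | S m => a m end) l.
Proof.
  intros H. rewrite serC_spec in *. intros eps Heps. destruct (H eps Heps) as [N HN].
  assert (E : forall n, sum_n (fun n => match n with O => RtoC 0 | S m => a m end) (S n) = sum_n a n).
  { induction n as [|n IH]; rewrite sumC_S; [rewrite !sumC_0; apply Cplus_0_l|].
    rewrite IH, sumC_S; reflexivity. }
  exists (S N); intros [|n] Hn; [lia|]. rewrite E. apply HN; lia.
Qed.

Lemma is_pseries_C (a : nat -> C) (h l : C) :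
  is_pseries (K := C_AbsRing) (V := C_NormedModule) a h l <-> serC (fun j => h ^ j * a j) l.
Proof.
  assert (E : forall j, pow_n (K := C_AbsRing) h j = h ^ j).
  { induction j as [|j IH]; [reflexivity|]. simpl. rewrite IH. reflexivity. }
  unfold is_pseries; split; apply serC_ext; intros n.
  - exact (f_equal (fun x => x * a n) (E n)).
  - exact (eq_sym (f_equal (fun x => x * a n) (E n))).
Qed.

(** This is [analytic_at] with the coefficients made explicit, since derivatives are read off from
    them. *)
Definition expands (F : C -> C) (z : C) (a : nat -> C) : Prop :=
  exists rho : R, 0 < rho /\
    forall h : C, Cmod h < rho -> serC (fun j => h ^ j * a j) (F (z + h)).

Lemma expands_analytic (F : C -> C) (z : C) (a : nat -> C) : expands F z a -> analytic_at F z.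
Proof.
  intros (rho & Hrho & H). exists a, rho. split; [exact Hrho|].
  intros h Hh. apply is_pseries_C, H, Hh.
Qed.

Lemma analytic_expands (F : C -> C) (z : C) : analytic_at F z -> exists a, expands F z a.
Proof.
  intros (a & rho & Hrho & H). exists a, rho. split; [exact Hrho|].
  intros h Hh. apply is_pseries_C, H, Hh.
Qed.

Lemma expands_ext (F : C -> C) (z : C) (a b : nat -> C) :
  (forall j, a j = b j) -> expands F z a -> expands F z b.
Proof.
  intros E (rho & Hrho & H). exists rho. split; [exact Hrho|].
  intros h Hh. eapply serC_ext; [|apply H, Hh]. intros n; simpl; rewrite E; reflexivity.
Qed.

Lemma expands_ext_loc (F G : C -> C) (z : C) (a : nat -> C) (d : R) : 0 < d ->
  (forall w, Cmod (w - z) < d -> F w = G w) -> expands F z a -> expands G z a.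
Proof.
  intros Hd E (rho & Hrho & H). exists (Rmin rho d). split; [apply Rmin_glb_lt; assumption|].
  intros h Hh. rewrite <- E.
  - apply H. eapply Rlt_le_trans; [exact Hh|apply Rmin_l].
  - replace (z + h - z) with h by cring. eapply Rlt_le_trans; [exact Hh|apply Rmin_r].
Qed.

Lemma expands_plus (F G : C -> C) (z : C) (a b : nat -> C) :
  expands F z a -> expands G z b -> expands (fun w => F w + G w) z (fun j => a j + b j).
Proof.
  intros (r & Hr & H) (r' & Hr' & H'). exists (Rmin r r'). split; [apply Rmin_glb_lt; assumption|].
  intros h Hh. eapply serC_ext; [|apply serC_plus; [apply H|apply H']].
  - intros n; simpl; cring.
  - eapply Rlt_le_trans; [exact Hh|apply Rmin_l].
  - eapply Rlt_le_trans; [exact Hh|apply Rmin_r].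
Qed.

Lemma expands_scal (c : C) (F : C -> C) (z : C) (a : nat -> C) :
  expands F z a -> expands (fun w => c * F w) z (fun j => c * a j).
Proof.
  intros (r & Hr & H). exists r. split; [assumption|].
  intros h Hh. eapply serC_ext; [|apply serC_scal, H, Hh]. intros n; simpl; cring.
Qed.

(** With w = z + h, w F(w) = z F(w) + h F(w), and the factor h moves every coefficient up one
    place. *)
Lemma expands_mul_id (F : C -> C) (z : C) (a : nat -> C) :
  expands F z a ->
  expands (fun w => w * F w) z (fun j => z * a j + match j with O => RtoC 0 | S i => a i end).
Proof.
  intros (r & Hr & H). exists r. split; [assumption|].
  intros h Hh. specialize (H h Hh).
  apply (serC_ext (fun n => z * (h ^ n * a n) + match n with O => RtoC 0 | S m => h * (h ^ m * a m) end)).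
  - intros [|n]; simpl; cring.
  - replace ((z + h) * F (z + h)) with (z * F (z + h) + h * F (z + h)) by cring.
    apply serC_plus; [apply serC_scal, H|].
    apply (serC_shift (fun m => h * (h ^ m * a m))), serC_scal, H.
Qed.

Lemma expands_const (c z : C) :
  expands (fun _ => c) z (fun j => match j with O => c | S _ => RtoC 0 end).
Proof.
  exists 1%R. split; [lra|]. intros h _. apply serC_spec. intros eps Heps. exists 0%nat; intros n _.
  assert (E : sum_n (fun j => h ^ j * match j with O => c | S _ => RtoC 0 end) n = c).
  { induction n as [|n IH]; [rewrite sumC_0; simpl; cring|]. rewrite sumC_S, IH; cring. }
  rewrite E. replace (c - c) with (RtoC 0) by cring. rewrite Cmod_0. exact Heps.
Qed.

(** The finite geometric sum has the exact error -(-h/z)^(n+1) / (z+h), and the radius |z|/2 makes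
    the ratio at most 1/2. *)
Lemma expands_inv (z : C) : z <> 0 -> expands (fun w => / w) z (fun j => (- (1)) ^ j / z ^ S j).
Proof.
  intros Hz. pose proof (proj1 (Cmod_gt_0 z) Hz) as Hm.
  exists (Cmod z / 2)%R. split; [lra|]. intros h Hh.
  assert (Hzh : z + h <> 0).
  { intros E. assert (z = - h) as -> by (rewrite <- (Cplus_0_l (- h)), <- E; cring).
    rewrite Cmod_opp in *. pose proof (Cmod_ge_0 h). lra. }
  assert (Hq : Cmod (h / z) <= 1 / 2).
  { rewrite Cmod_div by exact Hz. apply Rmult_le_reg_r with (Cmod z); [exact Hm|].
    unfold Rdiv. rewrite Rmult_assoc, Rinv_l; lra. }
  apply serC_of_geometric with (M := Cmod (/ (z + h))). intros n.
  assert (E : forall n, sum_n (fun j => h ^ j * ((- (1)) ^ j / z ^ S j)) n - / (z + h)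
     = - (- (1)) ^ S n * (h / z) ^ S n * / (z + h)).
  { clear n; induction n as [|n IH].
    - rewrite sumC_0. simpl. cfield. split; assumption.
    - rewrite sumC_S. replace (sum_n _ n) with (sum_n (fun j => h ^ j * ((- (1)) ^ j / z ^ S j)) n - / (z + h) + / (z + h)) by cring.
      rewrite IH. unfold Cdiv. rewrite !Cpow_mult_l. rewrite !Cpow_inv by assumption.
      rewrite (Cpow_S z (S n)), (Cpow_S h (S n)), (Cpow_S (- (1)) (S n)).
      set (A := h ^ S n). set (B := z ^ S n). set (D := (- (1)) ^ S n).
      assert (B <> 0) by (apply Cpow_nz, Hz). cfield. repeat split; assumption. }
  rewrite E, !Cmod_mult, Cmod_opp, !Cmod_pow, Cmod_opp, Cmod_1, pow1.
  rewrite Rmult_1_l, Rmult_comm. apply Rmult_le_compat_l; [apply Cmod_ge_0|].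
  simpl. apply Rle_trans with (1 * Cmod (h / z) ^ n)%R.
  - apply Rmult_le_compat_r; [apply pow_le, Cmod_ge_0|lra].
  - rewrite Rmult_1_l. apply pow_incr. split; [apply Cmod_ge_0|exact Hq].
Qed.

(** Convergence at the single point r = rho/2 bounds the terms r^j |a_j|; for |h| <= r/2 the tail is
    then dominated by a geometric series of ratio at most 1/2. The value, the derivative and the
    vanishing of coefficients are all deduced from this bound. *)
Lemma expands_remainder (F : C -> C) (z : C) (a : nat -> C) : expands F z a ->
  forall n, exists M r : R, 0 <= M /\ 0 < r /\ forall h, Cmod h <= r ->
    Cmod (F (z + h) - sum_n (fun j => h ^ j * a j) n) <= M * Cmod h ^ S n.
Proof.
  intros (rho & Hrho & H) n. set (r := (rho / 2)%R). assert (Hr : 0 < r) by (unfold r; lra).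
  assert (Hb : exists K, 0 <= K /\ forall j, r ^ j * Cmod (a j) <= K).
  { specialize (H (RtoC r)). rewrite Cmod_R, Rabs_pos_eq in H by lra. specialize (H ltac:(unfold r; lra)).
    destruct (filterlim_bounded (K := C_AbsRing) (V := C_NormedModule) _ (ex_intro _ _ H)) as [K HK].
    assert (HK' : forall m, Cmod (sum_n (fun j => RtoC r ^ j * a j) m) <= K) by exact HK.
    assert (K0 : 0 <= K) by (eapply Rle_trans; [apply Cmod_ge_0|apply (HK' 0%nat)]).
    (* A term is a difference of two partial sums, each bounded by [K]. *)
    exists (K + K)%R. split; [lra|]. intros j.
    replace (r ^ j * Cmod (a j))%R with (Cmod (RtoC r ^ j * a j)).
    2:{ rewrite Cmod_mult, Cmod_pow, Cmod_R, Rabs_pos_eq by lra. reflexivity. }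
    destruct j as [|j].
    - specialize (HK' 0%nat). rewrite sumC_0 in HK'. lra.
    - replace (RtoC r ^ S j * a (S j)) with
        (sum_n (fun j => RtoC r ^ j * a j) (S j) + - sum_n (fun j => RtoC r ^ j * a j) j) by (rewrite sumC_S; cring).
      eapply Rle_trans; [apply Cmod_triangle|]. rewrite Cmod_opp. apply Rplus_le_compat; apply HK'. }
  destruct Hb as (K & HK & Hb).
  exists (2 * K / r ^ S n)%R, (r / 2)%R.
  assert (Hrn : forall m, 0 < r ^ m) by (intros; apply pow_lt; exact Hr).
  split; [apply Rmult_le_pos; [lra|left; apply Rinv_0_lt_compat, Hrn]|]. split; [lra|].
  intros h Hh. set (q := (Cmod h / r)%R).
  assert (Hq0 : 0 <= q) by (apply Rmult_le_pos; [apply Cmod_ge_0|left; apply Rinv_0_lt_compat, Hr]).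
  assert (Hq : q <= 1 / 2).
  { unfold q. apply Rmult_le_reg_r with r; [exact Hr|]. unfold Rdiv. rewrite Rmult_assoc, Rinv_l; lra. }
  assert (Hterm : forall j, Cmod (h ^ j * a j) <= K * q ^ j).
  { intros j. rewrite Cmod_mult, Cmod_pow. unfold q, Rdiv. rewrite Rpow_mult_distr, pow_inv.
    pose proof (Hrn j). apply Rle_trans with (Cmod h ^ j * / r ^ j * (r ^ j * Cmod (a j)))%R.
    - right. cfield. lra.
    - rewrite (Rmult_comm K). apply Rmult_le_compat_l; [|apply Hb].
      apply Rmult_le_pos; [apply pow_le, Cmod_ge_0|left; apply Rinv_0_lt_compat; assumption]. }
  (* 2 - 2 (1/2)^m is the sum of the first m powers of 1/2. *)
  assert (Htail : forall m, Cmod (sum_n (fun j => h ^ j * a j) (n + m) - sum_n (fun j => h ^ j * a j) n)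
     <= K * q ^ S n * (2 - 2 * (1 / 2) ^ m)).
  { induction m as [|m IH].
    - rewrite Nat.add_0_r. replace (_ - _) with (RtoC 0) by cring. rewrite Cmod_0. simpl. lra.
    - rewrite Nat.add_succ_r, sumC_S.
      replace (_ - _) with (sum_n (fun j => h ^ j * a j) (n + m) - sum_n (fun j => h ^ j * a j) n + h ^ S (n + m) * a (S (n + m))) by cring.
      eapply Rle_trans; [apply Cmod_triangle|].
      eapply Rle_trans; [apply Rplus_le_compat; [exact IH|apply Hterm]|].
      replace (S (n + m)) with (S n + m)%nat by lia. rewrite pow_add.
      assert (q ^ m <= (1 / 2) ^ m) by (apply pow_incr; lra).
      assert (0 <= K * q ^ S n) by (apply Rmult_le_pos; [|apply pow_le]; assumption).
      simpl ((1 / 2) ^ S m)%R. nra. }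
  assert (HhR : Cmod h < rho) by (unfold r in *; lra).
  specialize (H h HhR). rewrite serC_spec in H.
  replace (2 * K / r ^ S n * Cmod h ^ S n)%R with (K * q ^ S n * 2)%R.
  2:{ unfold q, Rdiv. rewrite Rpow_mult_distr, pow_inv. cfield. apply pow_nonzero; lra. }
  apply le_epsilon. intros eps Heps. destruct (H eps Heps) as [N HN].
  specialize (HN (n + N)%nat ltac:(lia)).
  replace (F (z + h) - sum_n (fun j => h ^ j * a j) n) with
    (- (sum_n (fun j => h ^ j * a j) (n + N) - F (z + h))
     + (sum_n (fun j => h ^ j * a j) (n + N) - sum_n (fun j => h ^ j * a j) n)) by cring.
  eapply Rle_trans; [apply Cmod_triangle|]. rewrite Cmod_opp.
  assert (0 <= K * q ^ S n) by (apply Rmult_le_pos; [|apply pow_le]; assumption).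
  specialize (Htail N). pose proof (pow_le (1 / 2) N ltac:(lra)). nra.
Qed.

Lemma expands_0 (F : C -> C) (z : C) (a : nat -> C) : expands F z a -> a 0%nat = F z.
Proof.
  intros H. destruct (expands_remainder _ _ _ H 0%nat) as (M & r & HM & Hr & B).
  specialize (B 0). rewrite Cmod_0 in B. specialize (B (Rlt_le _ _ Hr)).
  rewrite sumC_0, Cplus_0_r in B. simpl in B. rewrite Rmult_0_l, Rmult_0_r in B.
  assert (E : Cmod (F z - 1 * a 0%nat) = 0) by (apply Rle_antisym; [exact B|apply Cmod_ge_0]).
  apply Cmod_eq_0 in E. rewrite <- (Cplus_0_r (a 0%nat)), <- E. cring.
Qed.

(** The remainder M |h|^2 of the linear approximation is at most eps |h| once |h| <= eps / (M+1). *)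
Lemma expands_derive (F : C -> C) (z : C) (a : nat -> C) : expands F z a -> holC F z (a 1%nat).
Proof.
  intros H. pose proof (expands_0 _ _ _ H) as H0.
  destruct (expands_remainder _ _ _ H 1%nat) as (M & r & HM & Hr & B).
  split; [apply (is_linear_scal_l (K := C_AbsRing) (V := C_NormedModule))|].
  intros x Hx. apply (is_filter_lim_locally_unique (K := C_AbsRing) (V := AbsRing_NormedModule C_AbsRing)) in Hx. subst x.
  intros eps. apply (locally_le_locally_norm (K := C_AbsRing) (V := AbsRing_NormedModule C_AbsRing)).
  assert (Hd : 0 < Rmin r (eps / (M + 1))).
  { apply Rmin_glb_lt; [exact Hr|]. apply Rdiv_lt_0_compat; [apply cond_pos|lra]. }
  exists (mkposreal _ Hd).
  cut (forall y : C, Cmod (y - z) < Rmin r (eps / (M + 1)) ->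
    Cmod (F y - F z - (y - z) * a 1%nat) <= eps * Cmod (y - z)); [intros K; exact K|].
  intros y Hy.
  set (h := y - z) in *. assert (Hh : Cmod h <= r) by (left; eapply Rlt_le_trans; [exact Hy|apply Rmin_l]).
  specialize (B h Hh). replace (z + h) with y in B by (unfold h; cring).
  rewrite sumC_S, sumC_0 in B. rewrite H0 in B.
  replace (F y - F z - h * a 1%nat) with (F y - (h ^ 0 * F z + h ^ 1 * a 1%nat)) by (simpl; cring).
  eapply Rle_trans; [exact B|].
  assert (Hh2 : Cmod h * (M + 1) <= eps).
  { apply Rle_trans with (eps / (M + 1) * (M + 1))%R.
    - apply Rmult_le_compat_r; [lra|]. left; eapply Rlt_le_trans; [exact Hy|apply Rmin_r].
    - right; cfield; lra. }
  pose proof (Cmod_ge_0 h). simpl. nra.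
Qed.

(** If a_i = 0 for i < j, the remainder bound at h = t d, where F vanishes, reads |t d|^j |a_j| <= M
    |t d|^(j+1); dividing and letting t tend to 0 gives a_j = 0. Zeros on one short segment issuing
    from z are enough. *)
Lemma expands_zero (F : C -> C) (z d : C) (a : nat -> C) (e : R) :
  expands F z a -> d <> 0 -> 0 < e -> (forall t, 0 < t < e -> F (z + RtoC t * d) = 0) ->
  forall j, a j = 0.
Proof.
  intros H Hd He HF j. induction j as [j IH] using (well_founded_induction Wf_nat.lt_wf).
  destruct (expands_remainder _ _ _ H j) as (M & r & HM & Hr & B).
  pose proof (proj1 (Cmod_gt_0 d) Hd) as Hdm.
  apply Cmod_eq_0. apply Rle_antisym; [|apply Cmod_ge_0].
  apply le_epsilon. intros eps Heps. rewrite Rplus_0_l.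
  (* Small enough to stay on the segment of zeros, to remain within the radius of the bound, and to
     make M |t d| <= eps. *)
  set (t := (Rmin (e / 2) (Rmin (r / Cmod d) (eps / ((M + 1) * Cmod d))))%R).
  assert (Ht : 0 < t).
  { unfold t. apply Rmin_glb_lt; [lra|]. apply Rmin_glb_lt; apply Rdiv_lt_0_compat; try assumption. nra. }
  assert (Ht1 : t <= e / 2) by apply Rmin_l.
  assert (Ht2 : t * Cmod d <= r).
  { apply Rle_trans with (r / Cmod d * Cmod d)%R; [|right; cfield; lra].
    apply Rmult_le_compat_r; [lra|]. eapply Rle_trans; [apply Rmin_r|apply Rmin_l]. }
  assert (Ht3 : M * (t * Cmod d) <= eps).
  { apply Rle_trans with ((M + 1) * Cmod d * t)%R; [nra|].
    apply Rle_trans with ((M + 1) * Cmod d * (eps / ((M + 1) * Cmod d)))%R; [|right; cfield; lra].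
    apply Rmult_le_compat_l; [nra|]. eapply Rle_trans; [apply Rmin_r|apply Rmin_r]. }
  assert (Em : Cmod (RtoC t * d) = (t * Cmod d)%R) by (rewrite Cmod_mult, Cmod_R, Rabs_pos_eq; lra).
  specialize (B (RtoC t * d)). rewrite Em in B. specialize (B Ht2).
  rewrite HF in B by lra.
  assert (E : sum_n (fun i => (RtoC t * d) ^ i * a i) j = (RtoC t * d) ^ j * a j).
  { clear - IH. destruct j as [|j]; [apply sumC_0|]. rewrite sumC_S.
    assert (E : forall m, (m <= j)%nat -> sum_n (fun i => (RtoC t * d) ^ i * a i) m = RtoC 0).
    { induction m as [|m IHm]; intros Hm; [rewrite sumC_0, IH by lia; cring|].
      rewrite sumC_S, IHm, IH by lia. cring. }
    rewrite E by lia. cring. }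
  rewrite E in B. replace (0 - (RtoC t * d) ^ j * a j) with (- ((RtoC t * d) ^ j * a j)) in B by cring.
  rewrite Cmod_opp, Cmod_mult, Cmod_pow, Em in B. simpl in B.
  assert (Hp : 0 < (t * Cmod d) ^ j) by (apply pow_lt; nra).
  apply Rmult_le_reg_l with ((t * Cmod d) ^ j)%R; [exact Hp|]. nra.
Qed.

(** The identity theorem is used along one ray only, so connectedness reduces to completeness of the
    reals: zeros propagate from the far end of the ray back to s. *)
Lemma identity_on_ray (F : C -> C) (s d : C) (T : R) :
  d <> 0 -> 0 < T -> (forall t, 0 <= t -> analytic_at F (s + RtoC t * d)) ->
  (forall t, T < t -> F (s + RtoC t * d) = 0) -> F s = 0.
Proof.
  intros Hd HT HA HF.
  (* Here [u] measures how far back from T the zeros reach; [completeness] supplies the supremum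
     m. *)
  set (E := fun u => 0 <= u <= T /\ forall t, T - u < t -> F (s + RtoC t * d) = 0).
  destruct (completeness E) as [m [Hm1 Hm2]].
  - exists T. intros u [Hu _]. lra.
  - exists 0%R. split; [lra|]. intros t Ht. apply HF. lra.
  - assert (Hm : 0 <= m <= T).
    { split; [apply Hm1; split; [lra|intros t Ht; apply HF; lra]|apply Hm2; intros u [Hu _]; lra]. }
    assert (Hz : forall t, T - m < t -> F (s + RtoC t * d) = 0).
    { intros t Ht. destruct (Rlt_dec T t) as [H|H]; [apply HF, H|].
      destruct (Classical_Prop.classic (exists u, E u /\ T - u < t)) as [(u & Hu & Hut)|Hn].
      - apply Hu, Hut.
      - exfalso. assert (m <= T - t); [|lra]. apply Hm2. intros u Hu.
        apply Rnot_lt_le. intros Hlt. apply Hn. exists u. split; [exact Hu|lra]. }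
    destruct (analytic_expands _ _ (HA (T - m)%R ltac:(lra))) as (a & Ha).
    assert (Ha0 : forall j, a j = 0).
    { apply (expands_zero F (s + RtoC (T - m) * d) d a 1); [exact Ha|exact Hd|lra|].
      intros t Ht. rewrite <- Cplus_assoc, <- Cmult_plus_distr_r, <- RtoC_plus. apply Hz. lra. }
    (* At T - m all Taylor coefficients vanish because F is zero just beyond it; hence F vanishes on
       a whole disc, in particular on the near side of T - m. *)
    assert (HFz : exists e, 0 < e /\ forall t, T - m - e < t -> F (s + RtoC t * d) = 0).
    { destruct Ha as (rho & Hrho & Ha). pose proof (proj1 (Cmod_gt_0 d) Hd) as Hdm.
      exists (rho / Cmod d)%R. split; [apply Rdiv_lt_0_compat; assumption|].
      intros t Ht. destruct (Rlt_dec (T - m) t) as [Hlt|Hle]; [apply Hz, Hlt|].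
      specialize (Ha (RtoC (t - (T - m)) * d)).
      rewrite Cmod_mult, Cmod_R, Rabs_left1 in Ha by lra.
      rewrite <- Cplus_assoc, <- Cmult_plus_distr_r, <- RtoC_plus in Ha.
      replace (T - m + (t - (T - m)))%R with t in Ha by cring.
      assert (Hs : - (t - (T - m)) * Cmod d < rho).
      { apply Rlt_le_trans with (rho / Cmod d * Cmod d)%R; [|right; cfield; lra].
        apply Rmult_lt_compat_r; lra. }
      specialize (Ha Hs).
      apply (is_series_ext (V := C_NormedModule) _ (fun _ => RtoC 0)) in Ha.
      2: { intros n; simpl. rewrite Ha0. cring. }
      apply Cmod_eq_0. apply Rle_antisym; [|apply Cmod_ge_0]. apply le_epsilon. intros eps Heps.
      destruct (proj1 (serC_spec _ _) Ha eps Heps) as [N HN]. specialize (HN N (le_n _)).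
      assert (E0 : sum_n (fun _ : nat => RtoC 0) N = RtoC 0).
      { clear. induction N as [|N IH]; [apply sumC_0|]. rewrite sumC_S, IH. cring. }
      rewrite E0 in HN. replace (0 - F (s + RtoC t * d)) with (- F (s + RtoC t * d)) in HN by cring.
      rewrite Cmod_opp in HN. lra. }
    destruct HFz as (e & He & HFe).
    (* Either the disc already reaches t = 0, or m could be enlarged by e / 2. *)
    destruct (Rlt_dec (T - m) e) as [Hlt|Hge].
    + specialize (HFe 0%R ltac:(lra)). rewrite Cmult_0_l, Cplus_0_r in HFe. exact HFe.
    + exfalso. assert (E (m + e / 2)%R).
      { split; [lra|]. intros t Ht. apply HFe. lra. }
      specialize (Hm1 _ H). lra.
Qed.

Lemma serC_unique (a : nat -> C) (l m : C) : serC a l -> serC a m -> l = m.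
Proof.
  intros H1 H2. rewrite serC_spec in H1, H2.
  assert (E : Cmod (l - m) = 0).
  { apply Rle_antisym; [|apply Cmod_ge_0]. apply le_epsilon. intros eps Heps.
    destruct (H1 (eps / 2)%R ltac:(lra)) as [N HN], (H2 (eps / 2)%R ltac:(lra)) as [N' HN'].
    specialize (HN (N + N')%nat ltac:(lia)). specialize (HN' (N + N')%nat ltac:(lia)).
    replace (l - m) with (- (sum_n a (N + N') - l) + (sum_n a (N + N') - m)) by cring.
    eapply Rle_trans; [apply Cmod_triangle|]. rewrite Cmod_opp. lra. }
  apply Cmod_eq_0 in E. rewrite <- (Cplus_0_r m), <- E. cring.
Qed.

Lemma analytic_minus (F G : C -> C) (z : C) :
  analytic_at F z -> analytic_at G z -> analytic_at (fun w => F w + - (1) * G w) z.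
Proof.
  intros HF HG. destruct (analytic_expands _ _ HF) as (a & Ha), (analytic_expands _ _ HG) as (b & Hb).
  eapply expands_analytic, expands_plus; [exact Ha|apply expands_scal, Hb].
Qed.

(** [F] itself, with c = 0, satisfies the description. Any other candidate G agrees with it for Re z
    > 1, both being sums of the same series, and Re d > 0 carries the ray from s into that half
    plane without leaving D or the half planes of analyticity. *)
Lemma continuation_eq (D : C -> Prop) (a : nat -> C -> C) (F : C -> C) (s d : C) :
  0 < Re s -> 0 < Re d -> (forall t, 0 <= t -> D (s + RtoC t * d)) ->
  (forall z, D z -> 0 < Re z -> analytic_at F z) ->
  (forall z, 1 < Re z -> serC (fun n => a n z) (F z)) ->
  continuation D a s = F s.
Proof.
  intros Hs Hd HD HF HS. unfold continuation.
  assert (Hre : forall t, Re (s + RtoC t * d) = (Re s + t * Re d)%R) by (intros t; unfold Re; simpl; cring).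
  apply (iota_unique (K := C_AbsRing) (V := C_CompleteNormedModule)).
  - intros w (c & G & Hc & HG & HGS & <-).
    assert (E : G s + - (1) * F s = 0).
    (* For t > 1 / Re d the real part has grown by more than 1. *)
    { apply (identity_on_ray (fun w => G w + - (1) * F w) s d (1 / Re d)%R).
      - intros E; rewrite E in Hd; unfold Re in Hd; simpl in Hd; lra.
      - apply Rdiv_lt_0_compat; lra.
      - intros t Ht. assert (0 <= t * Re d) by nra.
        apply analytic_minus; [apply HG|apply HF]; try apply HD; try exact Ht; rewrite Hre; lra.
      - intros t Ht. assert (H1 : 1 < t * Re d).
        { apply Rmult_lt_compat_r with (r := Re d) in Ht; [|exact Hd].
          unfold Rdiv in Ht. rewrite Rmult_assoc, Rinv_l, Rmult_1_l in Ht by lra. exact Ht. }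
        assert (H2 : 1 < Re (s + RtoC t * d)) by (rewrite Hre; lra).
        rewrite (serC_unique _ _ _ (HGS _ H2) (HS _ H2)). cring. }
    rewrite <- (Cplus_0_r (F s)), <- E. cring.
  - exists 0%R, F. repeat split; auto.
Qed.

(** * Improper integrals depending on a complex parameter *)

Lemma intC_unique (f : R -> C) (a b : R) (l m : C) : intC f a b l -> intC f a b m -> l = m.
Proof.
  intros H1 H2. rewrite <- (is_RInt_unique (V := C_R_CompleteNormedModule) _ _ _ _ H1).
  exact (is_RInt_unique (V := C_R_CompleteNormedModule) _ _ _ _ H2).
Qed.

(** The uniform structure on C is that of the product, so passing from its balls to [Cmod] costs a
    factor sqrt 2. *)
Lemma infC_spec (f : R -> C) (x : R) (l : C) :
  is_RInt_infty f x l <->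
  forall eps, 0 < eps -> exists N, forall y, N < y -> exists v, intC f x y v /\ Cmod (v - l) < eps.
Proof.
  split.
  - intros H eps Heps. assert (Hs : 0 < eps / sqrt 2) by (apply Rdiv_lt_0_compat; [exact Heps|apply Rlt_sqrt2_0]).
    destruct (proj1 (filterlimi_locally (fun ab => intC f (fst ab) (snd ab)) l) H (mkposreal _ Hs)) as [Q R0 HQ [N HN] HP].
    exists N; intros y Hy. destruct (HP x y HQ (HN y Hy)) as (v & Hv & Hb).
    exists v; split; [exact Hv|].
    apply (C_NormedModule_mixin_compat2 l v (mkposreal _ Hs)) in Hb.
    replace (sqrt 2 * mkposreal _ Hs)%R with eps in Hb; [exact Hb|].
    simpl. field. apply Rgt_not_eq, Rlt_sqrt2_0.
  - intros H. apply filterlimi_locally. intros eps.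
    destruct (H eps (cond_pos eps)) as [N HN].
    exists (fun a => a = x) (fun y => N < y); [reflexivity|exists N; auto|].
    intros a y -> Hy. destruct (HN y Hy) as (v & Hv & Hb). exists v; split; [exact Hv|].
    apply C_NormedModule_mixin_compat1, Hb.
Qed.

Lemma infC_mult_l (c : C) (f : R -> C) (x : R) (l : C) :
  is_RInt_infty f x l -> is_RInt_infty (fun u => c * f u) x (c * l).
Proof.
  rewrite !infC_spec. intros H eps Heps. pose proof (Cmod_ge_0 c) as Hc.
  destruct (H (eps / (Cmod c + 1))%R) as [N HN]; [apply Rdiv_lt_0_compat; lra|].
  exists N; intros y Hy. destruct (HN y Hy) as (v & Hv & Hb).
  exists (c * v). split; [apply intC_mult_l, Hv|].
  replace (c * v - c * l) with (c * (v - l)) by ring. rewrite Cmod_mult.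
  apply Rle_lt_trans with ((Cmod c) * (eps / (Cmod c + 1)))%R.
  - apply Rmult_le_compat_l; lra.
  - apply Rmult_lt_reg_r with (Cmod c + 1)%R; [lra|]. field_simplify; lra.
Qed.

Lemma infC_plus (f g : R -> C) (x : R) (l m : C) :
  is_RInt_infty f x l -> is_RInt_infty g x m -> is_RInt_infty (fun u => f u + g u) x (l + m).
Proof. exact (is_RInt_gen_plus (V := C_R_NormedModule) f g l m). Qed.

Lemma infC_ext (f g : R -> C) (x : R) (l : C) :
  (forall u, x < u -> f u = g u) -> is_RInt_infty f x l -> is_RInt_infty g x l.
Proof.
  rewrite !infC_spec. intros E H eps Heps. destruct (H eps Heps) as [N HN].
  exists (Rmax N x); intros y Hy.
  assert (N < y) by (eapply Rle_lt_trans; [apply Rmax_l|exact Hy]).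
  assert (x < y) by (eapply Rle_lt_trans; [apply Rmax_r|exact Hy]).
  destruct (HN y ltac:(assumption)) as (v & Hv & Hb). exists v; split; [|exact Hb].
  apply (intC_ext f); [lra| |exact Hv]. intros u Hu. apply E; lra.
Qed.

Lemma infC_unique (f : R -> C) (x : R) (l m : C) :
  is_RInt_infty f x l -> is_RInt_infty f x m -> l = m.
Proof.
  intros H1 H2. rewrite <- (is_RInt_gen_unique (V := C_R_CompleteNormedModule) _ _ H1).
  exact (is_RInt_gen_unique (V := C_R_CompleteNormedModule) _ _ H2).
Qed.

Lemma infC_of_lim (f I : R -> C) (x : R) (l : C) :
  (forall y, x <= y -> intC f x y (I y)) ->
  (forall eps, 0 < eps -> exists N, forall y, N < y -> Cmod (I y - l) < eps) ->
  is_RInt_infty f x l.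
Proof.
  intros HI H. apply infC_spec. intros eps Heps. destruct (H eps Heps) as [N HN].
  exists (Rmax N x); intros y Hy. exists (I y). split.
  - apply HI. left; eapply Rle_lt_trans; [apply Rmax_r|exact Hy].
  - apply HN. eapply Rle_lt_trans; [apply Rmax_l|exact Hy].
Qed.

Lemma infC_lim (f I : R -> C) (x : R) (l : C) :
  (forall y, x <= y -> intC f x y (I y)) -> is_RInt_infty f x l ->
  forall eps, 0 < eps -> exists N, forall y, N < y -> Cmod (I y - l) < eps.
Proof.
  intros HI H eps Heps. destruct (proj1 (infC_spec _ _ _) H eps Heps) as [N HN].
  exists (Rmax N x); intros y Hy.
  destruct (HN y) as (v & Hv & Hb); [eapply Rle_lt_trans; [apply Rmax_l|exact Hy]|].
  rewrite (intC_unique f x y (I y) v); [exact Hb| |exact Hv].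
  apply HI. left; eapply Rle_lt_trans; [apply Rmax_r|exact Hy].
Qed.

Lemma infC_sum (f : nat -> R -> C) (x : R) (l : nat -> C) (n : nat) :
  (forall j, is_RInt_infty (f j) x (l j)) ->
  is_RInt_infty (fun u => sum_n (fun j => f j u) n) x (sum_n l n).
Proof.
  intros H. induction n as [|n IH].
  - rewrite sumC_0. eapply infC_ext; [|apply H]. intros u _; simpl. rewrite sumC_0; reflexivity.
  - rewrite sumC_S. eapply infC_ext; [|apply infC_plus; [exact IH|apply H]].
    intros u _; simpl. rewrite sumC_S; reflexivity.
Qed.

(* The real power (cu)^(-tau) is written [exp (- tau * ln (c * u))]. *)
Lemma int_rpow (c tau x y : R) : 0 < c -> 0 < x -> 0 < tau -> x <= y ->
  is_RInt (fun u => exp (- tau * ln (c * u)) / u)%R x y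
    ((exp (- tau * ln (c * x)) - exp (- tau * ln (c * y))) / tau)%R.
Proof.
  intros Hc Hx Ht Hxy.
  replace ((exp (- tau * ln (c * x)) - exp (- tau * ln (c * y))) / tau)%R with
   (minus (- / tau * exp (- tau * ln (c * y))) (- / tau * exp (- tau * ln (c * x))))%R.
  2:{ unfold minus, plus, opp; simpl. field. lra. }
  apply (is_RInt_derive (V := R_CompleteNormedModule) (fun y => - / tau * exp (- tau * ln (c * y)))%R).
  - intros u Hu. rewrite Rmin_left, Rmax_right in Hu by assumption.
    auto_derive; [nra|]. field. repeat split; lra.
  - intros u Hu. rewrite Rmin_left, Rmax_right in Hu by assumption.
    apply (ex_derive_continuous (V := R_NormedModule)). auto_derive. repeat split; nra.
Qed.

Lemma rpow_lim (c tau : R) : 0 < c -> 0 < tau ->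
  forall eps, 0 < eps -> exists N, forall y, N < y -> exp (- tau * ln (c * y)) < eps.
Proof.
  (* The solution y of (c y)^(-tau) = eps. *)
  intros Hc Ht eps Heps. exists (exp (- ln eps / tau) / c)%R. intros y Hy.
  assert (Hp : 0 < exp (- ln eps / tau)) by apply exp_pos.
  assert (H1 : exp (- ln eps / tau) < c * y).
  { apply Rmult_lt_compat_l with (r := c) in Hy; [|exact Hc].
    replace (c * (exp (- ln eps / tau) / c))%R with (exp (- ln eps / tau)) in Hy by (field; lra). exact Hy. }
  apply ln_increasing in H1; [|exact Hp]. rewrite ln_exp in H1.
  rewrite <- (exp_ln eps) by exact Heps. apply exp_increasing.
  apply Rmult_lt_compat_l with (r := tau) in H1; [|exact Ht].
  replace (tau * (- ln eps / tau))%R with (- ln eps)%R in H1 by (field; lra). lra.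
Qed.

Lemma ln_mult_le (c x y : R) : 0 < c -> 0 < x -> x <= y -> ln (c * x) <= ln (c * y).
Proof. intros Hc Hx Hxy. apply Rcomplements.ln_le; nra. Qed.

(** The tail beyond y is at most K (c y)^(-tau) / tau by the explicit integral of the majorant,
    which gives the Cauchy criterion. The bound at y = x is kept in the conclusion because it turns
    pointwise estimates of Taylor remainders into estimates of their integrals. *)
Lemma infC_dominated (f : R -> C) (c x K tau : R) :
  0 < c -> 0 < x -> 0 < tau -> 0 <= K ->
  (forall y, x <= y -> exists l, intC f x y l) ->
  (forall u, x <= u -> Cmod (f u) <= K * (exp (- tau * ln (c * u)) / u)) ->
  exists l, is_RInt_infty f x l /\ Cmod l <= K * (exp (- tau * ln (c * x)) / tau).
Proof.
  intros Hc Hx Ht HK Hint Hf.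
  set (I := fun y => RInt (V := C_R_CompleteNormedModule) f x y : C).
  assert (HI : forall y, x <= y -> intC f x y (I y)).
  { intros y Hy. apply (RInt_correct (V := C_R_CompleteNormedModule)). apply Hint, Hy. }
  assert (Hdiff : forall y z, x <= y -> y <= z -> Cmod (I z - I y) <= K * (exp (- tau * ln (c * y)) / tau)).
  { intros y z Hy Hz.
    assert (H : intC f y z (I z - I y)).
    { replace (I z - I y) with (- I y + I z) by ring.
      exact (is_RInt_Chasles (V := C_R_NormedModule) f y x z (- I y) (I z)
        (is_RInt_swap (V := C_R_NormedModule) f y x (I y) (HI y Hy)) (HI z (Rle_trans _ _ _ Hy Hz))). }
    eapply Rle_trans.
    - eapply (intC_norm f (fun u => K * (exp (- tau * ln (c * u)) / u))%R y z); [exact Hz| |exact H|].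
      + intros u Hu. apply Hf. lra.
      + apply (is_RInt_scal (V := R_NormedModule)). apply int_rpow; lra.
    - unfold scal; simpl; unfold mult; simpl. apply Rmult_le_compat_l; [exact HK|].
      unfold Rdiv. apply Rmult_le_compat_r; [left; apply Rinv_0_lt_compat, Ht|].
      pose proof (exp_pos (- tau * ln (c * z))). lra. }
  assert (Hex : exists l : C, filterlim I (Rbar_locally p_infty) (locally (T := C_UniformSpace) l)).
  { apply (filterlim_locally_cauchy (U := C_CompleteNormedModule)).
    intros eps.
    destruct (rpow_lim c tau Hc Ht (eps * tau / (K + 1))%R) as [N HN].
    { apply Rdiv_lt_0_compat; [apply Rmult_lt_0_compat; [apply cond_pos|exact Ht]|lra]. }
    exists (fun y => Rmax N x < y). split; [exists (Rmax N x); auto|].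
    assert (Hw : forall u v, Rmax N x < u -> u <= v -> Cmod (I v - I u) < eps).
    { intros u v Hu Hv.
      assert (N < u) by (eapply Rle_lt_trans; [apply Rmax_l|exact Hu]).
      assert (x < u) by (eapply Rle_lt_trans; [apply Rmax_r|exact Hu]).
      eapply Rle_lt_trans; [apply Hdiff; lra|].
      specialize (HN u ltac:(assumption)).
      apply Rle_lt_trans with ((K + 1) * (exp (- tau * ln (c * u)) / tau))%R.
      - apply Rmult_le_compat_r; [|lra]. apply Rmult_le_pos; [left; apply exp_pos|left; apply Rinv_0_lt_compat, Ht].
      - apply Rmult_lt_reg_r with (tau / (K + 1))%R; [apply Rdiv_lt_0_compat; lra|].
        field_simplify; [|lra|lra]. rewrite (Rmult_comm tau). exact HN. }
    intros u v Hu Hv. destruct (Rle_dec u v) as [H|H].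
    - apply C_NormedModule_mixin_compat1. apply (Hw u v Hu H).
    - apply (ball_sym (M := C_UniformSpace)). apply C_NormedModule_mixin_compat1. apply (Hw v u Hv). lra. }
  destruct Hex as [l Hl]. exists l.
  assert (Hlim : forall eps, 0 < eps -> exists N, forall y, N < y -> Cmod (I y - l) < eps).
  { intros eps Heps.
    apply (filterlim_locally_ball_norm (K := C_AbsRing) (U := C_NormedModule)) with (eps := mkposreal _ Heps) in Hl.
    destruct Hl as [N HN]. exists N; intros y Hy. exact (HN y Hy). }
  split; [apply (infC_of_lim f I); assumption|].
  apply le_epsilon. intros eps Heps. destruct (Hlim eps Heps) as [N HN].
  set (y := (Rmax N x + 1)%R). assert (Hy : N < y /\ x <= y).
  { unfold y. pose proof (Rmax_l N x). pose proof (Rmax_r N x). lra. }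
  specialize (HN y (proj1 Hy)). specialize (Hdiff x y (Rle_refl x) (proj2 Hy)).
  assert (E : I x = 0).
  { apply (intC_unique f x x); [apply HI, Rle_refl|apply (is_RInt_point (V := C_R_NormedModule))]. }
  rewrite E in Hdiff. replace (I y - 0) with (I y) in Hdiff by ring.
  replace l with (I y + - (I y - l)) by ring.
  eapply Rle_trans; [apply Cmod_triangle|]. rewrite Cmod_opp. lra.
Qed.

(* The k-th derivative of (cu)^(-z) with respect to z. *)
Definition lpow (c : R) (k : nat) (z : C) (u : R) : C :=
  Rcpow (c * u) (- z) * RtoC (- ln (c * u)) ^ k.

Lemma Rcpow_mod (u : R) (z : C) : Cmod (Rcpow u z) = exp (Re z * ln u).
Proof. unfold Rcpow. rewrite Cmod_Cexp. f_equal. unfold Re; simpl; ring. Qed.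

Lemma lpow_mod (c : R) (k : nat) (z : C) (u : R) :
  Cmod (lpow c k z u) = (exp (- Re z * ln (c * u)) * Rabs (ln (c * u)) ^ k)%R.
Proof.
  unfold lpow. rewrite Cmod_mult, Rcpow_mod, Cmod_pow, Cmod_R, Rabs_Ropp. f_equal.
Qed.

(** (d X)^k / k! is a single term of the series of exp (d X), whence K = k! / d^k. *)
Lemma pow_le_exp (d : R) (k : nat) : 0 < d ->
  exists K, 0 <= K /\ forall X, 0 <= X -> X ^ k <= K * exp (d * X).
Proof.
  intros Hd. exists (INR (fact k) * / d ^ k)%R.
  assert (Hdk : 0 < / d ^ k) by apply Rinv_0_lt_compat, pow_lt, Hd.
  assert (Hf : 0 < INR (fact k)) by apply INR_fact_lt_0.
  split; [apply Rlt_le, Rmult_lt_0_compat; assumption|]. intros X HX.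
  assert (HdX : 0 <= d * X) by (apply Rmult_le_pos; lra).
  assert (Hpos : forall j, 0 <= (d * X) ^ j / INR (fact j)).
  { intros j. apply Rmult_le_pos; [apply pow_le, HdX|left; apply Rinv_0_lt_compat, INR_fact_lt_0]. }
  assert (H : (d * X) ^ k / INR (fact k) <= exp (d * X)).
  { eapply Rle_trans; [|apply (exp_ge_taylor _ k HdX)].
    destruct k as [|k]; [simpl; apply Rle_refl|]. rewrite tech5.
    assert (0 <= sum_f_R0 (fun k => (d * X) ^ k / INR (fact k))%R k) by (apply cond_pos_sum, Hpos). lra. }
  rewrite Rpow_mult_distr in H.
  apply Rmult_le_compat_l with (r := (INR (fact k) * / d ^ k)%R) in H; [|left; apply Rmult_lt_0_compat; assumption].
  eapply Rle_trans; [|exact H]. right. field. split; [lra|apply pow_nonzero; lra].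
Qed.

(** Where c u < 1 the logarithm is negative but lies above ln (c x), so its absolute value exceeds
    it by at most 2 |ln (c x)|. *)
Lemma abs_ln_le (c x u : R) : 0 < c -> 0 < x -> x <= u ->
  Rabs (ln (c * u)) <= ln (c * u) + 2 * Rabs (ln (c * x)).
Proof.
  intros Hc Hx Hu. pose proof (ln_mult_le c x u Hc Hx Hu).
  unfold Rabs; destruct (Rcase_abs (ln (c * u))), (Rcase_abs (ln (c * x))); lra.
Qed.

(** The decay exponent sigma is shared out: sigma/8 absorbs the power of the logarithm, 3 sigma/8
    the factor exp (3 |h| |log|) of the Taylor remainder for |h| <= sigma/8, and sigma/2 is left for
    convergence. *)
Lemma lpow_exp_bound (c x sigma : R) (k : nat) : 0 < c -> 0 < x -> 0 < sigma ->
  exists K, 0 <= K /\ forall u, x <= u ->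
    exp (- sigma * ln (c * u)) * Rabs (ln (c * u)) ^ k * exp (3 * (sigma / 8) * Rabs (ln (c * u)))
    <= K * exp (- (sigma / 2) * ln (c * u)).
Proof.
  intros Hc Hx Hs. destruct (pow_le_exp (sigma / 8) k ltac:(lra)) as (K0 & HK0 & HK).
  set (L0 := Rabs (ln (c * x))).
  (* The factor exp (sigma * L0) pays for replacing |L| by L + 2 L0 in an exponent where it is
     multiplied by sigma/2. *)
  exists (K0 * exp (sigma * L0))%R. split; [apply Rmult_le_pos; [exact HK0|left; apply exp_pos]|].
  intros u Hu. set (L := ln (c * u)). set (A := Rabs L).
  assert (HA : 0 <= A) by apply Rabs_pos.
  assert (HL : A <= L + 2 * L0) by (apply abs_ln_le; assumption).
  apply Rle_trans with (exp (- sigma * L) * (K0 * exp (sigma / 8 * A)) * exp (3 * (sigma / 8) * A))%R.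
  - apply Rmult_le_compat_r; [left; apply exp_pos|]. apply Rmult_le_compat_l; [left; apply exp_pos|]. apply HK, HA.
  - replace (exp (- sigma * L) * (K0 * exp (sigma / 8 * A)) * exp (3 * (sigma / 8) * A))%R
      with (K0 * exp (- sigma * L + (sigma / 2) * A))%R.
    2:{ replace (- sigma * L + sigma / 2 * A)%R with (- sigma * L + (sigma / 8 * A + 3 * (sigma / 8) * A))%R by field.
        rewrite !exp_plus. ring. }
    rewrite Rmult_assoc, <- exp_plus. apply Rmult_le_compat_l; [exact HK0|]. apply exp_le_compat. nra.
Qed.

(** Since (c u)^(-z-h) = (c u)^(-z) exp (-h L), the error is governed by a Taylor remainder of exp,
    at most X^(n+1)/(n+1)! exp X with X = |h L|. Written as 2^(-n-1) (2X)^(n+1)/(n+1)! exp X it is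
    at most 2^(-n) exp (3X): geometric decay in n, uniform in u apart from an exponential that the
    decay of the kernel absorbs. *)
Lemma lpow_expansion (c : R) (k : nat) (z h : C) (u : R) (n : nat) :
  Cmod (lpow c k (z + h) u - sum_n (fun j => h ^ j * (lpow c (k + j) z u / RtoC (INR (fact j)))) n)
  <= (1 / 2) ^ n * (exp (- Re z * ln (c * u)) * Rabs (ln (c * u)) ^ k * exp (3 * (Cmod h * Rabs (ln (c * u))))).
Proof.
  set (L := ln (c * u)).
  assert (E : lpow c k (z + h) u - sum_n (fun j => h ^ j * (lpow c (k + j) z u / RtoC (INR (fact j)))) n
     = lpow c k z u * (Cexp (h * RtoC (- L)) - sum_n (fun j => (h * RtoC (- L)) ^ j / RtoC (INR (fact j))) n)).
  { assert (E1 : lpow c k (z + h) u = lpow c k z u * Cexp (h * RtoC (- L))).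
    { unfold lpow, Rcpow. replace (- (z + h) * RtoC (ln (c * u))) with (- z * RtoC (ln (c * u)) + h * RtoC (- L)).
      - rewrite Cexp_plus. cring.
      - rewrite RtoC_opp. unfold L. cring. }
    rewrite E1. clear E1.
    assert (E2 : forall n, sum_n (fun j => h ^ j * (lpow c (k + j) z u / RtoC (INR (fact j)))) n
       = lpow c k z u * sum_n (fun j => (h * RtoC (- L)) ^ j / RtoC (INR (fact j))) n).
    { assert (Et : forall j, h ^ j * (lpow c (k + j) z u / RtoC (INR (fact j))) = lpow c k z u * ((h * RtoC (- L)) ^ j / RtoC (INR (fact j)))).
      { intros j. unfold lpow. rewrite Cpow_add_r, Cpow_mult_l. fold L. unfold Cdiv. cring. }
      clear n; intros n; induction n as [|n IH]; [rewrite !sumC_0; apply Et|].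
      rewrite !sumC_S, IH, Et. cring. }
    rewrite E2. cring. }
  rewrite E, Cmod_mult, lpow_mod. fold L.
  set (X := Cmod (h * RtoC (- L))).
  assert (HX : X = (Cmod h * Rabs L)%R) by (unfold X; rewrite Cmod_mult, Cmod_R, Rabs_Ropp; reflexivity).
  assert (HX0 : 0 <= X) by apply Cmod_ge_0.
  rewrite <- HX.
  assert (HT : Cmod (Cexp (h * RtoC (- L)) - sum_n (fun j => (h * RtoC (- L)) ^ j / RtoC (INR (fact j))) n)
     <= (1 / 2) ^ n * exp (3 * X)).
  { eapply Rle_trans; [apply Cexp_taylor|]. fold X.
    replace (3 * X)%R with (2 * X + X)%R by ring. rewrite exp_plus, <- Rmult_assoc.
    apply Rmult_le_compat_r; [left; apply exp_pos|].
    assert (H2X : 0 <= 2 * X) by lra.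
    assert (H : (2 * X) ^ S n / INR (fact (S n)) <= exp (2 * X)).
    { eapply Rle_trans; [|apply (exp_ge_taylor _ (S n) H2X)]. rewrite tech5.
      assert (0 <= sum_f_R0 (fun k => (2 * X) ^ k / INR (fact k))%R n); [|lra].
      apply cond_pos_sum. intros j. apply Rmult_le_pos; [apply pow_le, H2X|left; apply Rinv_0_lt_compat, INR_fact_lt_0]. }
    replace (X ^ S n / INR (fact (S n)))%R with ((1 / 2) ^ S n * ((2 * X) ^ S n / INR (fact (S n))))%R.
    - apply Rmult_le_compat; [apply pow_le; lra| | |exact H].
      + apply Rmult_le_pos; [apply pow_le, H2X|left; apply Rinv_0_lt_compat, INR_fact_lt_0].
      + simpl. pose proof (pow_le (1/2) n ltac:(lra)). lra.
    - rewrite Rpow_mult_distr. replace ((1 / 2) ^ S n)%R with (/ 2 ^ S n)%R.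
      + field. split; [apply INR_fact_neq_0|apply pow_nonzero; lra].
      + unfold Rdiv. rewrite Rmult_1_l, pow_inv. reflexivity. }
  apply Rmult_le_compat_l with (r := (exp (- Re z * L) * Rabs L ^ k)%R) in HT.
  - eapply Rle_trans; [exact HT|]. right. cring.
  - apply Rmult_le_pos; [left; apply exp_pos|apply pow_le, Rabs_pos].
Qed.

(** For k = 0 the term with [pred k] has the coefficient [INR 0], so the convention [pred 0 = 0]
    does no harm. *)
Lemma derC_lpow (c : R) (k : nat) (z : C) (u : R) : 0 < c -> 0 < u ->
  derC (lpow c k z) u (- ((z * lpow c k z u + INR k * lpow c (pred k) z u) / RtoC u)).
Proof.
  intros Hc Hu.
  assert (HL : forall a : R, derC (fun u => RtoC (a * ln (c * u))) u (RtoC (a / u))).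
  { intros a. apply derC_RtoC. auto_derive; [apply Rmult_lt_0_compat; assumption|]. field. split; lra. }
  assert (Hu0 : RtoC u <> 0) by (intros E; apply RtoC_inj in E; lra).
  eapply derC_eq.
  - unfold lpow. apply derC_mult; [|apply derC_pow].
    + unfold Rcpow. apply (derC_Cexp (fun u => - z * RtoC (ln (c * u)))).
      apply derC_mult; [apply derC_const|].
      apply (derC_ext (fun u => RtoC (1 * ln (c * u)))); [intros v; f_equal; ring|apply (HL 1%R)].
    + apply (derC_ext (fun u => RtoC (-1 * ln (c * u)))); [intros v; f_equal; ring|apply (HL (-1)%R)].
  - cbv beta. fold (Rcpow (c * u) (- z)). rewrite !RtoC_div by lra.
    Ceq. unfold lpow. field. exact Hu0.
Qed.

Lemma contC_lpow (c : R) (k : nat) (z : C) (u : R) : 0 < c -> 0 < u -> contC (lpow c k z) u.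
Proof. intros Hc Hu. eapply derC_cont, derC_lpow; assumption. Qed.

Lemma contC_div_id (f : R -> C) (u : R) : 0 < u -> contC f u -> contC (fun u => f u / RtoC u) u.
Proof.
  intros Hu Hf. apply contC_mult; [exact Hf|].
  apply (continuous_ext_loc (T := R_UniformSpace) (U := C_UniformSpace) (fun u => / RtoC u) (fun u => RtoC (/ u)) u).
  - exists (mkposreal _ Hu). intros v Hv. apply RtoC_inv.
    unfold ball in Hv; simpl in Hv; unfold AbsRing_ball, abs, minus, plus, opp in Hv; simpl in Hv.
    intros ->. rewrite Rplus_0_l, Rabs_Ropp, Rabs_pos_eq in Hv; lra.
  - eapply derC_cont, derC_RtoC. auto_derive; [lra|reflexivity].
Qed.

(** The weights met below may have jumps, so integrability of their products with continuous
    functions does not come from continuity; it is made part of the notion, which is then stable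
    under sums and bounded continuous factors. *)
Definition admissible (B : R -> C) (x : R) : Prop :=
  (exists M, forall u, x <= u -> Cmod (B u) <= M) /\
  (forall g : R -> C, (forall u, 0 < u -> contC g u) ->
     forall y, x <= y -> exists l, intC (fun u => B u * g u) x y l).

(** Meant as the k-th z-derivative of the Mellin-type integral of B(u) (c u)^(-z) du / u. [RInt_gen]
    being total, this is a function on all of C, with its intended meaning for Re z > 0. *)
Definition GI (B : R -> C) (c x : R) (k : nat) (z : C) : C :=
  RInt_gen (V := C_R_CompleteNormedModule) (fun u => B u * (lpow c k z u / RtoC u))
    (at_point x) (Rbar_locally p_infty).

Lemma GI_of (B : R -> C) (c x : R) (k : nat) (z l : C) :
  is_RInt_infty (fun u => B u * (lpow c k z u / RtoC u)) x l -> GI B c x k z = l.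
Proof. intros H. exact (is_RInt_gen_unique (V := C_R_CompleteNormedModule) _ l H). Qed.

Lemma GI_correct (B : R -> C) (c x : R) (k : nat) (z : C) :
  0 < c -> 0 < x -> admissible B x -> 0 < Re z ->
  is_RInt_infty (fun u => B u * (lpow c k z u / RtoC u)) x (GI B c x k z).
Proof.
  intros Hc Hx [[M HM] HB] Hz.
  destruct (lpow_exp_bound c x (Re z) k Hc Hx Hz) as (K & HK & HK').
  assert (HM0 : 0 <= M) by (eapply Rle_trans; [apply Cmod_ge_0|apply (HM x (Rle_refl x))]).
  destruct (infC_dominated (fun u => B u * (lpow c k z u / RtoC u)) c x (M * K) (Re z / 2) Hc Hx) as (l & Hl & _).
  - lra.
  - apply Rmult_le_pos; assumption.
  - intros y Hy. apply HB; [|exact Hy]. intros u Hu. apply contC_div_id; [exact Hu|]. apply contC_lpow; assumption.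
  - intros u Hu. rewrite Cmod_mult, Cmod_div, Cmod_R, (Rabs_pos_eq u) by (try (intros E; apply RtoC_inj in E); lra).
    rewrite Rmult_assoc. apply Rmult_le_compat; [apply Cmod_ge_0| |apply HM, Hu|].
    + apply Rmult_le_pos; [apply Cmod_ge_0|left; apply Rinv_0_lt_compat; lra].
    + unfold Rdiv. rewrite <- Rmult_assoc.
      apply Rmult_le_compat_r; [left; apply Rinv_0_lt_compat; lra|].
      rewrite lpow_mod. eapply Rle_trans; [|apply HK', Hu].
      rewrite <- (Rmult_1_r (_ * _)) at 1. apply Rmult_le_compat_l.
      * apply Rmult_le_pos; [left; apply exp_pos|apply pow_le, Rabs_pos].
      * rewrite <- exp_0 at 1. apply exp_le_compat. apply Rmult_le_pos; [lra|apply Rabs_pos].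
  - rewrite (GI_of _ _ _ _ _ _ Hl). exact Hl.
Qed.

(* In particular F k is the k-th derivative of F 0. *)
Definition taylor (U : C -> Prop) (F : nat -> C -> C) : Prop :=
  forall z, U z -> forall k, expands (F k) z (fun j => F (k + j)%nat z / RtoC (INR (fact j))).

(** Sum and integral are exchanged by hand: the integral of the n-th Taylor remainder of the kernel,
    times B(u) / u, is computed by linearity on one side and bounded by a constant times 2^(-n)
    through domination on the other. *)
Lemma taylor_GI (B : R -> C) (c x : R) : 0 < c -> 0 < x -> admissible B x ->
  taylor (fun z => 0 < Re z) (GI B c x).
Proof.
  intros Hc Hx HB z Hz k.
  destruct (lpow_exp_bound c x (Re z) k Hc Hx Hz) as (K & HK & HK').
  destruct (proj1 HB) as [M HM].
  assert (HM0 : 0 <= M) by (eapply Rle_trans; [apply Cmod_ge_0|apply (HM x (Rle_refl x))]).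
  (* The range of |h| for which [lpow_exp_bound] absorbs exp (3 |h| |log|). *)
  exists (Re z / 8)%R. split; [lra|]. intros h Hh.
  apply serC_of_geometric with (M := (M * K * (exp (- (Re z / 2) * ln (c * x)) / (Re z / 2)))%R).
  intros n.
  assert (Hzh : 0 < Re (z + h)).
  { pose proof (re_le_Cmod h) as H. apply Rabs_le_between in H. replace (Re (z + h)) with (Re z + Re h)%R by reflexivity. lra. }
  pose proof (infC_sum (fun j u => h ^ j / RtoC (INR (fact j)) * (B u * (lpow c (k + j) z u / RtoC u))) x
    (fun j => h ^ j / RtoC (INR (fact j)) * GI B c x (k + j) z) n
    (fun j => infC_mult_l _ _ _ _ (GI_correct B c x (k + j) z Hc Hx HB Hz))) as HS.
  pose proof (infC_plus _ _ _ _ _ (infC_mult_l (- (1)) _ _ _ HS) (GI_correct B c x k (z + h) Hc Hx HB Hzh)) as HD.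
  assert (E : forall u, - (1) * sum_n (fun j => h ^ j / RtoC (INR (fact j)) * (B u * (lpow c (k + j) z u / RtoC u))) n
      + B u * (lpow c k (z + h) u / RtoC u) =
     B u * ((lpow c k (z + h) u - sum_n (fun j => h ^ j * (lpow c (k + j) z u / RtoC (INR (fact j)))) n) / RtoC u)).
  { intros u.
    assert (E : sum_n (fun j => h ^ j / RtoC (INR (fact j)) * (B u * (lpow c (k + j) z u / RtoC u))) n
       = B u * (sum_n (fun j => h ^ j * (lpow c (k + j) z u / RtoC (INR (fact j)))) n / RtoC u)).
    { clear. induction n as [|n IH]; [rewrite !sumC_0|rewrite !sumC_S, IH]; unfold Cdiv; cring. }
    rewrite E. unfold Cdiv; cring. }
  apply (infC_ext _ _ _ _ (fun u _ => E u)) in HD.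
  destruct (infC_dominated (fun u => B u * ((lpow c k (z + h) u - sum_n (fun j => h ^ j * (lpow c (k + j) z u / RtoC (INR (fact j)))) n) / RtoC u))
     c x (M * K * (1 / 2) ^ n) (Re z / 2) Hc Hx) as (l & Hl & Hb).
  - lra.
  - apply Rmult_le_pos; [apply Rmult_le_pos; assumption|apply pow_le; lra].
  - intros y Hy. apply (proj2 HB); [|exact Hy]. intros u Hu. apply contC_div_id; [exact Hu|].
    apply contC_plus; [apply contC_lpow; assumption|].
    apply (continuous_opp (V := C_R_NormedModule)).
    clear - Hc Hu. induction n as [|n IH].
    + apply continuous_ext with (f := fun u => h ^ 0 * (lpow c (k + 0) z u / RtoC (INR (fact 0)))).
      { intros v; symmetry; apply sumC_0. }
      apply contC_mult; [apply contC_const|]. apply contC_mult; [apply contC_lpow; assumption|apply contC_const].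
    + apply continuous_ext with (f := fun u => sum_n (fun j => h ^ j * (lpow c (k + j) z u / RtoC (INR (fact j)))) n + h ^ S n * (lpow c (k + S n) z u / RtoC (INR (fact (S n))))).
      { intros v; symmetry; apply sumC_S. }
      apply contC_plus; [exact IH|].
      apply contC_mult; [apply contC_const|]. apply contC_mult; [apply contC_lpow; assumption|apply contC_const].
  - intros u Hu. rewrite Cmod_mult, Cmod_div, Cmod_R, (Rabs_pos_eq u) by (try (intros E0; apply RtoC_inj in E0); lra).
    rewrite !Rmult_assoc. apply Rmult_le_compat; [apply Cmod_ge_0| |apply HM, Hu|].
    + apply Rmult_le_pos; [apply Cmod_ge_0|left; apply Rinv_0_lt_compat; lra].
    + unfold Rdiv. rewrite <- !Rmult_assoc.
      apply Rmult_le_compat_r; [left; apply Rinv_0_lt_compat; lra|].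
      eapply Rle_trans; [apply lpow_expansion|].
      rewrite (Rmult_comm K), (Rmult_assoc _ K). apply Rmult_le_compat_l; [apply pow_le; lra|].
      eapply Rle_trans; [|apply HK', Hu]. apply Rmult_le_compat_l.
      * apply Rmult_le_pos; [left; apply exp_pos|apply pow_le, Rabs_pos].
      * apply exp_le_compat. pose proof (Rabs_pos (ln (c * u))). nra.
  - rewrite (infC_unique _ _ _ _ Hl HD) in Hb.
    replace (sum_n (fun j => h ^ j * (GI B c x (k + j) z / RtoC (INR (fact j)))) n - GI B c x k (z + h)) with
     (- (- (1) * sum_n (fun j => h ^ j / RtoC (INR (fact j)) * GI B c x (k + j) z) n + GI B c x k (z + h))).
    + rewrite Cmod_opp. eapply Rle_trans; [exact Hb|]. right. cring.
    + replace (sum_n (fun j => h ^ j / RtoC (INR (fact j)) * GI B c x (k + j) z) n)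
       with (sum_n (fun j => h ^ j * (GI B c x (k + j) z / RtoC (INR (fact j)))) n); [cring|].
      apply sum_n_ext. intros j. unfold Cdiv; cring.
Qed.

(** * Higher derivatives *)

Lemma sumC_n_n (f : nat -> C) (n : nat) : sum_n_m f n n = f n.
Proof. exact (sum_n_n (G := C_AbelianMonoid) f n). Qed.

Lemma sumC_n_Sm (f : nat -> C) (m n : nat) : (m <= S n)%nat -> sum_n_m f m (S n) = sum_n_m f m n + f (S n).
Proof. exact (sum_n_Sm (G := C_AbelianMonoid) f m n). Qed.

Lemma sumC_n_m_zero (f : nat -> C) (m n : nat) : (n < m)%nat -> sum_n_m f m n = RtoC 0.
Proof. exact (sum_n_m_zero (G := C_AbelianMonoid) f m n). Qed.

Definition openC (U : C -> Prop) : Prop :=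
  forall z, U z -> exists d, 0 < d /\ forall w, Cmod (w - z) < d -> U w.

Lemma openC_locally (U P : C -> Prop) (z : C) : openC U -> U z -> (forall w, U w -> P w) ->
  locally (T := AbsRing_UniformSpace C_AbsRing) z P.
Proof.
  intros HU Hz HP. destruct (HU z Hz) as (d & Hd & H).
  apply (locally_le_locally_norm (K := C_AbsRing) (V := AbsRing_NormedModule C_AbsRing)).
  exists (mkposreal _ Hd). intros w Hw. apply HP, H. exact Hw.
Qed.

Lemma openC_half_plane : openC (fun z => 0 < Re z).
Proof.
  intros z Hz. exists (Re z). split; [exact Hz|]. intros w Hw.
  pose proof (re_le_Cmod (w - z)) as H. apply Rabs_le_between in H.
  replace (Re (w - z)) with (Re w - Re z)%R in H by reflexivity. lra.
Qed.

Lemma openC_punctured : openC (fun z => 0 < Re z /\ z <> 1).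
Proof.
  intros z [Hz H1]. destruct (openC_half_plane z Hz) as (d & Hd & H).
  assert (Hm : 0 < Cmod (1 - z)).
  { apply Cmod_gt_0. intros E. apply H1. rewrite <- (Cplus_0_l z), <- E. ring. }
  exists (Rmin d (Cmod (1 - z))). split; [apply Rmin_glb_lt; assumption|]. intros w Hw. split.
  - apply H. eapply Rlt_le_trans; [exact Hw|apply Rmin_l].
  - intros ->. pose proof (Rmin_r d (Cmod (1 - z))). lra.
Qed.

(** Weaker than [taylor], but all that iterated [C_derive] requires; the pole term is treated at
    this level. *)
Definition derivatives (U : C -> Prop) (F : nat -> C -> C) : Prop :=
  forall z, U z -> forall k, holC (F k) z (F (S k) z).

(** A derivative depends on the values in a neighbourhood, so at each order the identity must hold
    on an open set and not merely at the point z. *)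
Lemma C_derive_n_eq (U : C -> Prop) (F : nat -> C -> C) (f : C -> C) :
  openC U -> derivatives U F -> (forall z, U z -> f z = F 0%nat z) ->
  forall r z, U z -> C_derive_n r f z = F r z.
Proof.
  intros HU HF Hf r. induction r as [|r IH]; intros z Hz; [apply Hf, Hz|].
  apply is_C_derive_unique. eapply is_derive_ext_loc; [|apply HF, Hz].
  apply (openC_locally U); [exact HU|exact Hz|]. intros w Hw. symmetry. apply IH, Hw.
Qed.

Lemma taylor_derivatives (U : C -> Prop) (F : nat -> C -> C) : taylor U F -> derivatives U F.
Proof.
  intros H z Hz k. pose proof (expands_derive _ _ _ (H z Hz k)) as E.
  cbv beta in E. rewrite Nat.add_1_r in E.
  replace (F (S k) z) with (F (S k) z / RtoC (INR (fact 1))) by (simpl; field). exact E.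
Qed.

Lemma taylor_analytic (U : C -> Prop) (F : nat -> C -> C) (z : C) :
  taylor U F -> U z -> analytic_at (F 0%nat) z.
Proof. intros H Hz. eapply expands_analytic, H, Hz. Qed.

Lemma taylor_plus (U : C -> Prop) (F G : nat -> C -> C) :
  taylor U F -> taylor U G -> taylor U (fun k z => F k z + G k z).
Proof.
  intros HF HG z Hz k. eapply expands_ext; [|apply expands_plus; [apply HF, Hz|apply HG, Hz]].
  intros j; simpl. unfold Cdiv. ring.
Qed.

Lemma taylor_scal (U : C -> Prop) (c : C) (F : nat -> C -> C) :
  taylor U F -> taylor U (fun k z => c * F k z).
Proof.
  intros HF z Hz k. eapply expands_ext; [|apply expands_scal, HF, Hz].
  intros j; simpl. unfold Cdiv. ring.
Qed.

Lemma taylor_sum_n_m (U : C -> Prop) (F : nat -> nat -> C -> C) (m n : nat) :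
  (forall a, (m <= a <= n)%nat -> taylor U (F a)) -> taylor U (fun k z => sum_n_m (fun a => F a k z) m n).
Proof.
  destruct (Nat.le_gt_cases m n) as [Hmn|Hmn].
  - induction Hmn as [|n Hmn IH]; intros H z Hz k.
    + apply (expands_ext_loc (F m k)) with (d := 1%R); [lra|intros w _; symmetry; apply (sumC_n_n (fun a => F a k w))|].
      eapply expands_ext; [|apply H; [lia|exact Hz]]. intros j. simpl. rewrite sumC_n_n; reflexivity.
    + apply (expands_ext_loc (fun w => sum_n_m (fun a => F a k w) m n + F (S n) k w)) with (d := 1%R); [lra| |].
      { intros w _; symmetry. apply (sumC_n_Sm (fun a => F a k w)). lia. }
      eapply expands_ext; [|apply expands_plus; [apply IH; [|exact Hz]|apply H; [|exact Hz]]].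
      * intros j. simpl. rewrite sumC_n_Sm by lia.
        unfold Cdiv. cring.
      * intros a Ha. apply H. lia.
      * lia.
  - intros _ z Hz k.
    apply (expands_ext_loc (fun _ => RtoC 0)) with (d := 1%R); [lra|intros w _; symmetry; apply (sumC_n_m_zero (fun a => F a k w)); lia|].
    eapply expands_ext; [|apply expands_const].
    intros j. simpl. rewrite sumC_n_m_zero by lia.
    destruct j; unfold Cdiv; rewrite Cmult_0_l; reflexivity.
Qed.

Lemma taylor_sum_n (U : C -> Prop) (F : nat -> nat -> C -> C) (n : nat) :
  (forall a, taylor U (F a)) -> taylor U (fun k z => sum_n (fun a => F a k z) n).
Proof. intros H. apply (taylor_sum_n_m U F 0 n). intros a _; apply H. Qed.

Lemma taylor_const (U : C -> Prop) (c : C) :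
  taylor U (fun k _ => match k with O => c | S _ => RtoC 0 end).
Proof.
  intros z Hz [|k].
  - eapply expands_ext; [|apply expands_const]. intros [|j]; simpl; field.
    change (RtoC (INR (fact (S j))) <> 0). intros E. apply RtoC_inj in E. revert E; apply INR_fact_neq_0.
  - eapply expands_ext; [|apply expands_const]. intros [|j]; simpl; unfold Cdiv; ring.
Qed.

(* Leibniz' rule for the product with the identity. *)
Definition mul_id (F : nat -> C -> C) (k : nat) (z : C) : C :=
  z * F k z + RtoC (INR k) * F (pred k) z.

(** Multiplication by w contributes F_(k+j-1)/(j-1)! = j F_(k+j-1)/j! to the coefficient, and the
    term k F_(k-1) contributes k F_(k+j-1)/j!; together they give the factor k + j of Leibniz' rule
    at order k + j. *)
Lemma taylor_mul_id (U : C -> Prop) (F : nat -> C -> C) : taylor U F -> taylor U (mul_id F).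
Proof.
  intros HF z Hz k. unfold mul_id.
  eapply expands_ext; [|apply expands_plus; [apply expands_mul_id, HF, Hz|apply expands_scal, HF, Hz]].
  assert (Hfact : forall j, RtoC (INR (fact j)) <> 0).
  { intros j E. apply RtoC_inj in E. revert E; apply INR_fact_neq_0. }
  intros [|j].
  - rewrite !Nat.add_0_r. unfold Cdiv. cring.
  - rewrite Nat.add_succ_r. simpl pred. rewrite (fact_simpl j), mult_INR, RtoC_mult.
    assert (Hj : RtoC (INR (S j)) <> 0).
    { intros E. apply RtoC_inj in E. revert E; apply not_0_INR; lia. }
    destruct k as [|k].
    + simpl (INR 0). simpl (0 + j)%nat. simpl pred.
      set (A := F (S j) z). set (B := F j z). field. split; [apply Hfact|exact Hj].
    + simpl pred. rewrite Nat.add_succ_r. simpl (S k + j)%nat.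
      replace (INR (S (S (k + j)))) with (INR (S k) + INR (S j))%R by (rewrite <- plus_INR; f_equal; lia).
      rewrite RtoC_plus. field. split; [apply Hfact|exact Hj].
Qed.

Lemma taylor_lpow (c u : R) (U : C -> Prop) : taylor U (fun k z => lpow c k z u).
Proof.
  intros z _ k. exists 1%R. split; [lra|]. intros h Hh.
  apply serC_of_geometric with (M := (exp (- Re z * ln (c * u)) * Rabs (ln (c * u)) ^ k * exp (3 * (Cmod h * Rabs (ln (c * u)))))%R).
  intros n. replace (sum_n _ n - lpow c k (z + h) u) with
   (- (lpow c k (z + h) u - sum_n (fun j => h ^ j * (lpow c (k + j) z u / RtoC (INR (fact j)))) n)) by ring.
  rewrite Cmod_opp. eapply Rle_trans; [apply lpow_expansion|]. right. apply Rmult_comm.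
Qed.

Lemma taylor_ext (U : C -> Prop) (F G : nat -> C -> C) :
  (forall k z, F k z = G k z) -> taylor U F -> taylor U G.
Proof.
  intros E H z Hz k. apply (expands_ext_loc (F k)) with (d := 1%R); [lra|intros; apply E|].
  eapply expands_ext; [|apply H, Hz]. intros j; simpl; rewrite E; reflexivity.
Qed.

Lemma lpow_0 (c : R) (z : C) (u : R) : lpow c 0 z u = Rcpow (c * u) (- z).
Proof. unfold lpow. simpl. ring. Qed.

Lemma C_derive_n_lpow (c u : R) (f : C -> C) (r : nat) (s : C) :
  (forall z, f z = Rcpow (c * u) (- z)) -> C_derive_n r f s = lpow c r s u.
Proof.
  intros H. apply (C_derive_n_eq (fun _ => True) (fun k z => lpow c k z u)); auto.
  - intros z _. exists 1%R. split; [lra|auto].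
  - apply taylor_derivatives, taylor_lpow.
  - intros z _. rewrite H, lpow_0. reflexivity.
Qed.

Lemma C_derive_n_mul_lpow (c u : R) (f : C -> C) (r : nat) (s : C) :
  (forall z, f z = z * Rcpow (c * u) (- z)) ->
  C_derive_n r f s = mul_id (fun k z => lpow c k z u) r s.
Proof.
  intros H. apply (C_derive_n_eq (fun _ => True) (mul_id (fun k z => lpow c k z u))); auto.
  - intros z _. exists 1%R. split; [lra|auto].
  - apply taylor_derivatives, taylor_mul_id, taylor_lpow.
  - intros z _. rewrite H. unfold mul_id. rewrite lpow_0. simpl. ring.
Qed.

(* Differentiating (z - 1) P = X^(1-z) k times gives (z - 1) P_k + k P_(k-1) = X (-log X)^k X^(-z). *)
Fixpoint pole_part (X : R) (k : nat) (z : C) : C :=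
  match k with
  | O => RtoC X * lpow 1 0 z X / (z - 1)
  | S j => (RtoC X * lpow 1 (S j) z X - RtoC (INR (S j)) * pole_part X j z) / (z - 1)
  end.

Lemma holC_plus (f g : C -> C) (z a b : C) : holC f z a -> holC g z b -> holC (fun w => f w + g w) z (a + b).
Proof. exact (is_derive_plus (K := C_AbsRing) (V := C_NormedModule) f g z a b). Qed.

Lemma holC_mult (f g : C -> C) (z a b : C) : holC f z a -> holC g z b ->
  holC (fun w => f w * g w) z (a * g z + f z * b).
Proof.
  (* [is_derive_mult] speaks of C with the module structure of its absolute-value ring; both
     structures have the same derivatives. *)
  assert (T : forall k z l, holC k z l <-> @is_derive C_AbsRing (AbsRing_NormedModule C_AbsRing) k z l).
  { intros k w l. split; intros [_ H]; (split; [apply (is_linear_scal_l (K := C_AbsRing))|exact H]). }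
  rewrite !T. intros Hf Hg. exact (is_derive_mult (K := C_AbsRing) f g z a b Hf Hg Cmult_comm).
Qed.

Lemma holC_const (c z : C) : holC (fun _ => c) z (RtoC 0).
Proof. exact (is_derive_const (K := C_AbsRing) (V := C_NormedModule) c z). Qed.

Lemma holC_eq (f : C -> C) (z a b : C) : holC f z a -> a = b -> holC f z b.
Proof. intros H <-; exact H. Qed.

Lemma expands_inv_shift (z : C) : z <> 1 ->
  expands (fun w => / (w - 1)) z (fun j => (- (1)) ^ j / (z - 1) ^ S j).
Proof.
  intros Hz. assert (H : z - 1 <> 0).
  { intros E. apply Hz. rewrite <- (Cplus_0_l 1), <- E. ring. }
  destruct (expands_inv (z - 1) H) as (rho & Hrho & E). exists rho. split; [exact Hrho|].
  intros h Hh. replace (z + h - 1) with (z - 1 + h) by ring. apply E, Hh.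
Qed.

(** Each member is a numerator times 1/(z - 1), so the product rule reduces the claim for k + 1 to
    that for k; the recursion stands in for a closed formula. *)
Lemma derivatives_pole_part (X : R) : derivatives (fun z => 0 < Re z /\ z <> 1) (pole_part X).
Proof.
  intros z [_ Hz].
  assert (Hz0 : z - 1 <> 0).
  { intros E. apply Hz. rewrite <- (Cplus_0_l 1), <- E. ring. }
  assert (Hinv : holC (fun w => / (w - 1)) z (- / ((z - 1) * (z - 1)))).
  { eapply holC_eq; [apply (expands_derive _ _ _ (expands_inv_shift z Hz))|]. cbv beta. simpl. Ceq. field. exact Hz0. }
  assert (Hl : forall k, holC (fun w => RtoC X * lpow 1 k w X) z (RtoC X * lpow 1 (S k) z X)).
  { intros k. exact (taylor_derivatives _ _ (taylor_scal (fun _ => True) (RtoC X) _ (taylor_lpow 1 X _)) z I k). }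
  intros k. induction k as [|k IH].
  - simpl pole_part. eapply holC_eq; [apply holC_mult; [apply Hl|exact Hinv]|].
    change (pole_part X 1 z) with ((RtoC X * lpow 1 1 z X - RtoC 1 * (RtoC X * lpow 1 0 z X / (z - 1))) / (z - 1)).
    Ceq. cbv beta. field. exact Hz0.
  - pose proof (holC_mult _ _ _ _ _ (holC_plus _ _ _ _ _ (Hl (S k))
      (holC_mult _ _ _ _ _ (holC_const (- RtoC (INR (S k))) z) IH)) Hinv) as Hk.
    eapply is_derive_ext; [|eapply holC_eq; [exact Hk|]].
    + intros w. change (pole_part X (S k) w) with ((RtoC X * lpow 1 (S k) w X - RtoC (INR (S k)) * pole_part X k w) / (w - 1)).
      unfold Cdiv, Cminus. Ceq. ring.
    + change (pole_part X (S (S k)) z) with ((RtoC X * lpow 1 (S (S k)) z X - RtoC (INR (S (S k))) * pole_part X (S k) z) / (z - 1)).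
      rewrite (S_INR (S k)), (RtoC_plus (INR (S k)) 1).
      (* The recursion solved for its leading term, which can then be eliminated. *)
      assert (E : RtoC X * lpow 1 (S k) z X = pole_part X (S k) z * (z - 1) + RtoC (INR (S k)) * pole_part X k z).
      { change (pole_part X (S k) z) with ((RtoC X * lpow 1 (S k) z X - RtoC (INR (S k)) * pole_part X k z) / (z - 1)).
        field. exact Hz0. }
      cbv beta. rewrite E. Ceq. field. exact Hz0.
Qed.

(** * Partial summation *)

Lemma sumC_ext (f g : nat -> C) (n : nat) : (forall k, f k = g k) -> sum_n f n = sum_n g n.
Proof. exact (sum_n_ext (G := C_AbelianMonoid) f g n). Qed.

Lemma sumC_tail (f : nat -> C) (m n : nat) : (m <= n)%nat ->
  (forall k, (m < k)%nat -> f k = 0) -> sum_n f n = sum_n f m.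
Proof.
  intros Hmn H. induction Hmn as [|n Hmn IH]; [reflexivity|].
  rewrite sumC_S, IH, H by lia. cring.
Qed.

(** The mask sets the terms beyond y to zero, so every N with y < N + 1 may serve as upper limit.
    With one N for all u <= b, sums of variable length become sums over a fixed index set. *)
Lemma sum_upto_eq (y : R) (f : nat -> C) (N : nat) : y < INR (S N) ->
  sum_upto y f = sum_n (fun n => if Rle_dec (INR n) y then f n else RtoC 0) N.
Proof.
  intros Hy. unfold sum_upto. set (m := Z.to_nat (Int_part y)).
  assert (Hm : y < INR (S m)).
  { unfold m. destruct (base_Int_part y) as [H1 H2]. rewrite S_INR, INR_IZR_INZ.
    (* For negative y the index is 0 because of [Z.to_nat], and y < 1 holds anyway. *)
    destruct (Z_lt_le_dec (Int_part y) 0) as [H|H].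
    - apply IZR_lt in H. assert (IZR (Int_part y) <= -1).
      { apply IZR_le. apply lt_IZR in H. lia. }
      pose proof (IZR_le 0 (Z.of_nat (Z.to_nat (Int_part y))) ltac:(lia)). lra.
    - rewrite Z2Nat.id by exact H. lra. }
  assert (Hz : forall M k, y < INR (S M) -> (M < k)%nat -> (if Rle_dec (INR k) y then f k else RtoC 0) = 0).
  { intros M k HM Hk. destruct (Rle_dec (INR k) y) as [H|]; [|reflexivity].
    pose proof (le_INR (S M) k Hk). lra. }
  destruct (Nat.le_ge_cases m N) as [H|H].
  - symmetry. apply sumC_tail; [exact H|]. intros k. apply (Hz m k Hm).
  - apply sumC_tail; [exact H|]. intros k. apply (Hz N k Hy).
Qed.

Lemma sum_upto_ext (y : R) (f g : nat -> C) :
  (forall n, INR n <= y -> f n = g n) -> sum_upto y f = sum_upto y g.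
Proof.
  intros H. apply sumC_ext. intros n. destruct (Rle_dec (INR n) y); [apply H; assumption|reflexivity].
Qed.

Lemma sum_upto_neg (y : R) (f : nat -> C) : y < 0 -> sum_upto y f = 0.
Proof.
  intros Hy. rewrite (sum_upto_eq y f 0) by (simpl; lra). rewrite sumC_0.
  destruct (Rle_dec (INR 0) y) as [H|]; [simpl in H; lra|reflexivity].
Qed.

Lemma sum_upto_floor (y : R) (N : nat) (f : nat -> C) : INR N <= y < INR (S N) -> sum_upto y f = sum_n f N.
Proof.
  intros [H1 H2]. rewrite (sum_upto_eq _ f N H2).
  assert (H : forall m, (m <= N)%nat -> sum_n (fun n => if Rle_dec (INR n) y then f n else RtoC 0) m = sum_n f m).
  { induction m as [|m IH]; intros Hm; rewrite ?sumC_0, ?sumC_S, ?IH by lia;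
    (destruct (Rle_dec _ y) as [|n]; [reflexivity|]; elim n; eapply Rle_trans; [apply le_INR, Hm|exact H1]). }
  apply H; lia.
Qed.

Lemma sum_upto_INR (N : nat) (f : nat -> C) : sum_upto (INR N) f = sum_n f N.
Proof. apply sum_upto_floor. rewrite S_INR. lra. Qed.

Lemma sum_upto_plus (y : R) (f g : nat -> C) :
  sum_upto y (fun n => f n + g n) = sum_upto y f + sum_upto y g.
Proof.
  unfold sum_upto. induction (Z.to_nat (Int_part y)) as [|m IH]; rewrite ?sumC_0, ?sumC_S, ?IH;
  destruct (Rle_dec _ y); cring.
Qed.

Lemma sum_upto_mult (y : R) (c : C) (f : nat -> C) :
  sum_upto y (fun n => c * f n) = c * sum_upto y f.
Proof.
  unfold sum_upto. induction (Z.to_nat (Int_part y)) as [|m IH]; rewrite ?sumC_0, ?sumC_S, ?IH;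
  destruct (Rle_dec _ y); cring.
Qed.

Lemma intC_sum (f : nat -> R -> C) (a b : R) (l : nat -> C) (n : nat) : a <= b ->
  (forall j, intC (f j) a b (l j)) -> intC (fun u => sum_n (fun j => f j u) n) a b (sum_n l n).
Proof.
  intros Hab H. induction n as [|n IH].
  - rewrite sumC_0. eapply intC_ext; [exact Hab| |apply H]. intros u _; simpl. rewrite sumC_0; reflexivity.
  - rewrite sumC_S. eapply intC_ext; [exact Hab| |apply intC_plus; [exact IH|apply H]].
    intros u _; simpl. rewrite sumC_S; reflexivity.
Qed.

(** [Phi] is a primitive across the jump at p + al: it is zero before the jump and starts from zero
    there, the value of g at the jump being subtracted. The cases are the positions of the jump
    relative to x and b. *)
Lemma intC_step (p : nat) (al : R) (a : C) (g dg : R -> C) (x b : R) :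
  0 < al -> 0 < x -> x <= b ->
  (forall u, 0 < u -> derC g u (dg u)) -> (forall u, 0 < u -> contC dg u) ->
  let Phi := fun u => if Rle_dec (INR p) (u - al) then a * (g u - g (INR p + al)%R) else RtoC 0 in
  intC (fun u => (if Rle_dec (INR p) (u - al) then a else RtoC 0) * dg u) x b (Phi b - Phi x).
Proof.
  intros Hal Hx Hxb Hg Hdg Phi.
  assert (Hp : 0 <= INR p) by apply pos_INR.
  assert (Hint : forall y z, 0 < y -> y <= z -> intC (fun u => a * dg u) y z (a * (g z - g y))).
  { intros y z Hy Hz. apply intC_mult_l, intC_derive; intros u Hu; rewrite Rmin_left, Rmax_right in Hu by lra;
    [apply Hg|apply Hdg]; lra. }
  assert (Hzero : forall y z, y <= z -> z <= INR p + al -> intC (fun u => (if Rle_dec (INR p) (u - al) then a else RtoC 0) * dg u) y z (RtoC 0)).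
  { intros y z Hyz Hz. apply (intC_ext (fun _ => RtoC 0)); [exact Hyz| |].
    - intros u Hu. destruct (Rle_dec (INR p) (u - al)); [lra|ring].
    - pose proof (is_RInt_const (V := C_R_NormedModule) y z (RtoC 0)) as H.
      rewrite scal_C_R, Cmult_0_r in H. exact H. }
  assert (Hpos : forall y z, 0 < y -> y <= z -> INR p + al <= y -> intC (fun u => (if Rle_dec (INR p) (u - al) then a else RtoC 0) * dg u) y z (a * (g z - g y))).
  { intros y z Hy Hyz Hy'. apply (intC_ext (fun u => a * dg u)); [exact Hyz| |apply Hint; assumption].
    intros u Hu. destruct (Rle_dec (INR p) (u - al)); [reflexivity|lra]. }
  unfold Phi. destruct (Rle_dec (INR p) (b - al)) as [H1|H1], (Rle_dec (INR p) (x - al)) as [H2|H2]; try lra.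
  - replace (a * (g b - g (INR p + al)%R) - a * (g x - g (INR p + al)%R)) with (a * (g b - g x)) by ring.
    apply Hpos; lra.
  - replace (a * (g b - g (INR p + al)%R) - 0) with (0 + a * (g b - g (INR p + al)%R)) by ring.
    refine (is_RInt_Chasles (V := C_R_NormedModule) _ x (INR p + al)%R b (RtoC 0) _ (Hzero _ _ _ _) (Hpos _ _ _ _ _)); lra.
  - replace (0 - 0) with (RtoC 0) by ring. apply Hzero; lra.
Qed.

(** On [x, b] the step function is a finite sum of single jumps, and [intC_step] is applied to each.
    Taking a_n = 1 gives the counting function of the lattice, a_n = expi (lambda n) the exponential
    sums of Lerch's function. *)
Lemma abel_summation (al : R) (a : nat -> C) (g dg : R -> C) (x b : R) :
  0 < al -> 0 < x -> x <= b ->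
  (forall u, 0 < u -> derC g u (dg u)) -> (forall u, 0 < u -> contC dg u) ->
  intC (fun u => sum_upto (u - al) a * dg u) x b
    (sum_upto (b - al) a * g b - sum_upto (b - al) (fun n => a n * g (INR n + al)%R)
     - (sum_upto (x - al) a * g x - sum_upto (x - al) (fun n => a n * g (INR n + al)%R))).
Proof.
  intros Hal Hx Hxb Hg Hdg.
  destruct (nfloor_ex (b) ltac:(lra)) as [N [_ HN]]. rewrite <- S_INR in HN.
  assert (Hu : forall u f, u <= b -> sum_upto (u - al) f = sum_n (fun n => if Rle_dec (INR n) (u - al) then f n else RtoC 0) N).
  { intros u f Hu. apply sum_upto_eq. lra. }
  assert (HS : forall u, u <= b -> sum_upto (u - al) a * g u - sum_upto (u - al) (fun n => a n * g (INR n + al)%R)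
    = sum_n (fun n => if Rle_dec (INR n) (u - al) then a n * (g u - g (INR n + al)%R) else RtoC 0) N).
  { intros u Hub. rewrite <- Hu by exact Hub.
    replace (sum_upto (u - al) a * g u - _) with (g u * sum_upto (u - al) a + -1 * sum_upto (u - al) (fun n => a n * g (INR n + al)%R)) by ring.
    rewrite <- !sum_upto_mult, <- sum_upto_plus. apply sum_upto_ext. intros; ring. }
  rewrite !HS by lra.
  pose proof (intC_sum _ x b _ N Hxb (fun n => intC_step n al (a n) g dg x b Hal Hx Hxb Hg Hdg)) as H.
  cbv zeta beta in H.
  replace (sum_n (fun n => if Rle_dec (INR n) (b - al) then a n * (g b - g (INR n + al)%R) else RtoC 0) N
    - sum_n (fun n => if Rle_dec (INR n) (x - al) then a n * (g x - g (INR n + al)%R) else RtoC 0) N)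
    with (sum_n (fun n => (if Rle_dec (INR n) (b - al) then a n * (g b - g (INR n + al)%R) else RtoC 0)
     - (if Rle_dec (INR n) (x - al) then a n * (g x - g (INR n + al)%R) else RtoC 0)) N).
  - eapply intC_ext; [exact Hxb| |exact H]. intros u Huu. cbv beta. rewrite Hu by lra.
    clear. induction N as [|N IH]; [rewrite !sumC_0; reflexivity|].
    rewrite !sumC_S, IH. symmetry; apply Cmult_plus_distr_r.
  - clear. induction N as [|N IH]; rewrite ?sumC_0, ?sumC_S, ?IH;
    destruct (Rle_dec _ (b - al)), (Rle_dec _ (x - al)); cring.
Qed.

(** * The sawtooth function and Euler's summation formula *)

Lemma psi_le (u : R) : Rabs (psi u) <= 1 / 2.
Proof.
  unfold psi. destruct (base_Int_part u) as [H1 H2]. apply Rabs_le. lra.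
Qed.

(** The floor of y plus one counts the integers from 0 to y. The formula persists for -1 < y < 0,
    where the floor is -1 and the sum is empty; that range is used, since u - al > -1 whenever u > 0
    and al <= 1. *)
Lemma count_psi (y : R) : -1 < y -> sum_upto y (fun _ => RtoC 1) = RtoC (y + 1 / 2 - psi y).
Proof.
  intros Hy. unfold psi. destruct (base_Int_part y) as [H1 H2].
  replace (y + 1 / 2 - (y - IZR (Int_part y) - 1 / 2))%R with (IZR (Int_part y) + 1)%R by lra.
  destruct (Rlt_dec y 0) as [H|H].
  - rewrite sum_upto_neg by exact H. f_equal.
    replace (Int_part y) with (-1)%Z; [lra|]. apply Int_part_spec. lra.
  - assert (H3 : (0 <= Int_part y)%Z).
    { apply Z.lt_succ_r. apply lt_IZR. rewrite succ_IZR. lra. }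
    rewrite <- (Z2Nat.id (Int_part y)), <- INR_IZR_INZ by exact H3.
    set (m := Z.to_nat (Int_part y)).
    assert (Hm : INR m <= y < INR m + 1).
    { unfold m. rewrite INR_IZR_INZ, Z2Nat.id by exact H3. lra. }
    rewrite (sum_upto_floor y m) by (rewrite S_INR; lra).
    clearbody m. clear. induction m as [|m IH].
    + rewrite sumC_0. simpl. f_equal. lra.
    + rewrite sumC_S, IH, <- RtoC_plus, S_INR. reflexivity.
Qed.

(** The counting function of the lattice is u - al + 1/2 - psi (u - al): integrating f' against the
    linear part by parts and subtracting [abel_summation] leaves psi. *)
Lemma euler_summation (al : R) (f df : R -> C) (x b : R) :
  0 < al <= 1 -> 0 < x -> x <= b ->
  (forall u, 0 < u -> derC f u (df u)) -> (forall u, 0 < u -> contC df u) ->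
  intC (fun u => f u + RtoC (psi (u - al)) * df u) x b
    (sum_upto (b - al) (fun n => f (INR n + al)%R) + RtoC (psi (b - al)) * f b
     - (sum_upto (x - al) (fun n => f (INR n + al)%R) + RtoC (psi (x - al)) * f x)).
Proof.
  intros Hal Hx Hxb Hf Hdf.
  pose proof (abel_summation al (fun _ => RtoC 1) f df x b (proj1 Hal) Hx Hxb Hf Hdf) as H1.
  assert (Hlin : forall u, derC (fun u => RtoC (u - al + 1 / 2)) u (RtoC 1)).
  { intros u. apply derC_RtoC. auto_derive; auto. }
  assert (H2 : intC (fun u => 1 * f u + RtoC (u - al + 1 / 2) * df u) x b
    (RtoC (b - al + 1 / 2) * f b - RtoC (x - al + 1 / 2) * f x)).
  { apply (intC_derive (fun u => RtoC (u - al + 1 / 2) * f u)).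
    - intros u Hu. rewrite Rmin_left, Rmax_right in Hu by lra. apply (derC_mult (fun u => RtoC (u - al + 1 / 2)) f u _ _ (Hlin u)), Hf; lra.
    - intros u Hu. rewrite Rmin_left, Rmax_right in Hu by lra.
      apply contC_plus; apply contC_mult; [apply contC_const|eapply derC_cont, Hf; lra|exact (derC_cont _ _ _ (Hlin u))|apply Hdf; lra]. }
  pose proof (intC_plus _ _ _ _ _ _ H2 (intC_mult_l _ _ _ (-1) _ H1)) as H.
  rewrite !count_psi in H by lra.
  rewrite !(sum_upto_ext _ (fun n => 1 * f (INR n + al)%R) (fun n => f (INR n + al)%R)) in H by (intros; ring).
  match goal with |- intC _ _ _ ?l => match type of H with intC _ _ _ ?m => replace l with m end end.
  - eapply intC_ext; [exact Hxb| |exact H]. intros u Hu. cbv beta. rewrite count_psi by lra.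
    rewrite (RtoC_minus (u - al + 1 / 2)). ring.
  - rewrite (RtoC_minus (b - al + 1 / 2)), (RtoC_minus (x - al + 1 / 2)). ring.
Qed.

(** * Integrability of weights with jumps *)

Definition loc_int (B : R -> C) (x : R) : Prop :=
  forall g : R -> C, (forall u, 0 < u -> contC g u) ->
     forall y, x <= y -> exists l, intC (fun u => B u * g u) x y l.

(** Lets [abel_summation], which integrates against a derivative, show that a step function times an
    arbitrary continuous g is integrable. *)
Lemma antiderivative (g : R -> C) : (forall u, 0 < u -> contC g u) ->
  exists G : R -> C, forall u, 0 < u -> derC G u (g u).
Proof.
  intros Hg. exists (fun u => RInt (V := C_R_CompleteNormedModule) g 1 u). intros u Hu.
  apply (is_derive_RInt (V := C_R_NormedModule) g (fun u => RInt (V := C_R_CompleteNormedModule) g 1 u) 1 u); [|apply Hg, Hu].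
  exists (mkposreal _ Hu). intros v Hv.
  assert (Hv' : 0 < v).
  { change (Rabs (v - u) < u) in Hv. apply Rabs_def2 in Hv. lra. }
  apply (RInt_correct (V := C_R_CompleteNormedModule)).
  apply (ex_RInt_continuous (V := C_R_CompleteNormedModule)). intros w Hw. apply Hg.
  assert (0 < Rmin 1 v) by (apply Rmin_glb_lt; lra). lra.
Qed.

Lemma loc_int_continuous (B : R -> C) (x : R) : 0 < x -> (forall u, 0 < u -> contC B u) -> loc_int B x.
Proof.
  intros Hx HB g Hg y Hy.
  apply (ex_RInt_continuous (V := C_R_CompleteNormedModule) (fun u => B u * g u)). intros u Hu.
  rewrite Rmin_left in Hu by lra. apply contC_mult; [apply HB|apply Hg]; lra.
Qed.

Lemma loc_int_mult (B e : R -> C) (x : R) : (forall u, 0 < u -> contC e u) ->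
  loc_int B x -> loc_int (fun u => B u * e u) x.
Proof.
  intros He HB g Hg y Hy. destruct (HB (fun u => e u * g u)) with (y := y) as [l Hl].
  - intros u Hu. apply contC_mult; [apply He|apply Hg]; exact Hu.
  - exact Hy.
  - exists l. eapply intC_ext; [exact Hy| |exact Hl]. intros u _; simpl; ring.
Qed.

Lemma loc_int_plus (A B : R -> C) (x : R) : loc_int A x -> loc_int B x -> loc_int (fun u => A u + B u) x.
Proof.
  intros HA HB g Hg y Hy. destruct (HA g Hg y Hy) as [l Hl], (HB g Hg y Hy) as [m Hm].
  exists (l + m). eapply intC_ext; [exact Hy| |apply intC_plus; [exact Hl|exact Hm]]. intros u _; simpl; ring.
Qed.

Lemma loc_int_step (al x : R) (a : nat -> C) : 0 < al -> 0 < x -> loc_int (fun u => sum_upto (u - al) a) x.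
Proof.
  intros Hal Hx g Hg y Hy. destruct (antiderivative g Hg) as [G HG].
  eexists. apply (abel_summation al a G g x y); assumption.
Qed.

Lemma loc_int_ext (A B : R -> C) (x : R) : (forall u, x < u -> A u = B u) -> loc_int A x -> loc_int B x.
Proof.
  intros E HA g Hg y Hy. destruct (HA g Hg y Hy) as [l Hl]. exists l.
  eapply intC_ext; [exact Hy| |exact Hl]. intros u Hu; simpl. rewrite E by lra. reflexivity.
Qed.

Lemma loc_int_psi (al x : R) : 0 < al <= 1 -> 0 < x -> loc_int (fun u => RtoC (psi (u - al))) x.
Proof.
  intros Hal Hx.
  apply (loc_int_ext (fun u => RtoC (u - al + 1 / 2) + sum_upto (u - al) (fun _ => RtoC 1) * -1)).
  - intros u Hu. rewrite count_psi by lra. rewrite (RtoC_minus (u - al + 1 / 2)). ring.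
  - apply loc_int_plus.
    + apply loc_int_continuous; [exact Hx|]. intros u _. eapply derC_cont, derC_RtoC. auto_derive; [auto|reflexivity].
    + apply loc_int_mult; [intros; apply contC_const|]. apply loc_int_step; lra.
Qed.

Lemma admissible_psi (al x : R) : 0 < al <= 1 -> 0 < x -> admissible (fun u => RtoC (psi (u - al))) x.
Proof.
  intros Hal Hx. split; [|apply loc_int_psi; assumption].
  exists (1 / 2)%R. intros u _. rewrite Cmod_R. apply psi_le.
Qed.

Lemma infC_mul_id (B : R -> C) (c x : R) (k : nat) (z : C) :
  0 < c -> 0 < x -> admissible B x -> 0 < Re z ->
  is_RInt_infty (fun u => B u * (mul_id (fun k z => lpow c k z u) k z / RtoC u)) x (mul_id (GI B c x) k z).
Proof.
  intros Hc Hx HB Hz. unfold mul_id.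
  eapply infC_ext; [|apply infC_plus; apply infC_mult_l; apply GI_correct; assumption].
  intros u _. simpl. unfold Cdiv. ring.
Qed.

(** * The Hurwitz zeta function *)

Lemma taylor_sum_upto (U : C -> Prop) (y : R) (F : nat -> nat -> C -> C) :
  (forall n, taylor U (F n)) -> taylor U (fun k z => sum_upto y (fun n => F n k z)).
Proof.
  intros H. unfold sum_upto.
  apply (taylor_sum_n U (fun n k z => if Rle_dec (INR n) y then F n k z else RtoC 0)).
  intros n. destruct (Rle_dec (INR n) y); [apply H|].
  apply (taylor_ext U (fun k _ => match k with O => RtoC 0 | S _ => RtoC 0 end)); [intros [|k] z; reflexivity|].
  apply taylor_const.
Qed.

Lemma RtoC_neq_0 (x : R) : x <> 0%R -> RtoC x <> 0.
Proof. intros H E. apply RtoC_inj in E. exact (H E). Qed.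

(** The k-th derivative of the right-hand side of the zeta formula, pole term excluded; with c = q,
    al = a/q and x = X/q it is the corresponding expression for the residue class of a. *)
Definition euler_part (c al x : R) (k : nat) (z : C) : C :=
  sum_upto (x - al) (fun n => lpow c k z (INR n + al)%R)
  + RtoC (psi (x - al)) * lpow c k z x
  - mul_id (GI (fun u => RtoC (psi (u - al))) c x) k z.

Lemma taylor_euler_part (c al x : R) : 0 < c -> 0 < al <= 1 -> 0 < x ->
  taylor (fun z => 0 < Re z) (euler_part c al x).
Proof.
  intros Hc Hal Hx.
  apply (taylor_ext _ (fun k z => (sum_upto (x - al) (fun n => lpow c k z (INR n + al)%R)
    + RtoC (psi (x - al)) * lpow c k z x) + - (1) * mul_id (GI (fun u => RtoC (psi (u - al))) c x) k z)).
  { intros k z. unfold euler_part. ring. }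
  apply taylor_plus; [apply taylor_plus|].
  - apply (taylor_sum_upto _ _ (fun n k z => lpow c k z (INR n + al)%R)). intros n. apply taylor_lpow.
  - apply taylor_scal, taylor_lpow.
  - apply taylor_scal, taylor_mul_id, taylor_GI; [exact Hc|exact Hx|]. apply admissible_psi; assumption.
Qed.

Lemma lpow_vanish (c : R) (k : nat) (z : C) : 0 < c -> 0 < Re z ->
  forall eps, 0 < eps -> exists N, forall b, N < b -> Cmod (lpow c k z b) < eps.
Proof.
  intros Hc Hz eps Heps.
  destruct (lpow_exp_bound c 1 (Re z) k Hc Rlt_0_1 Hz) as (K & HK & HK').
  destruct (rpow_lim c (Re z / 2) Hc ltac:(lra) (eps / (K + 1))%R) as [N HN]; [apply Rdiv_lt_0_compat; lra|].
  exists (Rmax N 1). intros b Hb. pose proof (Rmax_l N 1). pose proof (Rmax_r N 1).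
  specialize (HN b ltac:(lra)). specialize (HK' b ltac:(lra)).
  rewrite lpow_mod. set (L := ln (c * b)) in *.
  assert (1 <= exp (3 * (Re z / 8) * Rabs L)).
  { rewrite <- exp_0 at 1. apply exp_le_compat. apply Rmult_le_pos; [lra|apply Rabs_pos]. }
  assert (0 <= exp (- Re z * L) * Rabs L ^ k) by (apply Rmult_le_pos; [left; apply exp_pos|apply pow_le, Rabs_pos]).
  apply Rmult_lt_compat_r with (r := (K + 1)%R) in HN; [|lra].
  replace (eps / (K + 1) * (K + 1))%R with eps in HN by (field; lra).
  pose proof (exp_pos (- (Re z / 2) * L)). nra.
Qed.

(** Euler summation on [x, b], where the boundary term at b and the tail of the integral tend to 0.
    The primitive [P] is left abstract: for zeta it carries the pole, while for L all that matters
    is that it is the same for every residue. *)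
Lemma euler_part_limit (c al x : R) (z : C) (P : R -> C) :
  0 < c -> 0 < al <= 1 -> 0 < x -> 0 < Re z ->
  (forall b, x <= b -> intC (lpow c 0 z) x b (P b)) ->
  forall eps, 0 < eps -> exists N, forall b, N < b ->
    Cmod (sum_upto (b - al) (fun n => lpow c 0 z (INR n + al)%R) - P b - euler_part c al x 0 z) < eps.
Proof.
  intros Hc Hal Hx Hz HP eps Heps.
  set (B := fun u => RtoC (psi (u - al))).
  pose proof (admissible_psi al x Hal Hx) as HB. fold B in HB.
  pose proof (GI_correct B c x 0 z Hc Hx HB Hz) as HG.
  set (I := fun y => RInt (V := C_R_CompleteNormedModule) (fun u => B u * (lpow c 0 z u / RtoC u)) x y : C).
  assert (HI : forall y, x <= y -> intC (fun u => B u * (lpow c 0 z u / RtoC u)) x y (I y)).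
  { intros y Hy. apply (RInt_correct (V := C_R_CompleteNormedModule)). apply (proj2 HB); [|exact Hy].
    intros u Hu. apply contC_div_id; [exact Hu|]. apply contC_lpow; assumption. }
  pose proof (Cmod_ge_0 z) as Hz0.
  destruct (infC_lim _ I x _ HI HG (eps / 2 / (Cmod z + 1))%R) as [N1 HN1].
  { apply Rdiv_lt_0_compat; lra. }
  destruct (lpow_vanish c 0 z Hc Hz (eps / 2)%R ltac:(lra)) as [N2 HN2].
  exists (Rmax (Rmax N1 N2) x). intros b Hb.
  assert (Hb' : N1 < b /\ N2 < b /\ x < b).
  { pose proof (Rmax_l (Rmax N1 N2) x). pose proof (Rmax_r (Rmax N1 N2) x).
    pose proof (Rmax_l N1 N2). pose proof (Rmax_r N1 N2). lra. }
  destruct Hb' as (Hb1 & Hb2 & Hb3). specialize (HN1 b Hb1). specialize (HN2 b Hb2).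
  (* The same integral evaluated by Euler summation and by linearity. *)
  assert (E : sum_upto (b - al) (fun n => lpow c 0 z (INR n + al)%R) + RtoC (psi (b - al)) * lpow c 0 z b
     - (sum_upto (x - al) (fun n => lpow c 0 z (INR n + al)%R) + RtoC (psi (x - al)) * lpow c 0 z x)
     = P b + - z * I b).
  { eapply intC_unique.
    - apply (euler_summation al (lpow c 0 z) (fun u => - ((z * lpow c 0 z u + RtoC (INR 0) * lpow c (pred 0) z u) / RtoC u)) x b Hal Hx); [lra| |].
      + intros u Hu. apply derC_lpow; assumption.
      + intros u Hu. apply (continuous_opp (V := C_R_NormedModule)). apply contC_div_id; [exact Hu|].
        apply contC_plus; apply contC_mult; try apply contC_const; apply contC_lpow; assumption.
    - eapply intC_ext; [| |apply intC_plus; [apply HP|exact (intC_mult_l (fun u => B u * (lpow c 0 z u / RtoC u)) _ _ (- z) _ (HI b ltac:(lra)))]]; try lra.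
      intros u Hu. cbv beta. unfold B. simpl (INR 0). field. apply RtoC_neq_0. lra. }
  replace (sum_upto (b - al) (fun n => lpow c 0 z (INR n + al)%R) - P b - euler_part c al x 0 z)
    with (- RtoC (psi (b - al)) * lpow c 0 z b + - z * (I b - GI B c x 0 z)).
  - eapply Rle_lt_trans; [apply Cmod_triangle|]. rewrite !Cmod_mult, !Cmod_opp, Cmod_R.
    pose proof (psi_le (b - al)). pose proof (Cmod_ge_0 (lpow c 0 z b)).
    pose proof (Cmod_ge_0 (I b - GI B c x 0 z)). pose proof (Rabs_pos (psi (b - al))).
    assert (Cmod z * Cmod (I b - GI B c x 0 z) < eps / 2).
    { apply Rle_lt_trans with ((Cmod z) * (eps / 2 / (Cmod z + 1)))%R.
      - apply Rmult_le_compat_l; lra.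
      - apply Rmult_lt_reg_r with (Cmod z + 1)%R; [lra|]. field_simplify; lra. }
    nra.
  - unfold euler_part, mul_id. fold B. simpl (INR 0).
    replace (P b) with (P b + - z * I b + z * I b) by ring. rewrite <- E. ring.
Qed.

Definition pole_prim (c : R) (z : C) (u : R) : C := RtoC u * lpow c 0 z u / (1 - z).

Lemma Cminus_neq_0 (z w : C) : z <> w -> z - w <> 0.
Proof. intros H E. apply H. rewrite <- (Cplus_0_l w), <- E. ring. Qed.

Lemma int_pole_prim (c x b : R) (z : C) : 0 < c -> 0 < x -> x <= b -> z <> 1 ->
  intC (lpow c 0 z) x b (pole_prim c z b - pole_prim c z x).
Proof.
  intros Hc Hx Hb Hz. assert (Hz1 : 1 - z <> 0) by (apply Cminus_neq_0; congruence).
  apply intC_derive; intros u Hu; rewrite Rmin_left, Rmax_right in Hu by lra.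
  - unfold pole_prim. eapply derC_eq.
    + apply (derC_mult (fun u => RtoC u * lpow c 0 z u) (fun _ => / (1 - z))); [|apply derC_const].
      apply (derC_mult (fun u => RtoC u) (lpow c 0 z)); [apply derC_RtoC, is_derive_id|apply derC_lpow; lra].
    + Ceq. change (@one R_AbsRing) with 1%R. simpl (INR 0). cbv beta. field. split; [exact Hz1|apply RtoC_neq_0; lra].
  - apply contC_lpow; lra.
Qed.

Lemma lim_C_unique (f : R -> C) (l m : C) :
  (forall eps, 0 < eps -> exists N, forall b, N < b -> Cmod (f b - l) < eps) ->
  (forall eps, 0 < eps -> exists N, forall b, N < b -> Cmod (f b - m) < eps) -> l = m.
Proof.
  intros H1 H2.
  assert (E : Cmod (l - m) = 0).
  { apply Rle_antisym; [|apply Cmod_ge_0]. apply le_epsilon. intros eps Heps.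
    destruct (H1 (eps / 2)%R ltac:(lra)) as [N HN], (H2 (eps / 2)%R ltac:(lra)) as [N' HN'].
    pose proof (Rmax_l N N'). pose proof (Rmax_r N N').
    specialize (HN (Rmax N N' + 1)%R ltac:(lra)). specialize (HN' (Rmax N N' + 1)%R ltac:(lra)).
    replace (l - m) with (- (f (Rmax N N' + 1)%R - l) + (f (Rmax N N' + 1)%R - m)) by ring.
    eapply Rle_trans; [apply Cmod_triangle|]. rewrite Cmod_opp. lra. }
  apply Cmod_eq_0 in E. rewrite <- (Cplus_0_r m), <- E. ring.
Qed.

Lemma pole_part_0 (x : R) (z : C) : z <> 1 -> pole_part x 0 z = - pole_prim 1 z x.
Proof.
  intros Hz. unfold pole_part, pole_prim. field. split; apply Cminus_neq_0; congruence.
Qed.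

(** Valid for Re z > 0, where the partial sums themselves need not converge. The quantity passing to
    the limit does not involve x, so the right-hand side has the same value for every x; for Re z >
    1 the subtracted power tends to 0 and the sum of the series remains. *)
Lemma hurwitz_lim (al x : R) (z : C) : 0 < al <= 1 -> 0 < x -> 0 < Re z -> z <> 1 ->
  forall eps, 0 < eps -> exists N, forall b, N < b ->
    Cmod (sum_upto (b - al) (fun n => lpow 1 0 z (INR n + al)%R) - pole_prim 1 z b
      - (euler_part 1 al x 0 z + pole_part x 0 z)) < eps.
Proof.
  intros Hal Hx Hz Hz1 eps Heps.
  destruct (euler_part_limit 1 al x z (fun b => pole_prim 1 z b - pole_prim 1 z x) ltac:(lra) Hal Hx Hz
    (fun b Hb => int_pole_prim 1 x b z ltac:(lra) Hx Hb Hz1) eps Heps) as [N HN].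
  exists N. intros b Hb. rewrite pole_part_0 by exact Hz1.
  replace (sum_upto (b - al) (fun n => lpow 1 0 z (INR n + al)%R) - pole_prim 1 z b - (euler_part 1 al x 0 z + - pole_prim 1 z x))
    with (sum_upto (b - al) (fun n => lpow 1 0 z (INR n + al)%R) - (pole_prim 1 z b - pole_prim 1 z x) - euler_part 1 al x 0 z) by ring.
  apply HN, Hb.
Qed.

Lemma pole_prim_vanish (z : C) : 1 < Re z ->
  forall eps, 0 < eps -> exists N, forall b, N < b -> Cmod (pole_prim 1 z b) < eps.
Proof.
  intros Hz eps Heps.
  assert (Hz1 : 1 - z <> 0).
  { apply Cminus_neq_0. intros <-. simpl in Hz. lra. }
  pose proof (proj1 (Cmod_gt_0 _) Hz1) as Hm.
  destruct (rpow_lim 1 (Re z - 1) ltac:(lra) ltac:(lra) (eps * Cmod (1 - z))%R) as [N HN].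
  { apply Rmult_lt_0_compat; assumption. }
  exists (Rmax N 0). intros b Hb.
  assert (Hb' : N < b /\ 0 < b).
  { pose proof (Rmax_l N 0). pose proof (Rmax_r N 0). lra. }
  specialize (HN b (proj1 Hb')). unfold pole_prim.
  rewrite Cmod_div by exact Hz1. rewrite Cmod_mult, lpow_mod, Cmod_R, Rabs_pos_eq by lra.
  apply Rmult_lt_reg_r with (Cmod (1 - z)); [exact Hm|].
  unfold Rdiv. rewrite Rmult_assoc, Rinv_l, Rmult_1_r by lra.
  eapply Rle_lt_trans; [|exact HN]. right. rewrite Rmult_1_l. simpl. rewrite Rmult_1_r.
  rewrite <- (exp_ln b) at 1 by lra. rewrite <- exp_plus. f_equal. ring.
Qed.

Lemma lpow_1_u (z : C) (u : R) : lpow 1 0 z u = Rcpow u (- z).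
Proof. rewrite lpow_0, Rmult_1_l. reflexivity. Qed.

Lemma pole_part_base (z : C) : pole_part 1 0 z = / (z - 1).
Proof.
  unfold pole_part. rewrite lpow_1_u. unfold Rcpow. rewrite ln_1, Cmult_0_r, Cexp_0. unfold Cdiv. ring.
Qed.

Lemma serC_of_lim (a : nat -> C) (al : R) (l : C) :
  (forall eps, 0 < eps -> exists N, forall b, N < b -> Cmod (sum_upto (b - al) a - l) < eps) ->
  serC a l.
Proof.
  intros H. apply serC_spec. intros eps Heps. destruct (H eps Heps) as [N HN].
  destruct (nfloor_ex (Rmax 0 (N - al)) (Rmax_l _ _)) as [m [_ Hm]].
  exists (S m). intros n Hn. rewrite <- sum_upto_INR.
  specialize (HN (INR n + al)%R). replace (INR n + al - al)%R with (INR n) in HN by ring.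
  apply HN. apply le_INR in Hn. rewrite S_INR in Hn. pose proof (Rmax_r 0 (N - al)). lra.
Qed.

(** A horizontal ray from a real s < 1 would run through 1; a slanted one, directed away from the
    real axis, cannot come back to it. *)
Lemma punctured_ray (s : C) : s <> 1 -> exists d, 0 < Re d /\ forall t, 0 <= t -> s + RtoC t * d <> 1.
Proof.
  intros Hs. destruct (Rle_dec 0 (Im s)) as [H|H].
  - exists (1, 1)%R. split; [simpl; lra|]. intros t Ht E.
    assert (E2 : Im (s + RtoC t * (1, 1)%R) = 0) by (rewrite E; reflexivity). unfold Im in *. simpl in E2.
    assert (t = 0%R) as -> by lra. apply Hs. rewrite <- E. ring.
  - exists (1, -1)%R. split; [simpl; lra|]. intros t Ht E.
    assert (E2 : Im (s + RtoC t * (1, -1)%R) = 0) by (rewrite E; reflexivity). unfold Im in *. simpl in E2. lra.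
Qed.

(** The continuation is identified at x = 1, where the pole term is 1/(z - 1) with its explicit
    power series; other x are reached because both expressions are the limit of the same
    quantity. *)
Theorem hurwitz_zeta_eq (al x : R) (s : C) : 0 < al <= 1 -> 0 < x -> 0 < Re s -> s <> 1 ->
  hurwitz_zeta al s = euler_part 1 al x 0 s + pole_part x 0 s.
Proof.
  intros Hal Hx Hs Hs1.
  assert (Hbase : forall z, 0 < Re z -> z <> 1 ->
    euler_part 1 al 1 0 z + pole_part 1 0 z = euler_part 1 al x 0 z + pole_part x 0 z).
  { intros z Hz Hz1. apply (lim_C_unique (fun b => sum_upto (b - al) (fun n => lpow 1 0 z (INR n + al)%R) - pole_prim 1 z b)).
    - apply (hurwitz_lim al 1 z Hal Rlt_0_1 Hz Hz1).
    - apply (hurwitz_lim al x z Hal Hx Hz Hz1). }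
  rewrite <- Hbase by assumption.
  destruct (punctured_ray s Hs1) as (d & Hd & HD). unfold hurwitz_zeta.
  apply (continuation_eq _ _ (fun z => euler_part 1 al 1 0 z + pole_part 1 0 z) s d Hs Hd HD).
  - intros z Hz1 Hz. eapply expands_analytic, expands_plus.
    + apply (taylor_euler_part 1 al 1 ltac:(lra) Hal ltac:(lra) z Hz 0%nat).
    + apply (expands_ext_loc (fun w => / (w - 1))) with (d := 1%R); [lra|intros w _; symmetry; apply pole_part_base|].
      apply expands_inv_shift, Hz1.
  - intros z Hz. assert (Hz1 : z <> 1) by (intros ->; simpl in Hz; lra).
    apply (serC_ext (fun n => lpow 1 0 z (INR n + al)%R)); [intros n; apply lpow_1_u|].
    apply serC_of_lim with (al := al). intros eps Heps.
    destruct (hurwitz_lim al 1 z Hal ltac:(lra) ltac:(lra) Hz1 (eps / 2)%R ltac:(lra)) as [N HN].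
    destruct (pole_prim_vanish z Hz (eps / 2)%R ltac:(lra)) as [N' HN'].
    exists (Rmax N N'). intros b Hb. pose proof (Rmax_l N N'). pose proof (Rmax_r N N').
    specialize (HN b ltac:(lra)). specialize (HN' b ltac:(lra)).
    replace (sum_upto (b - al) (fun n => lpow 1 0 z (INR n + al)%R) - (euler_part 1 al 1 0 z + pole_part 1 0 z))
      with (sum_upto (b - al) (fun n => lpow 1 0 z (INR n + al)%R) - pole_prim 1 z b - (euler_part 1 al 1 0 z + pole_part 1 0 z) + pole_prim 1 z b) by ring.
    eapply Rle_lt_trans; [apply Cmod_triangle|]. lra.
Qed.

Lemma C_derive_n_pole (X : R) (r : nat) (s : C) : 0 < X -> 0 < Re s -> s <> 1 ->
  C_derive_n r (fun z => Rcpow X (1 - z) / (z - 1)) s = pole_part X r s.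
Proof.
  intros HX Hs Hs1.
  apply (C_derive_n_eq _ _ _ openC_punctured (derivatives_pole_part X)); [|split; assumption].
  intros z _. simpl. rewrite lpow_1_u. f_equal.
  unfold Rcpow. replace ((1 - z) * RtoC (ln X)) with (RtoC (ln X) + - z * RtoC (ln X)) by ring.
  rewrite Cexp_plus. f_equal. unfold Cexp; simpl. rewrite exp_ln, cos_0, sin_0 by exact HX.
  apply C_eq; simpl; ring.
Qed.

(* With c = 1 this is the Hurwitz zeta function, and with c = q the function Z. *)
Lemma C_derive_n_euler (c al x X : R) (k0 : C) (f : C -> C) (r : nat) (s : C) :
  0 < c -> 0 < al <= 1 -> 0 < x -> 0 < Re s -> s <> 1 ->
  (forall z, 0 < Re z -> z <> 1 -> f z = euler_part c al x 0 z + k0 * pole_part X 0 z) ->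
  C_derive_n r f s = euler_part c al x r s + k0 * pole_part X r s.
Proof.
  intros Hc Hal Hx Hs Hs1 Hf.
  apply (C_derive_n_eq (fun z => 0 < Re z /\ z <> 1) (fun k z => euler_part c al x k z + k0 * pole_part X k z) f openC_punctured).
  - intros z Hz k. apply holC_plus.
    + apply (taylor_derivatives _ _ (taylor_euler_part c al x Hc Hal Hx)), Hz.
    + eapply holC_eq; [apply holC_mult; [apply holC_const|apply (derivatives_pole_part X z Hz k)]|].
      cbv beta. rewrite Cmult_0_l, Cplus_0_l. reflexivity.
  - intros z [Hz Hz1]. apply Hf; assumption.
  - split; assumption.
Qed.

Lemma Rcpow_mult (a b : R) (z : C) : 0 < a -> 0 < b -> Rcpow (a * b) z = Rcpow a z * Rcpow b z.
Proof.
  intros Ha Hb. unfold Rcpow. rewrite ln_mult, RtoC_plus, <- Cexp_plus by assumption. f_equal. ring.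
Qed.

Lemma lpow_0_scale (c u : R) (z : C) : 0 < c -> 0 < u -> Rcpow c (- z) * lpow 1 0 z u = lpow c 0 z u.
Proof. intros Hc Hu. rewrite lpow_1_u, lpow_0, Rcpow_mult by assumption. reflexivity. Qed.

Lemma GI_scale (q : R) (B : R -> C) (x : R) (s : C) : 0 < q -> 0 < x -> admissible B x -> 0 < Re s ->
  GI B q x 0 s = Rcpow q (- s) * GI B 1 x 0 s.
Proof.
  intros Hq Hx HB Hs. apply GI_of.
  eapply infC_ext; [|apply infC_mult_l, GI_correct; try eassumption; lra].
  intros u Hu. cbv beta. rewrite <- (lpow_0_scale q u s) by lra. unfold Cdiv; ring.
Qed.

(** The factor q^(-s) turns u^(-s) into (q u)^(-s) in every term, and with x = X/q the numerator
    q^(-s) x^(1-s) of the pole term becomes X^(1-s) / q. *)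
Lemma Z_fun_eq (a q : nat) (X : R) (s : C) : (1 <= a <= q)%nat -> 0 < X -> 0 < Re s -> s <> 1 ->
  Z_fun a q s = euler_part (INR q) (INR a / INR q) (X / INR q) 0 s + / RtoC (INR q) * pole_part X 0 s.
Proof.
  intros Haq HX Hs Hs1.
  assert (Hq : 0 < INR q) by (apply lt_0_INR; lia).
  assert (Ha : 0 < INR a <= INR q) by (split; [apply lt_0_INR; lia|apply le_INR; lia]).
  assert (Hal : 0 < INR a / INR q <= 1).
  { split; [apply Rdiv_lt_0_compat; lra|]. apply Rmult_le_reg_r with (INR q); [exact Hq|]. unfold Rdiv. rewrite Rmult_assoc, Rinv_l; lra. }
  assert (Hx : 0 < X / INR q) by (apply Rdiv_lt_0_compat; lra).
  set (al := (INR a / INR q)%R) in *. set (x := (X / INR q)%R) in *.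
  unfold Z_fun. fold al. rewrite (hurwitz_zeta_eq al x s Hal Hx Hs Hs1), Cmult_plus_distr_l. f_equal.
  - unfold euler_part, mul_id.
    assert (HB : admissible (fun u => RtoC (psi (u - al))) x) by (apply admissible_psi; assumption).
    rewrite (GI_scale (INR q)) by assumption.
    rewrite <- (lpow_0_scale (INR q) x s) by assumption.
    rewrite (sum_upto_ext _ (fun n => lpow (INR q) 0 s (INR n + al)%R) (fun n => Rcpow (INR q) (- s) * lpow 1 0 s (INR n + al)%R)).
    + rewrite sum_upto_mult. simpl (INR 0). ring.
    + intros n _. symmetry. apply lpow_0_scale; [exact Hq|]. pose proof (pos_INR n). lra.
  - simpl. rewrite <- (lpow_0_scale 1 X s), !lpow_1_u by lra.
    replace (Rcpow 1 (- s)) with (RtoC 1).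
    2:{ unfold Rcpow. rewrite ln_1, Cmult_0_r, Cexp_0. reflexivity. }
    replace (Rcpow X (- s)) with (Rcpow (INR q) (- s) * Rcpow x (- s)).
    2:{ rewrite <- Rcpow_mult by assumption. f_equal. unfold x; field; lra. }
    replace (RtoC X) with (RtoC (INR q) * RtoC x) by (rewrite <- RtoC_mult; f_equal; unfold x; field; lra).
    field. split; [apply Cminus_neq_0, Hs1|apply RtoC_neq_0; lra].
Qed.

(** * Dirichlet L-functions *)

Lemma sum_n_delta (F : nat -> C) (p N : nat) :
  sum_n (fun n => if Nat.eqb n p then F n else RtoC 0) N = if Nat.leb p N then F p else RtoC 0.
Proof.
  induction N as [|N IH].
  - rewrite sumC_0. destruct p; reflexivity.
  - rewrite sumC_S, IH. destruct (Nat.eqb_spec (S N) p) as [<-|Hne].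
    + rewrite (proj2 (Nat.leb_gt (S N) N)), Nat.leb_refl by lia. cring.
    + destruct (Nat.leb_spec p N) as [H|H].
      * rewrite (proj2 (Nat.leb_le p (S N))) by lia. cring.
      * rewrite (proj2 (Nat.leb_gt p (S N))) by lia. cring.
Qed.

Lemma sum_n_delta_eq (F : nat -> C) (t : nat -> bool) (p N : nat) : (p <= N)%nat ->
  (forall n, t n = Nat.eqb n p) -> sum_n (fun n => if t n then F n else RtoC 0) N = F p.
Proof.
  intros Hp Ht. rewrite (sumC_ext _ (fun n => if Nat.eqb n p then F n else RtoC 0)).
  - rewrite sum_n_delta, (proj2 (Nat.leb_le p N) Hp). reflexivity.
  - intros n. rewrite Ht. reflexivity.
Qed.

Lemma sumC_switch (u : nat -> nat -> C) (m n : nat) :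
  sum_n (fun i => sum_n (u i) n) m = sum_n (fun j => sum_n (fun i => u i j) m) n.
Proof. exact (sum_n_switch (G := C_AbelianMonoid) u m n). Qed.

Lemma sumC_zero (f : nat -> C) (n : nat) : (forall k, f k = 0) -> sum_n f n = RtoC 0.
Proof.
  intros H. induction n as [|n IH]; [rewrite sumC_0; apply H|]. rewrite sumC_S, IH, H. cring.
Qed.

Definition residue_mask (a q n : nat) : bool :=
  andb (Nat.leb 1 n) (Nat.eqb (Nat.modulo n q) (Nat.modulo a q)).

Lemma residue_mask_spec (a q n : nat) : (1 <= a <= q)%nat ->
  residue_mask a q n = true <-> exists m, n = (a + m * q)%nat.
Proof.
  intros Ha. unfold residue_mask. rewrite Bool.andb_true_iff, Nat.leb_le, Nat.eqb_eq. split.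
  - intros [H1 H2].
    (* The residue of a = q is 0, so the quotient n / q is one too large; n >= 1 guarantees that it
       is at least 1. *)
    destruct (Nat.eq_dec a q) as [->|Hne].
    + rewrite Nat.Div0.mod_same in H2. exists (n / q - 1)%nat.
      pose proof (Nat.div_mod_eq n q). assert (n / q <> 0)%nat by (intros E; rewrite E in *; lia). nia.
    + rewrite (Nat.mod_small a q) in H2 by lia. exists (n / q)%nat.
      pose proof (Nat.div_mod_eq n q). nia.
  - intros [m ->]. split; [lia|]. apply Nat.Div0.mod_add.
Qed.

(** Both sides are the double sum over n, m <= N with n = a + m q, taken in the two orders; the
    hypothesis on F disposes of the m with a + m q > N. *)
Lemma sum_residue_class (F : nat -> C) (a q N : nat) : (1 <= a <= q)%nat ->
  (forall n, (N < n)%nat -> F n = 0) ->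
  sum_n (fun n => if residue_mask a q n then F n else RtoC 0) N = sum_n (fun m => F (a + m * q)%nat) N.
Proof.
  intros Ha HF.
  assert (E1 : forall n, (n <= N)%nat -> (if residue_mask a q n then F n else RtoC 0)
     = sum_n (fun m => if Nat.eqb n (a + m * q) then F n else RtoC 0) N).
  { intros n Hn. destruct (residue_mask a q n) eqn:Em.
    - apply (residue_mask_spec a q n Ha) in Em. destruct Em as [m0 ->].
      symmetry. apply (sum_n_delta_eq (fun _ => F (a + m0 * q)%nat) _ m0); [nia|].
      intros m. destruct (Nat.eqb_spec m m0) as [->|H]; [apply Nat.eqb_refl|]. apply Nat.eqb_neq. nia.
    - symmetry. apply sumC_zero. intros m. destruct (Nat.eqb_spec n (a + m * q)) as [E|]; [|reflexivity].
      rewrite (proj2 (residue_mask_spec a q n Ha)) in Em by (exists m; exact E). discriminate. }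
  assert (E2 : sum_n (fun n => if residue_mask a q n then F n else RtoC 0) N
     = sum_n (fun n => sum_n (fun m => if Nat.eqb n (a + m * q) then F n else RtoC 0) N) N).
  { assert (G : forall M, (M <= N)%nat -> sum_n (fun n => if residue_mask a q n then F n else RtoC 0) M
     = sum_n (fun n => sum_n (fun m => if Nat.eqb n (a + m * q) then F n else RtoC 0) N) M).
    { induction M as [|M IH]; intros HM; rewrite ?sumC_0, ?sumC_S, ?E1, ?IH by lia; reflexivity. }
    apply G. lia. }
  rewrite E2, sumC_switch. apply sumC_ext. intros m. rewrite sum_n_delta.
  destruct (Nat.leb_spec (a + m * q) N) as [H|H]; [reflexivity|]. symmetry. apply HF, H.
Qed.

(** n = a + m q <= y means m <= y/q - a/q, so a residue class gives a lattice sum of Hurwitz type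
    with al = a/q and x = y/q. *)
Lemma sum_upto_mod_eq (y : R) (a q : nat) (f : nat -> C) : (1 <= a <= q)%nat ->
  sum_upto_mod y a q f = sum_upto (y / INR q - INR a / INR q) (fun m => f (a + m * q)%nat).
Proof.
  intros Haq.
  assert (Hq : 1 <= INR q) by (apply (le_INR 1); lia).
  assert (Ha : 1 <= INR a) by (apply (le_INR 1); lia).
  assert (Hiff : forall m, INR m <= y / INR q - INR a / INR q <-> INR (a + m * q) <= y).
  { intros m. rewrite plus_INR, mult_INR.
    replace (y / INR q - INR a / INR q)%R with ((y - INR a) / INR q)%R by (field; lra).
    rewrite <- Rcomplements.Rle_div_r by lra. lra. }
  unfold sum_upto_mod. destruct (Rlt_dec y 0) as [Hy|Hy].
  - rewrite !sum_upto_neg; [reflexivity| |exact Hy].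
    apply Rnot_le_lt. intros H. apply (Hiff 0%nat) in H. pose proof (pos_INR (a + 0 * q)). lra.
  - destruct (nfloor_ex y ltac:(lra)) as [N [_ HN]]. rewrite <- S_INR in HN.
    rewrite (sum_upto_eq y _ N HN). rewrite (sum_upto_eq _ _ N).
    2:{ apply Rnot_le_lt. intros H. apply (Hiff (S N)) in H.
        rewrite plus_INR, mult_INR in H. assert (INR (S N) * 1 <= INR (S N) * INR q); [|lra].
        apply Rmult_le_compat_l; [apply pos_INR|exact Hq]. }
    transitivity (sum_n (fun n => if residue_mask a q n then (if Rle_dec (INR n) y then f n else RtoC 0) else RtoC 0) N).
    + apply sumC_ext. intros n. fold (residue_mask a q n).
      destruct (residue_mask a q n), (Rle_dec (INR n) y); reflexivity.
    + rewrite sum_residue_class.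
      * apply sumC_ext. intros m. destruct (Rle_dec (INR (a + m * q)) y) as [H|H], (Rle_dec (INR m) (y / INR q - INR a / INR q)) as [H'|H']; try reflexivity; apply Hiff in H' || apply Hiff in H; contradiction.
      * exact Haq.
      * intros n Hn. destruct (Rle_dec (INR n) y) as [H|H]; [|reflexivity].
        apply le_INR in Hn. lra.
Qed.

Lemma sumC_n_m_ext (f g : nat -> C) (m n : nat) :
  (forall k, (m <= k <= n)%nat -> f k = g k) -> sum_n_m f m n = sum_n_m g m n.
Proof. exact (sum_n_m_ext_loc (G := C_AbelianMonoid) f g m n). Qed.

Lemma sumC_n_m_plus (f g : nat -> C) (m n : nat) :
  sum_n_m (fun k => f k + g k) m n = sum_n_m f m n + sum_n_m g m n.
Proof. exact (sum_n_m_plus (G := C_AbelianMonoid) f g m n). Qed.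

Lemma sumC_n_m_mult_r (f : nat -> C) (c : C) (m n : nat) :
  sum_n_m (fun k => f k * c) m n = sum_n_m f m n * c.
Proof. exact (sum_n_m_mult_r (K := C_Ring) c f m n). Qed.

Lemma sum_n_m_delta (F : nat -> C) (t : nat -> bool) (p m N : nat) : (m <= p <= N)%nat ->
  (forall n, (m <= n <= N)%nat -> t n = Nat.eqb n p) -> sum_n_m (fun n => if t n then F n else RtoC 0) m N = F p.
Proof.
  intros Hp Ht.
  assert (G : forall M, (M <= N)%nat -> sum_n_m (fun n => if t n then F n else RtoC 0) m M = if Nat.leb p M then F p else RtoC 0).
  { induction M as [|M IH]; intros HM.
    - destruct (Nat.eq_dec m 0) as [->|Hm].
      + rewrite sumC_n_n, Ht by lia. destruct p; reflexivity.
      + rewrite sumC_n_m_zero by lia. rewrite (proj2 (Nat.leb_gt p 0)) by lia. reflexivity.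
    - destruct (Nat.leb_spec m (S M)) as [H|H].
      + rewrite sumC_n_Sm, IH, Ht by lia. destruct (Nat.eqb_spec (S M) p) as [<-|Hne].
        * rewrite (proj2 (Nat.leb_gt (S M) M)), Nat.leb_refl by lia. cring.
        * destruct (Nat.leb_spec p M) as [H'|H'].
          -- rewrite (proj2 (Nat.leb_le p (S M))) by lia. cring.
          -- rewrite (proj2 (Nat.leb_gt p (S M))) by lia. cring.
      + rewrite sumC_n_m_zero by lia. rewrite (proj2 (Nat.leb_gt p (S M))) by lia. reflexivity. }
  rewrite G by lia. rewrite (proj2 (Nat.leb_le p N)) by lia. reflexivity.
Qed.

(** * Character sums over residues *)

Lemma chi_periodic_mul (q : nat) (chi : Z -> C) (n k : Z) : dirichlet_character q chi -> (0 <= k)%Z ->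
  chi (n + k * Z.of_nat q)%Z = chi n.
Proof.
  intros [_ Hper _] Hk. pattern k. apply natlike_ind; [f_equal; lia| |exact Hk].
  intros j Hj IH. rewrite <- IH. replace (n + Z.succ j * Z.of_nat q)%Z with (n + j * Z.of_nat q + Z.of_nat q)%Z by lia.
  apply Hper.
Qed.

Lemma chi_mod (q : nat) (chi : Z -> C) (m n : Z) : dirichlet_character q chi ->
  (Z.of_nat q | m - n)%Z -> chi m = chi n.
Proof.
  intros H [k Hk]. destruct (Z.le_ge_cases 0 k) as [H0|H0].
  - replace m with (n + k * Z.of_nat q)%Z by lia. apply chi_periodic_mul; assumption.
  - replace n with (m + (- k) * Z.of_nat q)%Z by lia. symmetry. apply chi_periodic_mul; [assumption|lia].
Qed.

Lemma sum_over_residues (q n : nat) (chi : Z -> C) : dirichlet_character q chi -> (1 <= q)%nat -> (1 <= n)%nat ->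
  sum_n_m (fun a => if residue_mask a q n then chi (Z.of_nat a) else RtoC 0) 1 q = chi (Z.of_nat n).
Proof.
  intros Hchi Hq Hn.
  pose proof (Nat.div_mod_eq (n - 1) q) as Hdm. pose proof (Nat.mod_upper_bound (n - 1) q ltac:(lia)) as Hub.
  (* The representative of n among 1, ..., q rather than 0, ..., q - 1. *)
  set (p := ((n - 1) mod q + 1)%nat).
  rewrite (sum_n_m_delta (fun a => chi (Z.of_nat a)) (fun a => residue_mask a q n) p).
  - symmetry. apply (chi_mod q); [exact Hchi|]. exists (Z.of_nat ((n - 1) / q)). unfold p. nia.
  - unfold p; lia.
  - intros a Ha. apply Bool.eq_iff_eq_true. rewrite residue_mask_spec, Nat.eqb_eq by exact Ha.
    split.
    + intros [m Hm]. unfold p. assert (E : (n - 1 = (a - 1) + m * q)%nat) by lia.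
      rewrite E, Nat.Div0.mod_add, Nat.mod_small; lia.
    + intros ->. exists ((n - 1) / q)%nat. unfold p. lia.
Qed.

Lemma sum_chi_sum_upto (q : nat) (chi : Z -> C) (y : R) (f : nat -> C) :
  dirichlet_character q chi -> (1 <= q)%nat ->
  sum_n_m (fun a => chi (Z.of_nat a) * sum_upto_mod y a q f) 1 q
  = sum_upto y (fun n => if Nat.leb 1 n then chi (Z.of_nat n) * f n else RtoC 0).
Proof.
  intros Hchi Hq. unfold sum_upto_mod, sum_upto.
  assert (E : forall n, sum_n_m (fun a => chi (Z.of_nat a) * (if Rle_dec (INR n) y then (if residue_mask a q n then f n else RtoC 0) else RtoC 0)) 1 q
    = if Rle_dec (INR n) y then (if Nat.leb 1 n then chi (Z.of_nat n) * f n else RtoC 0) else RtoC 0).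
  { intros n. destruct (Nat.leb_spec 1 n) as [Hn|Hn].
    - rewrite <- (sum_over_residues q n chi Hchi Hq Hn).
      transitivity (sum_n_m (fun a => (if residue_mask a q n then chi (Z.of_nat a) else RtoC 0) * (if Rle_dec (INR n) y then f n else RtoC 0)) 1 q).
      + apply sumC_n_m_ext. intros a _. destruct (residue_mask a q n), (Rle_dec (INR n) y); cring.
      + rewrite sumC_n_m_mult_r. destruct (Rle_dec (INR n) y); [reflexivity|apply Cmult_0_r].
    - transitivity (sum_n_m (fun a => RtoC 0 * RtoC 0) 1 q).
      + apply sumC_n_m_ext. intros a _. unfold residue_mask. rewrite (proj2 (Nat.leb_gt 1 n)) by lia.
        destruct (Rle_dec (INR n) y); simpl; cring.
      + rewrite sumC_n_m_mult_r, Cmult_0_r. destruct (Rle_dec (INR n) y); reflexivity. }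
  induction (Z.to_nat (Int_part y)) as [|N IH].
  - rewrite sumC_0, <- E. apply sumC_n_m_ext. intros a _. rewrite sumC_0. reflexivity.
  - rewrite sumC_S, <- IH, <- E, <- sumC_n_m_plus. apply sumC_n_m_ext. intros a _. rewrite sumC_S.
    apply Cmult_plus_distr_l.
Qed.

(** Passing to lists makes the reordering of the residues a matter of [Permutation]. *)
Lemma sum_n_m_fold (f : nat -> C) (q : nat) :
  sum_n_m f 1 q = fold_right Cplus 0 (map f (seq 1 q)).
Proof.
  induction q as [|q IH]; [apply sumC_n_m_zero; lia|].
  rewrite sumC_n_Sm, IH, seq_S, map_app, fold_right_app by lia. simpl.
  generalize (map f (seq 1 q)). intros l. induction l as [|c l IHl]; simpl; [cring|]. rewrite <- IHl. cring.
Qed.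

Lemma fold_Cplus_perm (l l' : list C) : Permutation l l' -> fold_right Cplus 0 l = fold_right Cplus 0 l'.
Proof. intros H. induction H; simpl; [reflexivity|congruence|cring|congruence]. Qed.

(* Multiplication by a unit b with chi b <> 1 permutes the residues, so the sum S satisfies chi b * S = S. *)
Lemma sum_chi_zero (q : nat) (chi : Z -> C) : (1 <= q)%nat -> dirichlet_character q chi -> ~ principal q chi ->
  sum_n_m (fun a => chi (Z.of_nat a)) 1 q = RtoC 0.
Proof.
  intros Hq Hchi Hnp.
  assert (Hb : exists b, Z.gcd b (Z.of_nat q) = 1%Z /\ chi b <> 1).
  { apply Classical_Prop.NNPP. intros H. apply Hnp. intros n Hn. apply Classical_Prop.NNPP. intros Hne.
    apply H. exists n. split; assumption. }
  destruct Hb as (b & Hgcd & Hb).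
  (* The representative in 1, ..., q of the product of a and b; the shift by one sends multiples of
     q to q. *)
  set (sg := fun a : nat => S (Z.to_nat ((Z.of_nat a * b - 1) mod Z.of_nat q)%Z)).
  assert (Hsg : forall a, (Z.of_nat q | Z.of_nat (sg a) - b * Z.of_nat a)%Z /\ (1 <= sg a <= q)%nat).
  { intros a. pose proof (Z.mod_pos_bound (Z.of_nat a * b - 1) (Z.of_nat q) ltac:(lia)) as Hm.
    pose proof (Z.div_mod (Z.of_nat a * b - 1) (Z.of_nat q) ltac:(lia)) as Hd.
    unfold sg. split; [|lia]. exists (- ((Z.of_nat a * b - 1) / Z.of_nat q))%Z.
    rewrite Nat2Z.inj_succ, Z2Nat.id by lia. lia. }
  (* By Gauss's lemma, b being prime to q, this self-map of 1, ..., q is injective, hence a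
     permutation. *)
  assert (Hperm : Permutation (map sg (seq 1 q)) (seq 1 q)).
  { apply NoDup_Permutation_bis.
    - apply FinFun.Injective_map_NoDup_in; [|apply seq_NoDup].
      intros a a' Ha Ha' E. apply in_seq in Ha. apply in_seq in Ha'.
      destruct (Hsg a) as [[k Hk] _], (Hsg a') as [[k' Hk'] _]. rewrite E in Hk.
      assert (D : (Z.of_nat q | b * (Z.of_nat a - Z.of_nat a'))%Z) by (exists (k' - k)%Z; lia).
      apply Z.gauss in D; [|rewrite Z.gcd_comm; exact Hgcd].
      destruct D as [j Hj]. assert (j = 0%Z) by nia. lia.
    - rewrite length_map. lia.
    - intros c Hc. apply in_map_iff in Hc. destruct Hc as (a & <- & _). apply in_seq. pose proof (proj2 (Hsg a)). lia. }
  set (S_ := sum_n_m (fun a => chi (Z.of_nat a)) 1 q).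
  assert (E : S_ = chi b * S_).
  { unfold S_ at 1. rewrite sum_n_m_fold.
    rewrite <- (fold_Cplus_perm _ _ (Permutation_map (fun a => chi (Z.of_nat a)) Hperm)), map_map, <- sum_n_m_fold.
    rewrite Cmult_comm. unfold S_. rewrite <- (sumC_n_m_mult_r (fun a => chi (Z.of_nat a))). apply sumC_n_m_ext.
    intros a _. rewrite (chi_mod q chi _ _ Hchi (proj1 (Hsg a))), (chi_mul q chi Hchi). apply Cmult_comm. }
  apply Classical_Prop.NNPP. intros H. apply Hb.
  assert (E' : (chi b - 1) * S_ = 0).
  { replace ((chi b - 1) * S_) with (chi b * S_ - S_) by ring. rewrite <- E. ring. }
  destruct (Ceq_dec (chi b - 1) 0) as [E0|E0]; [rewrite <- (Cplus_0_l 1), <- E0; ring|].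
  exfalso. apply H. unfold S_ in *. rewrite <- (Cmult_1_l (sum_n_m _ 1 q)), <- (Cinv_l _ E0), <- Cmult_assoc, E'. apply Cmult_0_r.
Qed.

Lemma lim_sum_n_m (f : nat -> R -> C) (c : nat -> C) (m n : nat) :
  (forall a, (m <= a <= n)%nat -> forall eps, 0 < eps -> exists N, forall b, N < b -> Cmod (f a b) < eps) ->
  forall eps, 0 < eps -> exists N, forall b, N < b -> Cmod (sum_n_m (fun a => c a * f a b) m n) < eps.
Proof.
  intros H. induction n as [|n IH]; intros eps Heps.
  - destruct m as [|m].
    + destruct (H 0%nat ltac:(lia) (eps / (Cmod (c 0%nat) + 1))%R) as [N HN].
      { pose proof (Cmod_ge_0 (c 0%nat)). apply Rdiv_lt_0_compat; lra. }
      exists N. intros b Hb. rewrite sumC_n_n, Cmod_mult. specialize (HN b Hb).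
      pose proof (Cmod_ge_0 (c 0%nat)). pose proof (Cmod_ge_0 (f 0%nat b)).
      apply Rmult_lt_compat_r with (r := (Cmod (c 0%nat) + 1)%R) in HN; [|lra].
      unfold Rdiv in HN. rewrite Rmult_assoc, Rinv_l in HN by lra. lra.
    + exists 0%R. intros b _. rewrite sumC_n_m_zero by lia. rewrite Cmod_0. exact Heps.
  - destruct (Nat.leb_spec m (S n)) as [Hm|Hm].
    + destruct (IH ltac:(intros a Ha; apply H; lia) (eps / 2)%R ltac:(lra)) as [N HN].
      destruct (H (S n) ltac:(lia) (eps / 2 / (Cmod (c (S n)) + 1))%R) as [N' HN'].
      { pose proof (Cmod_ge_0 (c (S n))). apply Rdiv_lt_0_compat; lra. }
      exists (Rmax N N'). intros b Hb. pose proof (Rmax_l N N'). pose proof (Rmax_r N N').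
      specialize (HN b ltac:(lra)). specialize (HN' b ltac:(lra)).
      rewrite sumC_n_Sm by lia. eapply Rle_lt_trans; [apply Cmod_triangle|]. rewrite Cmod_mult.
      pose proof (Cmod_ge_0 (c (S n))). pose proof (Cmod_ge_0 (f (S n) b)).
      apply Rmult_lt_compat_r with (r := (Cmod (c (S n)) + 1)%R) in HN'; [|lra].
      unfold Rdiv in HN'. rewrite !Rmult_assoc, Rinv_l in HN' by lra. lra.
    + exists 0%R. intros b _. rewrite sumC_n_m_zero by lia. rewrite Cmod_0. exact Heps.
Qed.

Lemma fraction_range (a q : nat) : (1 <= a <= q)%nat -> 0 < INR q /\ 0 < INR a / INR q <= 1.
Proof.
  intros H. assert (Hq : 0 < INR q) by (apply lt_0_INR; lia).
  assert (Ha : 0 < INR a <= INR q) by (split; [apply lt_0_INR; lia|apply le_INR; lia]).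
  split; [exact Hq|]. split; [apply Rdiv_lt_0_compat; lra|].
  apply Rmult_le_reg_r with (INR q); [exact Hq|]. unfold Rdiv. rewrite Rmult_assoc, Rinv_l; lra.
Qed.

Lemma sum_lpow_residue (X : R) (a q k : nat) (z : C) : (1 <= a <= q)%nat ->
  sum_upto (X / INR q - INR a / INR q) (fun n => lpow (INR q) k z (INR n + INR a / INR q)%R)
  = sum_upto_mod X a q (fun n => lpow 1 k z (INR n)).
Proof.
  intros H. destruct (fraction_range a q H) as [Hq _].
  rewrite sum_upto_mod_eq by exact H. apply sum_upto_ext. intros n _. unfold lpow.
  replace (INR q * (INR n + INR a / INR q))%R with (1 * INR (a + n * q))%R; [reflexivity|].
  rewrite plus_INR, mult_INR. field. lra.
Qed.

(** For Re z > 1 the residue classes are all cut off at the common point b/q, so the same primitive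
    P (b/q) appears in each and is cancelled by the vanishing character sum. What remains is
    analytic at 1 too, and a horizontal ray may be used. *)
Theorem dirichlet_L_eq (q : nat) (chi : Z -> C) (X : R) (s : C) :
  (1 <= q)%nat -> dirichlet_character q chi -> ~ principal q chi -> 0 < X -> 0 < Re s ->
  dirichlet_L q chi s
  = sum_n_m (fun a => chi (Z.of_nat a) * euler_part (INR q) (INR a / INR q) (X / INR q) 0 s) 1 q.
Proof.
  intros Hq Hchi Hnp HX Hs. unfold dirichlet_L.
  assert (HqR : 0 < INR q) by (apply lt_0_INR; lia).
  assert (Hx : 0 < X / INR q) by (apply Rdiv_lt_0_compat; lra).
  apply (continuation_eq _ _ (fun s => sum_n_m (fun a => chi (Z.of_nat a) * euler_part (INR q) (INR a / INR q) (X / INR q) 0 s) 1 q) s 1); try assumption.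
  - simpl; lra.
  - intros t _. left; exact Hnp.
  - intros z _ Hz.
    apply (taylor_analytic (fun z => 0 < Re z) (fun k z => sum_n_m (fun a => chi (Z.of_nat a) * euler_part (INR q) (INR a / INR q) (X / INR q) k z) 1 q)); [|exact Hz].
    apply (taylor_sum_n_m _ (fun a k z => chi (Z.of_nat a) * euler_part (INR q) (INR a / INR q) (X / INR q) k z)).
    intros a Ha. apply taylor_scal, taylor_euler_part; [exact HqR|apply (fraction_range a q Ha)|exact Hx].
  - intros z Hz. assert (Hz0 : 0 < Re z) by lra.
    set (F := sum_n_m _ 1 q).
    set (P := fun b => RInt (V := C_R_CompleteNormedModule) (lpow (INR q) 0 z) (X / INR q) b : C).
    assert (HP : forall b, X / INR q <= b -> intC (lpow (INR q) 0 z) (X / INR q) b (P b)).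
    { intros b Hb. apply (RInt_correct (V := C_R_CompleteNormedModule)).
      apply (ex_RInt_continuous (V := C_R_CompleteNormedModule)). intros u Hu. rewrite Rmin_left in Hu by exact Hb.
      apply contC_lpow; lra. }
    (* The value 0 at index 0 matches sums over n >= 0 with the series over positive integers. *)
    set (g := fun n => if Nat.leb 1 n then chi (Z.of_nat n) * lpow 1 0 z (INR n) else RtoC 0).
    assert (Hlim : forall eps, 0 < eps -> exists N, forall b, N < b -> Cmod (sum_upto (b - 0) g - F) < eps).
    { intros eps Heps.
      destruct (lim_sum_n_m (fun a b => sum_upto (b - INR a / INR q) (fun n => lpow (INR q) 0 z (INR n + INR a / INR q)%R) - P b
         - euler_part (INR q) (INR a / INR q) (X / INR q) 0 z) (fun a => chi (Z.of_nat a)) 1 q) with (eps := eps) as [N HN].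
      - intros a Ha. apply euler_part_limit; try assumption. apply (fraction_range a q Ha).
      - exact Heps.
      - exists (INR q * N)%R. intros b Hb. specialize (HN (b / INR q)%R).
        rewrite Rminus_0_r. unfold g. rewrite <- (sum_chi_sum_upto q chi b (fun n => lpow 1 0 z (INR n)) Hchi Hq).
        replace (sum_n_m (fun a => chi (Z.of_nat a) * sum_upto_mod b a q (fun n => lpow 1 0 z (INR n))) 1 q - F) with
          (sum_n_m (fun a => chi (Z.of_nat a) * (sum_upto (b / INR q - INR a / INR q) (fun n => lpow (INR q) 0 z (INR n + INR a / INR q)%R)
            - P (b / INR q)%R - euler_part (INR q) (INR a / INR q) (X / INR q) 0 z)) 1 q).
        + apply HN. apply Rmult_lt_reg_l with (INR q); [exact HqR|].
          replace (INR q * (b / INR q))%R with b by (field; lra). exact Hb.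
        + rewrite (sumC_n_m_ext _ (fun a => chi (Z.of_nat a) * sum_upto_mod b a q (fun n => lpow 1 0 z (INR n))
            + (chi (Z.of_nat a) * - P (b / INR q)%R + chi (Z.of_nat a) * euler_part (INR q) (INR a / INR q) (X / INR q) 0 z * -1))).
          * rewrite !sumC_n_m_plus, !sumC_n_m_mult_r, (sum_chi_zero q chi Hq Hchi Hnp). fold F. cring.
          * intros a Ha. rewrite sum_lpow_residue by exact Ha. ring. }
    pose proof (serC_of_lim g 0 F Hlim) as HS.
    rewrite serC_spec in *. intros eps Heps. destruct (HS eps Heps) as [N HN].
    (* Index shift: the partial sum of the series with last index n ends at the integer n + 1. *)
    exists N. intros n Hn. specialize (HN (S n) ltac:(lia)).
    replace (sum_n (fun n => chi (Z.of_nat (S n)) * Rcpow (INR (S n)) (- z)) n) with (sum_n g (S n)); [exact HN|].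
    clear. induction n as [|n IH].
    + rewrite sumC_S, !sumC_0. unfold g. cbv [Nat.leb]. rewrite lpow_1_u. apply Cplus_0_l.
    + rewrite sumC_S, IH, sumC_S. unfold g at 1. simpl Nat.leb. rewrite lpow_1_u. reflexivity.
Qed.

Lemma C_derive_n_dirichlet_L (q : nat) (chi : Z -> C) (X : R) (r : nat) (s : C) :
  (1 <= q)%nat -> dirichlet_character q chi -> ~ principal q chi -> 0 < X -> 0 < Re s ->
  C_derive_n r (dirichlet_L q chi) s
  = sum_n_m (fun a => chi (Z.of_nat a) * euler_part (INR q) (INR a / INR q) (X / INR q) r s) 1 q.
Proof.
  intros Hq Hchi Hnp HX Hs.
  assert (HqR : 0 < INR q) by (apply lt_0_INR; lia).
  assert (Hx : 0 < X / INR q) by (apply Rdiv_lt_0_compat; lra).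
  apply (C_derive_n_eq (fun z => 0 < Re z) (fun k z => sum_n_m (fun a => chi (Z.of_nat a) * euler_part (INR q) (INR a / INR q) (X / INR q) k z) 1 q));
    [exact openC_half_plane| | |exact Hs].
  - apply taylor_derivatives.
    apply (taylor_sum_n_m _ (fun a k z => chi (Z.of_nat a) * euler_part (INR q) (INR a / INR q) (X / INR q) k z)).
    intros a Ha. apply taylor_scal, taylor_euler_part; [exact HqR|apply (fraction_range a q Ha)|exact Hx].
  - intros z Hz. apply dirichlet_L_eq; assumption.
Qed.

(** * Lerch's zeta function *)

Lemma expi_plus (u v : R) : expi (u + v) = expi u * expi v.
Proof.
  unfold expi. rewrite <- Cexp_plus. f_equal. apply C_eq; simpl; ring.
Qed.

Lemma expi_mod (u : R) : Cmod (expi u) = 1%R.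
Proof. unfold expi. rewrite Cmod_Cexp. simpl. apply exp_0. Qed.

Lemma expi_0 : expi 0 = 1.
Proof. unfold expi. rewrite Rmult_0_r. apply Cexp_0. Qed.

(** Re (expi lambda) = 1 - 2 sin^2 (PI lambda), and this sine is positive for 0 < lambda < 1. *)
Lemma expi_neq_1 (lambda : R) : 0 < lambda < 1 -> expi lambda <> 1.
Proof.
  intros Hl E. assert (H : Re (expi lambda) = 1%R) by (rewrite E; reflexivity).
  unfold expi, Cexp in H. simpl in H. rewrite exp_0, Rmult_1_l, Rmult_assoc, cos_2a_sin in H.
  assert (0 < sin (PI * lambda)).
  { pose proof PI_RGT_0. apply sin_gt_0; nra. }
  nra.
Qed.

Lemma derC_expi (lambda alpha u : R) :
  derC (fun u => expi (lambda * (u - alpha))) u (2 * PI * Ci * lambda * expi (lambda * (u - alpha))).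
Proof.
  unfold expi. apply (derC_Cexp (fun u => (0, 2 * PI * (lambda * (u - alpha)))%R)).
  replace (2 * PI * Ci * lambda) with ((0, 2 * PI * lambda)%R : C) by (apply C_eq; simpl; ring).
  apply derC_pair; auto_derive; auto; ring.
Qed.

Lemma contC_expi (lambda alpha u : R) : contC (fun u => expi (lambda * (u - alpha))) u.
Proof. eapply derC_cont, derC_expi. Qed.

Definition exp_sum (lambda alpha u : R) : C := sum_upto (u - alpha) (fun n => expi (lambda * INR n)).

(** A geometric sum: multiplied by expi lambda - 1 it becomes a difference of two numbers of modulus
    1. *)
Lemma exp_sum_bounded (lambda alpha u : R) : 0 < lambda < 1 ->
  Cmod (exp_sum lambda alpha u) <= 2 / Cmod (expi lambda - 1).
Proof.
  intros Hl. pose proof (Cminus_neq_0 _ _ (expi_neq_1 lambda Hl)) as H0.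
  pose proof (proj1 (Cmod_gt_0 _) H0) as Hm.
  unfold exp_sum. destruct (Rlt_dec (u - alpha) 0) as [Hu|Hu].
  - rewrite sum_upto_neg by exact Hu. rewrite Cmod_0. left. apply Rdiv_lt_0_compat; lra.
  - destruct (nfloor_ex (u - alpha) ltac:(lra)) as [m Hmm]. rewrite <- S_INR in Hmm.
    rewrite (sum_upto_floor _ m) by exact Hmm.
    assert (E : (expi lambda - 1) * sum_n (fun n => expi (lambda * INR n)) m = expi (lambda * INR (S m)) - 1).
    { clear. induction m as [|m IH].
      - rewrite sumC_0. simpl. rewrite Rmult_0_r, Rmult_1_r, expi_0. ring.
      - rewrite sumC_S, Cmult_plus_distr_l, IH, (S_INR (S m)).
        rewrite Rmult_plus_distr_l, Rmult_1_r, expi_plus. ring. }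
    apply Rmult_le_reg_l with (Cmod (expi lambda - 1)); [exact Hm|].
    rewrite <- Cmod_mult, E. replace (Cmod (expi lambda - 1) * (2 / Cmod (expi lambda - 1)))%R with (1 + 1)%R by (field; lra).
    eapply Rle_trans; [apply Cmod_triangle|]. rewrite Cmod_opp, expi_mod, Cmod_1. lra.
Qed.

Lemma admissible_plus (A B : R -> C) (x : R) :
  admissible A x -> admissible B x -> admissible (fun u => A u + B u) x.
Proof.
  intros [[M HM] HA] [[N HN] HB]. split; [|apply loc_int_plus; assumption].
  exists (M + N)%R. intros u Hu. eapply Rle_trans; [apply Cmod_triangle|]. apply Rplus_le_compat; auto.
Qed.

Lemma admissible_mult (B e : R -> C) (x M : R) : (forall u, 0 < u -> contC e u) ->
  (forall u, x <= u -> Cmod (e u) <= M) -> admissible B x -> admissible (fun u => B u * e u) x.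
Proof.
  intros He HM [[N HN] HB]. split; [|apply loc_int_mult; assumption].
  exists (N * M)%R. intros u Hu. rewrite Cmod_mult. apply Rmult_le_compat; auto using Cmod_ge_0.
Qed.

Lemma admissible_expi (c : C) (lambda alpha x : R) : 0 < x ->
  admissible (fun u => c * expi (lambda * (u - alpha))) x.
Proof.
  intros Hx. split.
  - exists (Cmod c). intros u _. rewrite Cmod_mult, expi_mod. lra.
  - apply loc_int_continuous; [exact Hx|]. intros u _. apply contC_mult; [apply contC_const|apply contC_expi].
Qed.

Lemma admissible_exp_sum (lambda alpha x : R) : 0 < lambda < 1 -> 0 < alpha -> 0 < x ->
  admissible (exp_sum lambda alpha) x.
Proof.
  intros Hl Ha Hx. split; [|apply loc_int_step; assumption].
  exists (2 / Cmod (expi lambda - 1))%R. intros u _. apply exp_sum_bounded, Hl.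
Qed.

Lemma GI_plus (A B : R -> C) (c x : R) (k : nat) (z : C) :
  0 < c -> 0 < x -> 0 < Re z -> admissible A x -> admissible B x ->
  GI (fun u => A u + B u) c x k z = GI A c x k z + GI B c x k z.
Proof.
  intros Hc Hx Hz HA HB. apply GI_of.
  eapply infC_ext; [|apply infC_plus; apply GI_correct; eassumption].
  intros u _. simpl. ring.
Qed.

Notation lpow1 := (lpow 1).
Notation dlpow k z u := (mul_id (fun j w => lpow 1 j w u) k z).

Lemma derC_lpow1 (k : nat) (z : C) (u : R) : 0 < u -> derC (lpow1 k z) u (- (dlpow k z u / RtoC u)).
Proof. intros Hu. apply derC_lpow; lra. Qed.

Lemma contC_dlpow (k : nat) (z : C) (u : R) : 0 < u -> contC (fun u => dlpow k z u / RtoC u) u.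
Proof.
  intros Hu. apply contC_div_id; [exact Hu|]. unfold mul_id.
  apply contC_plus; apply contC_mult; try apply contC_const; apply contC_lpow; lra.
Qed.

Lemma contC_opp (f : R -> C) (u : R) : contC f u -> contC (fun u => - f u) u.
Proof. exact (continuous_opp (V := C_R_NormedModule) f u). Qed.

(* Integration by parts trades a conditionally convergent integral for an absolutely convergent one. *)
Lemma infC_by_parts (w W : R -> C) (x : R) (k : nat) (z : C) :
  0 < x -> 0 < Re z -> admissible W x ->
  (forall b, x <= b -> intC (fun u => w u * lpow1 k z u - W u * (dlpow k z u / RtoC u)) x b
     (W b * lpow1 k z b - W x * lpow1 k z x)) ->
  is_RInt_infty (fun u => w u * lpow1 k z u) x (mul_id (GI W 1 x) k z - W x * lpow1 k z x).
Proof.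
  intros Hx Hz HW H.
  set (I := fun y => RInt (V := C_R_CompleteNormedModule) (fun u => W u * (dlpow k z u / RtoC u)) x y : C).
  assert (HI : forall y, x <= y -> intC (fun u => W u * (dlpow k z u / RtoC u)) x y (I y)).
  { intros y Hy. apply (RInt_correct (V := C_R_CompleteNormedModule)). apply (proj2 HW); [|exact Hy].
    intros u Hu. apply contC_dlpow, Hu. }
  apply (infC_of_lim _ (fun b => W b * lpow1 k z b - W x * lpow1 k z x + I b)).
  { intros b Hb. eapply intC_ext; [exact Hb| |apply intC_plus; [apply H, Hb|apply HI, Hb]].
    intros u _. simpl. ring. }
  intros eps Heps. destruct (proj1 HW) as [M HM].
  assert (HM0 : 0 <= M) by (eapply Rle_trans; [apply Cmod_ge_0|apply (HM x (Rle_refl x))]).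
  destruct (infC_lim _ I x _ HI (infC_mul_id W 1 x k z Rlt_0_1 Hx HW Hz) (eps / 2)%R ltac:(lra)) as [N HN].
  destruct (lpow_vanish 1 k z Rlt_0_1 Hz (eps / 2 / (M + 1))%R) as [N' HN']; [apply Rdiv_lt_0_compat; lra|].
  exists (Rmax (Rmax N N') x). intros b Hb.
  assert (Hb' : N < b /\ N' < b /\ x < b).
  { pose proof (Rmax_l (Rmax N N') x). pose proof (Rmax_r (Rmax N N') x).
    pose proof (Rmax_l N N'). pose proof (Rmax_r N N'). lra. }
  destruct Hb' as (Hb1 & Hb2 & Hb3). specialize (HN b Hb1). specialize (HN' b Hb2).
  replace (W b * lpow1 k z b - W x * lpow1 k z x + I b - (mul_id (GI W 1 x) k z - W x * lpow1 k z x))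
    with (W b * lpow1 k z b + (I b - mul_id (GI W 1 x) k z)) by ring.
  eapply Rle_lt_trans; [apply Cmod_triangle|]. rewrite Cmod_mult.
  assert (Cmod (W b) * Cmod (lpow1 k z b) < eps / 2); [|lra].
  apply Rmult_lt_compat_l with (r := (M + 1)%R) in HN'; [|lra].
  replace ((M + 1) * (eps / 2 / (M + 1)))%R with (eps / 2)%R in HN' by (field; lra).
  pose proof (HM b ltac:(lra)). pose proof (Cmod_ge_0 (lpow1 k z b)). nra.
Qed.

Lemma expi_lattice (lambda alpha : R) (n : nat) : expi (lambda * (INR n + alpha - alpha)) = expi (lambda * INR n).
Proof. f_equal. f_equal. ring. Qed.

(** Abel summation against the bounded exponential sums takes the place of Euler's formula: its only
    integral converges absolutely, so [taylor_GI] makes it analytic for Re z > 0. The formula with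
    psi is derived from it afterwards. *)
Definition lerch_part (lambda alpha x : R) (k : nat) (z : C) : C :=
  sum_upto (x - alpha) (fun n => expi (lambda * INR n) * lpow1 k z (INR n + alpha)%R)
  + mul_id (GI (exp_sum lambda alpha) 1 x) k z
  - exp_sum lambda alpha x * lpow1 k z x.

Lemma taylor_lerch_part (lambda alpha x : R) : 0 < lambda < 1 -> 0 < alpha -> 0 < x ->
  taylor (fun z => 0 < Re z) (lerch_part lambda alpha x).
Proof.
  intros Hl Ha Hx.
  apply (taylor_ext _ (fun k z => (sum_upto (x - alpha) (fun n => expi (lambda * INR n) * lpow1 k z (INR n + alpha)%R)
    + mul_id (GI (exp_sum lambda alpha) 1 x) k z) + - exp_sum lambda alpha x * lpow1 k z x)).
  { intros k z. unfold lerch_part. ring. }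
  apply taylor_plus; [apply taylor_plus|].
  - apply (taylor_sum_upto _ _ (fun n k z => expi (lambda * INR n) * lpow1 k z (INR n + alpha)%R)).
    intros n. apply taylor_scal, taylor_lpow.
  - apply taylor_mul_id, taylor_GI; [lra|exact Hx|]. apply admissible_exp_sum; assumption.
  - apply taylor_scal, taylor_lpow.
Qed.

Lemma abel_exp_sum (lambda alpha x b : R) (k : nat) (z : C) : 0 < alpha -> 0 < x -> x <= b ->
  intC (fun u => exp_sum lambda alpha u * - (dlpow k z u / RtoC u)) x b
    (exp_sum lambda alpha b * lpow1 k z b - sum_upto (b - alpha) (fun n => expi (lambda * INR n) * lpow1 k z (INR n + alpha)%R)
     - (exp_sum lambda alpha x * lpow1 k z x - sum_upto (x - alpha) (fun n => expi (lambda * INR n) * lpow1 k z (INR n + alpha)%R))).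
Proof.
  intros Ha Hx Hb. apply (abel_summation alpha (fun n => expi (lambda * INR n)) (lpow1 k z) (fun u => - (dlpow k z u / RtoC u)) x b Ha Hx Hb).
  - intros u Hu. apply derC_lpow1, Hu.
  - intros u Hu. apply contC_opp, contC_dlpow, Hu.
Qed.

Lemma lerch_lim (lambda alpha x : R) (z : C) : 0 < lambda < 1 -> 0 < alpha -> 0 < x -> 0 < Re z ->
  forall eps, 0 < eps -> exists N, forall b, N < b ->
    Cmod (sum_upto (b - alpha) (fun n => expi (lambda * INR n) * lpow1 0 z (INR n + alpha)%R)
      - lerch_part lambda alpha x 0 z) < eps.
Proof.
  intros Hl Ha Hx Hz eps Heps.
  pose proof (admissible_exp_sum lambda alpha x Hl Ha Hx) as HA.
  destruct (proj1 HA) as [M HM].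
  assert (HM0 : 0 <= M) by (eapply Rle_trans; [apply Cmod_ge_0|apply (HM x (Rle_refl x))]).
  set (T := fun b => sum_upto (b - alpha) (fun n => expi (lambda * INR n) * lpow1 0 z (INR n + alpha)%R)).
  set (A := exp_sum lambda alpha) in *.
  assert (HI : forall y, x <= y -> intC (fun u => A u * (dlpow 0%nat z u / RtoC u)) x y
     (-1 * (A y * lpow1 0 z y - T y - (A x * lpow1 0 z x - T x)))).
  { intros y Hy. eapply intC_ext; [exact Hy| |apply intC_mult_l, (abel_exp_sum lambda alpha x y 0 z Ha Hx Hy)].
    intros u _. cbv beta. fold A. ring. }
  destruct (infC_lim _ _ x _ HI (infC_mul_id A 1 x 0 z Rlt_0_1 Hx HA Hz) (eps / 2)%R ltac:(lra)) as [N HN].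
  destruct (lpow_vanish 1 0 z Rlt_0_1 Hz (eps / 2 / (M + 1))%R) as [N' HN']; [apply Rdiv_lt_0_compat; lra|].
  exists (Rmax (Rmax N N') x). intros b Hb.
  assert (Hb' : N < b /\ N' < b /\ x < b).
  { pose proof (Rmax_l (Rmax N N') x). pose proof (Rmax_r (Rmax N N') x).
    pose proof (Rmax_l N N'). pose proof (Rmax_r N N'). lra. }
  destruct Hb' as (Hb1 & Hb2 & Hb3). specialize (HN b Hb1). specialize (HN' b Hb2).
  fold (T b). unfold lerch_part. fold (T x). fold A.
  replace (T b - (T x + mul_id (GI A 1 x) 0 z - A x * lpow1 0 z x)) with
    (-1 * (A b * lpow1 0 z b - T b - (A x * lpow1 0 z x - T x)) - mul_id (GI A 1 x) 0 z + A b * lpow1 0 z b) by ring.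
  eapply Rle_lt_trans; [apply Cmod_triangle|]. rewrite (Cmod_mult (A b)).
  assert (Cmod (A b) * Cmod (lpow1 0 z b) < eps / 2); [|lra].
  apply Rmult_lt_compat_l with (r := (M + 1)%R) in HN'; [|lra].
  replace ((M + 1) * (eps / 2 / (M + 1)))%R with (eps / 2)%R in HN' by (field; lra).
  pose proof (HM b ltac:(lra)). pose proof (Cmod_ge_0 (lpow1 0 z b)). nra.
Qed.

Theorem lerch_phi_eq (lambda alpha x : R) (s : C) : 0 < lambda < 1 -> 0 < alpha -> 0 < x -> 0 < Re s ->
  lerch_phi lambda alpha s = lerch_part lambda alpha x 0 s.
Proof.
  intros Hl Ha Hx Hs. unfold lerch_phi.
  apply (continuation_eq _ _ (lerch_part lambda alpha x 0) s 1); try assumption; try (simpl; lra); auto.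
  - intros z _ Hz. apply (taylor_analytic _ _ z (taylor_lerch_part lambda alpha x Hl Ha Hx) Hz).
  - intros z Hz.
    apply (serC_ext (fun n => expi (lambda * INR n) * lpow1 0 z (INR n + alpha)%R)); [intros n; rewrite lpow_1_u; reflexivity|].
    apply serC_of_lim with (al := alpha). apply lerch_lim; try assumption. lra.
Qed.

Lemma kappa_neq_0 (lambda : R) : 0 < lambda -> 2 * PI * Ci * lambda <> 0.
Proof.
  intros Hl E. assert (H : Im (2 * PI * Ci * lambda) = 0%R) by (rewrite E; reflexivity).
  simpl in H. pose proof PI_RGT_0. assert (0 < PI * lambda) by nra. nra.
Qed.

(** At u = n + alpha the exponential sum A jumps by expi (lambda n) and Q = psi e by the opposite
    amount, so A + Q is a continuous bounded primitive of e + kappa Q. Integrating by parts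
    expresses J1 + kappa J2 through the integrals against A and against Q; the first is the one in
    [lerch_part], the second is the one subtracted in the formula. *)
Lemma C_derive_n_lerch (lambda alpha x : R) (r : nat) (s : C) :
  0 < lambda < 1 -> 0 < alpha <= 1 -> 0 < x -> 0 < Re s ->
  exists J1 J2 : C,
    is_RInt_infty (fun u => expi (lambda * (u - alpha)) * lpow1 r s u) x J1 /\
    is_RInt_infty (fun u => RtoC (psi (u - alpha)) * expi (lambda * (u - alpha)) * lpow1 r s u) x J2 /\
    C_derive_n r (lerch_phi lambda alpha) s
    = sum_upto (x - alpha) (fun n => expi (lambda * INR n) * lpow1 r s (INR n + alpha)%R)
      + J1 + 2 * PI * Ci * lambda * J2
      - mul_id (GI (fun u => RtoC (psi (u - alpha)) * expi (lambda * (u - alpha))) 1 x) r s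
      + expi (lambda * (x - alpha)) * psi (x - alpha) * lpow1 r s x.
Proof.
  intros Hl Ha Hx Hs.
  set (kappa := 2 * PI * Ci * lambda). assert (Hk : kappa <> 0) by (apply kappa_neq_0; lra).
  set (e := fun u => expi (lambda * (u - alpha))).
  set (A := exp_sum lambda alpha).
  set (Q := fun u => RtoC (psi (u - alpha)) * e u).
  assert (HA : admissible A x) by (apply admissible_exp_sum; lra).
  assert (HQ : admissible Q x).
  { apply (admissible_mult _ e x 1); [intros u _; apply contC_expi| |apply admissible_psi; assumption].
    intros u _. unfold e. rewrite expi_mod. lra. }
  assert (HW := admissible_plus A Q x HA HQ).
  assert (Hde : forall u, 0 < u -> derC (fun u => e u * lpow1 r s u) u (kappa * e u * lpow1 r s u + e u * - (dlpow r s u / RtoC u))).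
  { intros u Hu. apply derC_mult; [apply derC_expi|apply derC_lpow1, Hu]. }
  assert (Hce : forall u, 0 < u -> contC (fun u => kappa * e u * lpow1 r s u + e u * - (dlpow r s u / RtoC u)) u).
  { intros u Hu. apply contC_plus; apply contC_mult.
    - apply contC_mult; [apply contC_const|apply contC_expi].
    - apply contC_lpow; lra.
    - apply contC_expi.
    - apply contC_opp, contC_dlpow, Hu. }
  (* The exponential e has the bounded primitive e / kappa. *)
  assert (H1 : is_RInt_infty (fun u => e u * lpow1 r s u) x
     (mul_id (GI (fun u => / kappa * e u) 1 x) r s - / kappa * e x * lpow1 r s x)).
  { apply (infC_by_parts e (fun u => / kappa * e u)); [exact Hx|exact Hs|apply admissible_expi, Hx|].
    intros b Hb.
    replace (/ kappa * e b * lpow1 r s b - / kappa * e x * lpow1 r s x) with (/ kappa * (e b * lpow1 r s b - e x * lpow1 r s x)) by ring.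
    eapply intC_ext; [exact Hb| |apply intC_mult_l, (intC_derive (fun u => e u * lpow1 r s u) (fun u => kappa * e u * lpow1 r s u + e u * - (dlpow r s u / RtoC u)))].
    - intros u Hu. cbv beta. set (D := mul_id _ r s). field. split; [apply RtoC_neq_0; lra|exact Hk].
    - intros u Hu. rewrite Rmin_left in Hu by exact Hb. apply Hde; lra.
    - intros u Hu. rewrite Rmin_left in Hu by exact Hb. apply Hce; lra. }
  assert (H2 : is_RInt_infty (fun u => (e u + kappa * Q u) * lpow1 r s u) x
     (mul_id (GI (fun u => A u + Q u) 1 x) r s - (A x + Q x) * lpow1 r s x)).
  { apply (infC_by_parts (fun u => e u + kappa * Q u) (fun u => A u + Q u)); [exact Hx|exact Hs|exact HW|].
    intros b Hb.
    pose proof (abel_exp_sum lambda alpha x b r s (proj1 Ha) Hx Hb) as E1.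
    pose proof (euler_summation alpha (fun u => e u * lpow1 r s u) (fun u => kappa * e u * lpow1 r s u + e u * - (dlpow r s u / RtoC u)) x b
      Ha Hx Hb Hde Hce) as E2. cbv beta in E2.
    rewrite !(sum_upto_ext _ (fun n => e (INR n + alpha)%R * lpow1 r s (INR n + alpha)%R)
      (fun n => expi (lambda * INR n) * lpow1 r s (INR n + alpha)%R)) in E2.
    2,3: intros n _; unfold e; rewrite expi_lattice; reflexivity.
    (* The lattice sums in [E1] and [E2] have opposite signs and cancel. *)
    pose proof (intC_plus _ _ _ _ _ _ E1 E2) as E. fold A in E.
    match goal with |- intC _ _ _ ?l => match type of E with intC _ _ _ ?m => replace l with m end end.
    - eapply intC_ext; [exact Hb| |exact E]. intros u _. cbv beta. unfold Q. ring.
    - unfold Q. ring. }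
  exists (mul_id (GI (fun u => / kappa * e u) 1 x) r s - / kappa * e x * lpow1 r s x).
  (* The second integral is recovered by subtracting the value in [H1] from that in [H2] and
     dividing by kappa. *)
  exists (/ kappa * (mul_id (GI (fun u => A u + Q u) 1 x) r s - (A x + Q x) * lpow1 r s x
    + -1 * (mul_id (GI (fun u => / kappa * e u) 1 x) r s - / kappa * e x * lpow1 r s x))).
  split; [exact H1|]. split.
  - eapply infC_ext; [|apply infC_mult_l, infC_plus; [exact H2|apply infC_mult_l, H1]].
    intros u _. cbv beta. fold (e u). fold (Q u). field. exact Hk.
  - rewrite (C_derive_n_eq (fun z => 0 < Re z) (lerch_part lambda alpha x) _ openC_half_plane
      (taylor_derivatives _ _ (taylor_lerch_part lambda alpha x Hl (proj1 Ha) Hx))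
      (fun z Hz => lerch_phi_eq lambda alpha x z Hl (proj1 Ha) Hx Hz) r s Hs).
    unfold lerch_part. fold A.
    assert (E : mul_id (GI (fun u => A u + Q u) 1 x) r s = mul_id (GI A 1 x) r s + mul_id (GI Q 1 x) r s).
    { unfold mul_id. rewrite !GI_plus by (assumption || lra). ring. }
    rewrite E. change (fun u : R => RtoC (psi (u - alpha)) * expi (lambda * (u - alpha))) with Q.
    change (expi (lambda * (x - alpha))) with (e x). unfold Q at 2. field. exact Hk.
Qed.

(** * The formulas *)

Lemma Rcpow_opp (u : R) (z : C) : Rcpow u (- z) = / Rcpow u z.
Proof.
  unfold Rcpow. rewrite <- (Cmult_1_l (/ _)), <- (Cexp_opp (z * RtoC (ln u))), <- Cmult_assoc, Cinv_r by apply Cexp_neq_0.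
  rewrite Cmult_1_r. f_equal. ring.
Qed.

Lemma Rcpow_succ (u : R) (z : C) : 0 < u -> Rcpow u (z + 1) = Rcpow u z * RtoC u.
Proof.
  intros Hu. unfold Rcpow. rewrite Cmult_plus_distr_r, Cexp_plus, Cmult_1_l. f_equal.
  unfold Cexp; simpl. rewrite exp_ln, cos_0, sin_0 by exact Hu. apply C_eq; simpl; ring.
Qed.

Lemma Rcpow_neq_0 (u : R) (z : C) : Rcpow u z <> 0.
Proof. apply Cexp_neq_0. Qed.

Lemma lpow_1_div (z : C) (u : R) : 0 < u -> lpow 1 0 z u / RtoC u = / Rcpow u (z + 1).
Proof.
  intros Hu. rewrite lpow_1_u, Rcpow_opp, Rcpow_succ by exact Hu.
  field. split; [apply RtoC_neq_0; lra|apply Rcpow_neq_0].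
Qed.

Lemma lpow_unit (k : nat) (z : C) (u : R) : lpow 1 k z u = Rcpow u (- z) * Cpow (- ln u) k.
Proof. unfold lpow. rewrite Rmult_1_l, RtoC_opp. reflexivity. Qed.

Lemma C_derive_n_Rcpow (u : R) (r : nat) (s : C) : C_derive_n r (fun z => Rcpow u (- z)) s = lpow 1 r s u.
Proof. apply C_derive_n_lpow. intros z. rewrite Rmult_1_l. reflexivity. Qed.

Lemma C_derive_n_mul_Rcpow (u : R) (r : nat) (s : C) :
  C_derive_n r (fun z => z * Rcpow u (- z)) s = mul_id (fun k z => lpow 1 k z u) r s.
Proof. apply C_derive_n_mul_lpow. intros z. rewrite Rmult_1_l. reflexivity. Qed.

Lemma infC_psi_mul (c al x : R) (r : nat) (s : C) : 0 < c -> 0 < al <= 1 -> 0 < x -> 0 < Re s ->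
  is_RInt_infty (fun u => psi (u - al) / u * C_derive_n r (fun z => z * Rcpow (c * u) (- z)) s) x
    (mul_id (GI (fun u => RtoC (psi (u - al))) c x) r s).
Proof.
  intros Hc Hal Hx Hs.
  eapply infC_ext; [|apply (infC_mul_id (fun u => RtoC (psi (u - al))) c x r s Hc Hx (admissible_psi al x Hal Hx) Hs)].
  intros u _. cbv beta. rewrite (C_derive_n_mul_lpow c u) by reflexivity. unfold Cdiv. ring.
Qed.

Lemma infC_psi_div (al x : R) (s : C) : 0 < al <= 1 -> 0 < x -> 0 < Re s ->
  is_RInt_infty (fun u => psi (u - al) / Rcpow u (s + 1)) x (GI (fun u => RtoC (psi (u - al))) 1 x 0 s).
Proof.
  intros Hal Hx Hs.
  eapply infC_ext; [|apply (GI_correct (fun u => RtoC (psi (u - al))) 1 x 0 s Rlt_0_1 Hx (admissible_psi al x Hal Hx) Hs)].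
  intros u Hu. cbv beta. rewrite lpow_1_div by lra. reflexivity.
Qed.

Lemma mul_id_0 (F : nat -> C -> C) (z : C) : mul_id F 0 z = z * F 0%nat z.
Proof. unfold mul_id. simpl (INR 0). ring. Qed.

Lemma sum_upto_mod_ext (y : R) (a q : nat) (f g : nat -> C) :
  (forall n, (1 <= n)%nat -> f n = g n) -> sum_upto_mod y a q f = sum_upto_mod y a q g.
Proof.
  intros H. apply sum_upto_ext. intros n _.
  destruct (Nat.leb 1 n) eqn:E; [|reflexivity]. apply Nat.leb_le in E. rewrite (H n E). reflexivity.
Qed.

Lemma pole_part_unit (X : R) (s : C) : 0 < X -> Rcpow X (1 - s) / (s - 1) = pole_part X 0 s.
Proof.
  intros HX. simpl. rewrite lpow_1_u. f_equal. replace (1 - s) with (- s + 1) by ring.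
  rewrite Rcpow_succ by exact HX. apply Cmult_comm.
Qed.

Lemma euler_part_fraction (X : R) (a q r : nat) (s : C) : (1 <= a <= q)%nat ->
  euler_part (INR q) (INR a / INR q) (X / INR q) r s
  = sum_upto_mod X a q (fun n => lpow 1 r s (INR n)) + psi ((X - INR a) / INR q) * lpow 1 r s X
    - mul_id (GI (fun u => RtoC (psi (u - INR a / INR q))) (INR q) (X / INR q)) r s.
Proof.
  intros Haq. destruct (fraction_range a q Haq) as [Hq _].
  unfold euler_part. rewrite sum_lpow_residue by exact Haq.
  replace (X / INR q - INR a / INR q)%R with ((X - INR a) / INR q)%R by (field; lra).
  replace (lpow (INR q) r s (X / INR q)) with (lpow 1 r s X); [reflexivity|].
  unfold lpow. replace (INR q * (X / INR q))%R with (1 * X)%R by (field; lra). reflexivity.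
Qed.

Theorem theorem1 :
  forall (s : C) (alpha : R),
  0 < Re s <= 1 -> 0 <= Im s -> 0 < alpha <= 1 ->
  (* I *)
  (s <> 1 -> forall x : R, 0 < x ->
    (exists J : C,
      is_RInt_infty (fun u => psi (u - alpha) / Rcpow u (s + 1)) x J /\
      hurwitz_zeta alpha s - Rcpow x (1 - s) / (s - 1)
      = sum_upto (x - alpha) (fun n => Rcpow (INR n + alpha) (- s))
        + psi (x - alpha) * Rcpow x (- s)
        - s * J)
    /\
    (forall r : nat, exists J : C,
      is_RInt_infty (fun u =>
        psi (u - alpha) / u * C_derive_n r (fun z => z * Rcpow u (- z)) s) x J /\
      C_derive_n r (hurwitz_zeta alpha) s
        - C_derive_n r (fun z => Rcpow x (1 - z) / (z - 1)) s
      = sum_upto (x - alpha)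
          (fun n => C_derive_n r (fun z => Rcpow (INR n + alpha) (- z)) s)
        + psi (x - alpha) * C_derive_n r (fun z => Rcpow x (- z)) s
        - J))
  /\
  (* II *)
  (s <> 1 -> forall a q : nat, (1 <= a <= q)%nat -> forall X : R, 0 < X ->
    (exists J : C,
      is_RInt_infty
        (fun u => psi (u - INR a / INR q) / Rcpow u (s + 1)) (X / INR q) J /\
      Z_fun a q s - Rcpow X (1 - s) / (INR q * (s - 1))
      = sum_upto_mod X a q (fun n => Rcpow (INR n) (- s))
        + psi ((X - INR a) / INR q) * Rcpow X (- s)
        - s * Rcpow (INR q) (- s) * J)
    /\
    (forall r : nat, exists J : C,
      is_RInt_infty (fun u =>
        psi (u - INR a / INR q) / u
        * C_derive_n r (fun z => z * Rcpow (INR q * u) (- z)) s) (X / INR q) J /\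
      C_derive_n r (Z_fun a q) s
        - 1 / INR q * C_derive_n r (fun z => Rcpow X (1 - z) / (z - 1)) s
      = sum_upto_mod X a q
          (fun n => C_derive_n r (fun z => Rcpow (INR n) (- z)) s)
        + psi ((X - INR a) / INR q) * C_derive_n r (fun z => Rcpow X (- z)) s
        - J))
  /\
  (* III *)
  (forall (q : nat) (chi : Z -> C),
    (1 <= q)%nat -> dirichlet_character q chi -> ~ principal q chi ->
    forall X : R, 0 < X ->
    (exists J : nat -> C,
      (forall a : nat, (1 <= a <= q)%nat ->
        is_RInt_infty (fun u =>
          psi (u - INR a / INR q) / u * (s * Rcpow (INR q * u) (- s)))
          (X / INR q) (J a)) /\
      dirichlet_L q chi s
      = sum_n_m (fun a =>
          chi (Z.of_nat a) *
          (sum_upto_mod X a q (fun n => Rcpow (INR n) (- s))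
           + Rcpow X (- s) * psi ((X - INR a) / INR q)
           - J a)) 1 q)
    /\
    (forall r : nat, exists J : nat -> C,
      (forall a : nat, (1 <= a <= q)%nat ->
        is_RInt_infty (fun u =>
          psi (u - INR a / INR q) / u
          * C_derive_n r (fun z => z * Rcpow (INR q * u) (- z)) s)
          (X / INR q) (J a)) /\
      C_derive_n r (dirichlet_L q chi) s
      = sum_n_m (fun a =>
          chi (Z.of_nat a) *
          (sum_upto_mod X a q
             (fun n => Rcpow (INR n) (- s) * Cpow (- ln (INR n)) r)
           + psi ((X - INR a) / INR q) * C_derive_n r (fun z => Rcpow X (- z)) s
           - J a)) 1 q))
  /\
  (* IV *)
  (forall x lambda : R, 0 < x -> 0 < lambda < 1 ->
    (exists J1 J2 J3 : C,
      is_RInt_infty (fun u => expi (lambda * (u - alpha)) / Rcpow u s) x J1 /\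
      is_RInt_infty (fun u =>
        psi (u - alpha) * (expi (lambda * (u - alpha)) / Rcpow u s)) x J2 /\
      is_RInt_infty (fun u =>
        psi (u - alpha) * (expi (lambda * (u - alpha)) / Rcpow u (s + 1))) x J3 /\
      lerch_phi lambda alpha s
      = sum_upto (x - alpha)
          (fun n => expi (lambda * INR n) * Rcpow (INR n + alpha) (- s))
        + J1
        + 2 * PI * Ci * lambda * J2
        - s * J3
        + expi (lambda * (x - alpha)) / Rcpow x s * psi (x - alpha))
    /\
    (forall r : nat, exists J1 J2 J3 : C,
      is_RInt_infty (fun u =>
        expi (lambda * (u - alpha)) * C_derive_n r (fun z => Rcpow u (- z)) s)
        x J1 /\
      is_RInt_infty (fun u =>
        psi (u - alpha) * expi (lambda * (u - alpha))
        * C_derive_n r (fun z => Rcpow u (- z)) s) x J2 /\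
      is_RInt_infty (fun u =>
        psi (u - alpha) / u * expi (lambda * (u - alpha))
        * C_derive_n r (fun z => z * Rcpow u (- z)) s) x J3 /\
      C_derive_n r (lerch_phi lambda alpha) s
      = sum_upto (x - alpha) (fun n =>
          expi (lambda * INR n)
          * C_derive_n r (fun z => Rcpow (INR n + alpha) (- z)) s)
        + J1
        + 2 * PI * Ci * lambda * J2
        - J3
        + expi (lambda * (x - alpha)) * psi (x - alpha)
          * C_derive_n r (fun z => Rcpow x (- z)) s)).
Proof.
  intros s alpha [Hs _] _ Ha. split; [|split; [|split]].
  - intros Hs1 x Hx. split.
    + exists (GI (fun u => RtoC (psi (u - alpha))) 1 x 0 s).
      split; [apply infC_psi_div; assumption|].
      rewrite (hurwitz_zeta_eq alpha x s Ha Hx Hs Hs1), pole_part_unit by exact Hx.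
      unfold euler_part. rewrite mul_id_0, lpow_1_u.
      rewrite (sum_upto_ext _ (fun n => lpow 1 0 s (INR n + alpha)%R) (fun n => Rcpow (INR n + alpha) (- s)))
        by (intros; apply lpow_1_u).
      ring.
    + intros r. exists (mul_id (GI (fun u => RtoC (psi (u - alpha))) 1 x) r s). split.
      * eapply infC_ext; [|apply (infC_psi_mul 1 alpha x r s Rlt_0_1 Ha Hx Hs)].
        intros u _. cbv beta. rewrite Rmult_1_l. reflexivity.
      * rewrite (C_derive_n_euler 1 alpha x x 1 _ r s Rlt_0_1 Ha Hx Hs Hs1).
        2:{ intros z Hz Hz1. rewrite (hurwitz_zeta_eq alpha x z Ha Hx Hz Hz1). ring. }
        rewrite C_derive_n_pole, C_derive_n_Rcpow by assumption. unfold euler_part.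
        rewrite (sum_upto_ext _ (fun n => C_derive_n r (fun z => Rcpow (INR n + alpha) (- z)) s) (fun n => lpow 1 r s (INR n + alpha)%R))
          by (intros; apply C_derive_n_Rcpow).
        ring.
  - intros Hs1 a q Haq X HX. destruct (fraction_range a q Haq) as [Hq Hal].
    assert (Hx : 0 < X / INR q) by (apply Rdiv_lt_0_compat; lra).
    assert (Hq0 : RtoC (INR q) <> 0) by (apply RtoC_neq_0; lra).
    split.
    + exists (GI (fun u => RtoC (psi (u - INR a / INR q))) 1 (X / INR q) 0 s).
      split; [apply infC_psi_div; assumption|].
      rewrite (Z_fun_eq a q X s Haq HX Hs Hs1), euler_part_fraction, mul_id_0 by exact Haq.
      (* The integral here has the kernel with c = 1, the factor q^(-s) standing outside. *)
      rewrite GI_scale by (try apply admissible_psi; assumption).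
      rewrite (sum_upto_mod_ext X a q (fun n => lpow 1 0 s (INR n)) (fun n => Rcpow (INR n) (- s))) by (intros; apply lpow_1_u).
      rewrite lpow_1_u.
      replace (Rcpow X (1 - s) / (INR q * (s - 1))) with (/ INR q * (Rcpow X (1 - s) / (s - 1)))
        by (field; split; [apply Cminus_neq_0, Hs1|exact Hq0]).
      rewrite pole_part_unit by exact HX. ring.
    + intros r. exists (mul_id (GI (fun u => RtoC (psi (u - INR a / INR q))) (INR q) (X / INR q)) r s).
      split; [apply infC_psi_mul; assumption|].
      rewrite (C_derive_n_euler (INR q) (INR a / INR q) (X / INR q) X (/ INR q) _ r s Hq Hal Hx Hs Hs1).
      2:{ intros z Hz Hz1. apply Z_fun_eq; assumption. }
      rewrite C_derive_n_pole, C_derive_n_Rcpow, euler_part_fraction by assumption.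
      rewrite (sum_upto_mod_ext X a q (fun n => C_derive_n r (fun z => Rcpow (INR n) (- z)) s) (fun n => lpow 1 r s (INR n)))
        by (intros; apply C_derive_n_Rcpow).
      unfold Cdiv. ring.
  - intros q chi Hq Hchi Hnp X HX.
    assert (HqR : 0 < INR q) by (apply lt_0_INR; lia).
    assert (Hx : 0 < X / INR q) by (apply Rdiv_lt_0_compat; lra).
    split; [|intros r];
      [exists (fun a => mul_id (GI (fun u => RtoC (psi (u - INR a / INR q))) (INR q) (X / INR q)) 0 s)
      |exists (fun a => mul_id (GI (fun u => RtoC (psi (u - INR a / INR q))) (INR q) (X / INR q)) r s)]; split.
    + intros a Haq. apply (infC_psi_mul (INR q) (INR a / INR q) (X / INR q) 0 s HqR (proj2 (fraction_range a q Haq)) Hx Hs).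
    + rewrite (dirichlet_L_eq q chi X s Hq Hchi Hnp HX Hs). apply sumC_n_m_ext. intros a Haq.
      rewrite euler_part_fraction, lpow_1_u by exact Haq.
      rewrite (sum_upto_mod_ext X a q (fun n => lpow 1 0 s (INR n)) (fun n => Rcpow (INR n) (- s))) by (intros; apply lpow_1_u).
      ring.
    + intros a Haq. apply (infC_psi_mul (INR q) (INR a / INR q) (X / INR q) r s HqR (proj2 (fraction_range a q Haq)) Hx Hs).
    + rewrite (C_derive_n_dirichlet_L q chi X r s Hq Hchi Hnp HX Hs). apply sumC_n_m_ext. intros a Haq.
      rewrite euler_part_fraction, C_derive_n_Rcpow by exact Haq.
      rewrite (sum_upto_mod_ext X a q (fun n => lpow 1 r s (INR n)) (fun n => Rcpow (INR n) (- s) * Cpow (- ln (INR n)) r)) by (intros; apply lpow_unit).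
      reflexivity.
  - intros x lambda Hx Hl.
    assert (HQ : admissible (fun u => RtoC (psi (u - alpha)) * expi (lambda * (u - alpha))) x).
    { apply (admissible_mult _ (fun u => expi (lambda * (u - alpha))) x 1); [intros u _; apply contC_expi| |apply admissible_psi; assumption].
      intros u _. rewrite expi_mod. lra. }
    split.
    (* The undifferentiated formula is the case r = 0, where [C_derive_n 0] returns the function
       itself by computation. *)
    + destruct (C_derive_n_lerch lambda alpha x 0 s Hl Ha Hx Hs) as (J1 & J2 & H1 & H2 & E).
      exists J1, J2, (GI (fun u => RtoC (psi (u - alpha)) * expi (lambda * (u - alpha))) 1 x 0 s).
      split; [|split; [|split]].
      * eapply infC_ext; [|exact H1]. intros u _. cbv beta. rewrite lpow_1_u, Rcpow_opp. reflexivity.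
      * eapply infC_ext; [|exact H2]. intros u _. cbv beta. rewrite lpow_1_u, Rcpow_opp. unfold Cdiv. ring.
      * eapply infC_ext; [|apply (GI_correct _ 1 x 0 s Rlt_0_1 Hx HQ Hs)].
        intros u Hu. cbv beta. rewrite lpow_1_div by lra. unfold Cdiv. ring.
      * change (C_derive_n 0 (lerch_phi lambda alpha) s) with (lerch_phi lambda alpha s) in E.
        rewrite E, mul_id_0, lpow_1_u, Rcpow_opp.
        rewrite (sum_upto_ext _ (fun n => expi (lambda * INR n) * lpow 1 0 s (INR n + alpha)%R) (fun n => expi (lambda * INR n) * Rcpow (INR n + alpha) (- s)))
          by (intros; rewrite lpow_1_u; reflexivity).
        unfold Cdiv. ring.
    + intros r. destruct (C_derive_n_lerch lambda alpha x r s Hl Ha Hx Hs) as (J1 & J2 & H1 & H2 & E).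
      exists J1, J2, (mul_id (GI (fun u => RtoC (psi (u - alpha)) * expi (lambda * (u - alpha))) 1 x) r s).
      split; [|split; [|split]].
      * eapply infC_ext; [|exact H1]. intros u _. cbv beta. rewrite C_derive_n_Rcpow. reflexivity.
      * eapply infC_ext; [|exact H2]. intros u _. cbv beta. rewrite C_derive_n_Rcpow. reflexivity.
      * eapply infC_ext; [|apply (infC_mul_id _ 1 x r s Rlt_0_1 Hx HQ Hs)].
        intros u _. cbv beta. rewrite C_derive_n_mul_Rcpow. unfold Cdiv. ring.
      * rewrite E, C_derive_n_Rcpow.
        rewrite (sum_upto_ext _ (fun n => expi (lambda * INR n) * C_derive_n r (fun z => Rcpow (INR n + alpha) (- z)) s)
          (fun n => expi (lambda * INR n) * lpow 1 r s (INR n + alpha)%R)) by (intros; rewrite C_derive_n_Rcpow; reflexivity).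
        reflexivity.
Qed.
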